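(* Assume the rank condition stated in the context, $R>0$ and $AR=RA'$. For every $t\ge0$ one has the $L_2(\eta^h_\infty)$-spectral decomposition $$\mathcal{K}^h_t(x,dy)=\sum_{n\in\mathbb{N}^r}e^{-\lambda^h_nt}\,\varphi^h_n(x)\,\varphi^h_n(y)\,\eta^h_\infty(dy),$$ where the functions $$\varphi^h_n(x):=\frac1{\sqrt{n!}}\,\mathbb{H}^r_n\left(\mathcal{Z}'(P^h_\infty)^{-1/2}x\right),\qquad n\in\mathbb{N}^r,$$ form an orthonormal basis of $L_2(\eta^h_\infty)$ consisting of eigenfunctions, and the corresponding eigenvalues are $$\lambda^h_n:=\sum_{1\le i\le r}n_i\,\lambda^h_i.$$
   Context: Setting: $r\ge1$; $A,R,S$ are real $r\times r$ matrices, $R,S$ symmetric positive semi-definite; $'$ denotes transposition; $\mathbb{N}=\{0,1,2,\ldots\}$. Rank condition: the matrices $[R^{1/2},AR^{1/2},\ldots,A^{r-1}R^{1/2}]$ and $[S^{1/2},A'S^{1/2},\ldots,(A')^{r-1}S^{1/2}]$ both have rank $r$. Under this condition let $P_\infty$ be the unique positive definite solution of $AP+PA'+R-PSP=0$ and $Q_\infty$ the unique positive definite solution of $A'Q+QA-QRQ+S=0$. Let $BB'=R$, $W_t$ a Brownian motion; the $h$-process solves $dX^h_t=(A-RQ_\infty)X^h_t\,dt+B\,dW_t$ and $\mathcal{K}^h_t(x,dy)=\mathbb{P}(X^h_t\in dy\mid X^h_0=x)$. Put $P^h_\infty=(P_\infty^{-1}+Q_\infty)^{-1}$, $\eta^h_\infty=\mathcal{N}(0,P^h_\infty)$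 (centered Gaussian). When $R>0$ and $AR=RA'$, the matrix $A^2+RS$ has positive eigenvalues; $(A^2+RS)^{1/2}$ denotes its square root with positive eigenvalues. Set $\Lambda^h:=-(P^h_\infty)^{-1/2}(A^2+RS)^{1/2}(P^h_\infty)^{1/2}$, which is a symmetric negative definite matrix, with principal symmetric square roots $(P^h_\infty)^{\pm1/2}$. $\mathcal{Z}=(z_1,\ldots,z_r)$ is an orthogonal matrix whose columns are orthonormal eigenvectors $z_i$ of $\Lambda^h$ with eigenvalue $-\lambda^h_i<0$, where $\lambda_1^h\le\cdots\le\lambda^h_r$ are the square roots of the eigenvalues of $A^2+RS$. For $n=(n_1,\ldots,n_r)\in\mathbb{N}^r$, $n!=n_1!\cdots n_r!$, $u^n=u_1^{n_1}\cdots u_r^{n_r}$. The multivariate Chebychev-Hermite polynomials $\mathbb{H}^r_n$ are defined by $\sum_{n\in\mathbb{N}^r}\frac{u^n}{n!}\mathbb{H}^r_n(x)=\exp(u'x-\frac12u'u)$. Decompositions are understood in the $L_2(\eta^h_\infty)$ sense, i.e. $\mathcal{K}^h_t(f)=\sum_ne^{-\lambda_n^ht}\eta^h_\infty(f\varphi^h_n)\varphi^h_n$ for $f\in L_2(\eta^h_\infty)$. The scalars $\lambda_i^h$ (index $i\in\{1,\dots,r\}$) and $\lambda_n^h$ (multi-index $n$) are distinguished by their index. *)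

(* Defs.v *)
From HB Require Import structures.
From mathcomp Require Import all_boot all_order all_algebra finmap.
From mathcomp.analysis.showcase Require Import summability.
From mathcomp Require Import all_classical all_reals all_analysis.

Set Implicit Arguments.
Unset Strict Implicit.
Unset Printing Implicit Defensive.

Import Order.TTheory GRing.Theory Num.Theory.
Import numFieldTopology.Exports numFieldNormedType.Exports.

Local Open Scope classical_set_scope.
Local Open Scope ring_scope.

(* Product (= Borel) sigma-algebra on column vectors, generated by the
   coordinate projections. *)
Section measurable_cV.
Context (F : realType) (n : nat).

Let coor (i : 'I_n) (x : 'cV[F]_n) : F := x i 0.

Let cV_set0 : g_sigma_preimage coor set0.
Proof. exact: sigma_algebra0. Qed.

Let cV_setC D : g_sigma_preimage coor D -> g_sigma_preimage coor (~` D).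
Proof. exact: sigma_algebraC. Qed.

Let cV_bigcup (G : (set 'cV[F]_n)^nat) :
  (forall i, g_sigma_preimage coor (G i)) ->
  g_sigma_preimage coor (\bigcup_i (G i)).
Proof. exact: sigma_algebra_bigcup. Qed.

HB.instance Definition _ := @isMeasurable.Build default_measure_display
  'cV[F]_n (g_sigma_preimage coor) cV_set0 cV_setC cV_bigcup.

End measurable_cV.

Section matrices.
Context (F : realType) (r : nat).
Implicit Types M X : 'M[F]_r.

Definition dotv n (u v : 'cV[F]_n) : F := (u^T *m v) 0 0.

Definition symmx M := M^T = M.

Definition psdmx M := symmx M /\ forall x : 'cV[F]_r, 0 <= dotv x (M *m x).

Definition pdmx M :=
  symmx M /\ forall x : 'cV[F]_r, x != 0 -> 0 < dotv x (M *m x).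

(* The principal square root of a positive semi-definite matrix (unique;
   the default value 0 is irrelevant for such matrices). *)
Definition psd_sqrt M : 'M[F]_r := xget 0 [set X | psdmx X /\ X *m X = M].

(* All complex eigenvalues of M are real and positive. *)
Definition pos_spectrum M :=
  exists2 s : seq F, all (> 0) s & char_poly M = \prod_(a <- s) ('X - a%:P).

(* The square root with positive eigenvalues of a not necessarily symmetric
   matrix with positive eigenvalues (unique for such matrices). *)
Definition pos_sqrt M : 'M[F]_r := xget 0 [set X | pos_spectrum X /\ X *m X = M].

Definition krylov M X := \mxrow_(k < r) (M ^+ k *m X).

Definition rank_condition (A R S : 'M[F]_r) :=
  \rank (krylov A (psd_sqrt R)) = r /\ \rank (krylov A^T (psd_sqrt S)) = r.

Definition riccati (A R S P : 'M[F]_r) :=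
  A *m P + P *m A^T + R - P *m S *m P = 0.

End matrices.

Section gaussian.
Context (F : realType).

Definition gauss1 (v : F) : set F -> \bar F :=
  if v == 0 then \d_(0 : F) else normal_prob 0 (Num.sqrt v).

(* mu = N(0, V): every linear functional u'x has law N(0, u'Vu). *)
Definition centered_gaussian n (mu : set 'cV[F]_n -> \bar F) (V : 'M[F]_n) :=
  forall (u : 'cV[F]_n) (D : set F), measurable D ->
    mu [set x | D (dotv u x)] = gauss1 (dotv u (V *m u)) D.

End gaussian.

Section diffusion.
Context (F : realType) (d : measure_display) (Om : measurableType d).
Variable Pr : probability Om F.

Definition mutually_independent k n (Y : 'I_k -> Om -> 'cV[F]_n) :=
  forall D : 'I_k -> set 'cV[F]_n, (forall i, measurable (D i)) ->
    Pr (\bigcap_i (Y i @^-1` D i)) = (\prod_(i < k) Pr (Y i @^-1` D i))%E.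

(* Standard n-dimensional Brownian motion; only times t >= 0 matter. *)
Definition brownian n (W : F -> {RV Pr >-> 'cV[F]_n}) :=
  [/\ {ae Pr, forall w, W 0 w = 0},
      {ae Pr, forall w, {within `[0, +oo[, continuous (fun t => W t w)}},
      forall s t, 0 <= s <= t ->
        centered_gaussian (pushforward Pr (fun w => W t w - W s w))
          ((t - s)%:M) &
      forall k (t : nat -> F), 0 <= t 0%N -> (forall i, t i <= t i.+1) ->
        mutually_independent (fun (i : 'I_k) w => W (t i.+1) w - W (t i) w)].

(* X solves dX = M X dt + B dW, X_0 = x. The noise is additive, so the
   integrated equation involves no stochastic integral. *)
Definition linear_sde r n (M : 'M[F]_r) (B : 'M[F]_(r, n))
    (W : F -> {RV Pr >-> 'cV[F]_n}) (x : 'cV[F]_r)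
    (X : F -> {RV Pr >-> 'cV[F]_r}) :=
  {ae Pr, forall w, {within `[0, +oo[, continuous (fun t => X t w)} /\
    forall t, 0 <= t ->
      X t w = x
        + \col_i (\int[lebesgue_measure]_(s in `[0, t]) (M *m X s w) i 0)
        + B *m W t w}.

(* K_t(f)(x), where K_t(x,dy) is the law at time t of the process X x started
   at x. *)
Definition kernel_op r (X : 'cV[F]_r -> F -> {RV Pr >-> 'cV[F]_r}) (t : F)
    (f : 'cV[F]_r -> F) (x : 'cV[F]_r) : F :=
  \int[distribution Pr (X x t)]_y f y.

End diffusion.

Section hermite.
Context (F : realType) (r : nat).
Local Notation multi := {ffun 'I_r -> nat}.

Definition mfact (n : multi) : nat := (\prod_i (n i)`!)%N.

Definition mpow (u : 'cV[F]_r) (n : multi) : F := \prod_i u i 0 ^+ n i.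

(* Series over multi-indices are limits of finite partial sums along the
   directed set of finite subsets of N^r. *)
Definition hermite_family (H : multi -> 'cV[F]_r -> F) :=
  forall u x : 'cV[F]_r,
    (\sum_(n <- (J : {fset multi})) mpow u n / (mfact n)%:R * H n x)
      @[J --> totally] --> expR (dotv u x - 2^-1 * dotv u u).

End hermite.

Section L2.
Context (F : realType) (d : measure_display) (T : measurableType d).
Variables (eta : probability T F) (I : choiceType).

Definition inner (f g : T -> F) : F := \int[eta]_x (f x * g x).

(* f = \sum_(i : I) g i, with convergence in L2(eta). *)
Definition L2_sum (g : I -> T -> F) (f : T -> F) :=
  ('N[eta]_2%:E[EFin \o (fun x => f x - \sum_(i <- (J : {fset I})) g i x)%R])%E
    @[J --> totally] --> 0%E.

Definition orthonormal_basis (e : I -> T -> F) :=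
  [/\ forall i, e i \in Lfun eta 2%:E,
      forall i j, inner (e i) (e j) = (i == j)%:R &
      forall f, f \in Lfun eta 2%:E ->
        L2_sum (fun i x => inner f (e i) * e i x) f].

End L2.

(* Main.v *)
(** Put [M = A - R Qinf] and [T = Z' Ph^(-1/2)].  The Riccati equations give
    the Lyapunov equation [M Ph + Ph M' + R = 0] and [M^2 = A^2 + R S]; with
    [A R = R A'] they force [M = - (A^2 + R S)^(1/2)], so that [T] diagonalises
    everything at once: [T Ph T' = 1], [T M = - diag(lam) T] and
    [T R T' = 2 diag(lam)].  In the coordinates [T x] the h-process consists of
    independent scalar Ornstein-Uhlenbeck processes, i.e. [T X_t] is
    [exp (- lam t) T x] plus a centered Gaussian vector with independent
    coordinates of variance [1 - exp (- 2 lam t)], and Mehler's formula shows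
    that products of Hermite polynomials are eigenfunctions for every [x].
    The Gaussian law is invariant, so that [K_t] is a contraction of
    [L2(eta)], and the expansion of [K_t f] follows from that of [f].

    Gaussian vectors are handled only through their exponential moments.
    Expectations of Hermite products are read off generating functions, by
    uniqueness of the coefficients of a multiple power series.  The Gaussian
    noise is an almost sure limit of sums over Brownian increments, which
    identifies its moment generating function.  Polynomials are dense in
    [L2(mu)] when [mu] has exponential moments; applied to the sum of two laws
    with equal Hermite moments, this gives uniqueness of the Gaussian law. *)

Require Import Defs.
From HB Require Import structures.
From mathcomp Require Import all_boot all_order all_algebra finmap.
From mathcomp Require Import all_classical all_reals all_analysis.
From mathcomp Require Import measurable_realfun.
From mathcomp Require Import zify ring lra.
From mathcomp.analysis.showcase Require Import summability.
Import Order.TTheory GRing.Theory Num.Theory.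
Import numFieldTopology.Exports numFieldNormedType.Exports.
Set Implicit Arguments.
Unset Strict Implicit.
Unset Printing Implicit Defensive.
Local Open Scope classical_set_scope.
Local Open Scope ring_scope.

(** * Simultaneous diagonalisation *)

Section matrix_facts.
Context (F : realType) (r : nat).
Implicit Types (M G : 'M[F]_r) (x y : 'cV[F]_r).

Lemma dotvDr x y z : dotv z (x + y) = dotv z x + dotv z y.
Proof. by rewrite /dotv mulmxDr mxE. Qed.

Lemma dotvE x y : dotv x y = \sum_i x i 0 * y i 0.
Proof. by rewrite /dotv mxE; apply: eq_bigr => i _; rewrite mxE. Qed.

Lemma dotvC x y : dotv x y = dotv y x.
Proof. by rewrite !dotvE; apply: eq_bigr => i _; rewrite mulrC. Qed.

Lemma dotv_mulmxl k (N : 'M[F]_(r, k)) (u : 'cV[F]_k) x :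
  dotv (N *m u) x = dotv u (N^T *m x).
Proof. by rewrite /dotv trmx_mul mulmxA. Qed.

Lemma dotvv_ge0 x : 0 <= dotv x x.
Proof. by rewrite dotvE sumr_ge0// => i _; rewrite -expr2 sqr_ge0. Qed.

Lemma pdmx_unit M : pdmx M -> M \in unitmx.
Proof.
move=> [Msym Mpos]; rewrite unitmxE unitfE; apply/negP => /det0P[v v0 vM].
have : 0 < dotv v^T (M *m v^T).
  by apply: Mpos; apply: contra_neq v0 => v0; rewrite -[v]trmxK v0 trmx0.
by rewrite /dotv trmxK mulmxA vM mul0mx mxE ltxx.
Qed.

Lemma symmx_inv M : symmx M -> symmx (invmx M).
Proof. by rewrite /symmx trmx_inv => ->. Qed.

Lemma pdmx_inv M : pdmx M -> pdmx (invmx M).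
Proof.
move=> Mpd; have Mu := pdmx_unit Mpd; case: Mpd => Ms Mp.
split; first exact: symmx_inv.
move=> x x0; have y0 : invmx M *m x != 0.
  apply: contra_neq x0 => e.
  by rewrite -[x]mul1mx -(mulmxV Mu) -mulmxA e mulmx0.
have := Mp _ y0; rewrite mulmxA mulmxV// mul1mx.
by rewrite dotv_mulmxl (symmx_inv Ms) dotvC dotv_mulmxl (symmx_inv Ms).
Qed.

Lemma pdmxD M G : pdmx M -> pdmx G -> pdmx (M + G).
Proof.
move=> [Ms Mp] [Gs Gp]; split; first by rewrite /symmx linearD/= Ms Gs.
by move=> x x0; rewrite mulmxDl dotvDr addr_gt0 ?Mp ?Gp.
Qed.

Lemma mulmx_invmx_unit M G : M *m M = G -> G \in unitmx -> M \in unitmx.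
Proof. by move=> <-; rewrite unitmx_mul => /andP[]. Qed.

End matrix_facts.

Section invariant_covariance.
Context (F : realType) (r : nat) (A R S P Q : 'M[F]_r).
Hypotheses (Ppd : pdmx P) (Psol : riccati A R S P).
Hypotheses (Qpd : pdmx Q) (Qsol : riccati A^T S R Q).

Let M := A - R *m Q.
Let G := invmx P + Q.

Lemma lyapunov_inv : symmx R ->
  M *m invmx G + invmx G *m M^T + R = 0.
Proof.
move=> Rs; have Pu := pdmx_unit Ppd.
have Gpd : pdmx G by apply: pdmxD => //; exact: pdmx_inv.
have Gu := pdmx_unit Gpd.
have Qs : Q^T = Q by case: Qpd.
have e1 : invmx P *m A + A^T *m invmx P + invmx P *m R *m invmx P - S = 0.
  have := congr1 (fun X => invmx P *m X *m invmx P) Psol.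
  rewrite mulmx0 mul0mx mulmxBr !mulmxDr !mulmxBl !mulmxDl !mulmxA.
  rewrite mulVmx// !mul1mx -[_ *m A *m P *m _]mulmxA mulmxV// mulmx1.
  by rewrite -[S *m P *m _]mulmxA mulmxV// mulmx1.
have e2 : A^T *m Q + Q *m A - Q *m R *m Q + S = 0.
  by rewrite -Qsol trmxK addrAC.
have e3 : G *m M + M^T *m G + G *m R *m G = 0.
  have MT : M^T = A^T - Q *m R by rewrite /M linearB/= trmx_mul Qs Rs.
  rewrite MT /M mulmxBr mulmxBl.
  have eP : invmx P = G - Q by rewrite /G addrK.
  clearbody G.
  have := congr2 +%R e1 e2; rewrite addr0 eP.
  rewrite !(mulmxBl, mulmxBr, mulmxDl, mulmxDr, mulNmx) !mulmxA => <-.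
  move: (G *m A) (Q *m A) (A^T *m G) (A^T *m Q) (G *m R *m G) (G *m R *m Q)
    (Q *m R *m G) (Q *m R *m Q) => a b c d0 e f g h.
  apply/matrixP => i j; rewrite !mxE; ring.
clearbody G M; have := congr1 (fun X => invmx G *m X *m invmx G) e3.
rewrite mulmx0 mul0mx !mulmxDr !mulmxDl !mulmxA mulVmx// !mul1mx.
rewrite -[_ *m M^T *m G *m _]mulmxA mulmxV// mulmx1.
by rewrite -[R *m G *m _]mulmxA mulmxV// mulmx1.
Qed.

Lemma hdrift_sqr : A *m R = R *m A^T -> M *m M = A *m A + R *m S.
Proof.
move=> AR; have := congr1 (mulmx R) Qsol; rewrite mulmx0 trmxK /M.
rewrite mulmxBr !mulmxDr !mulmxA -AR => e.
apply/eqP; rewrite -subr_eq0 -oppr_eq0 -[X in _ == X]e; apply/eqP.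
rewrite !(mulmxBl, mulmxBr, mulNmx, mulmxN) !mulmxA.
apply/matrixP => i j; rewrite !mxE; ring.
Qed.

End invariant_covariance.

Lemma spectral_coordinates (F : realType) (r : nat) (A R S P Q Z : 'M[F]_r)
  (lam : 'I_r -> F) (r_ge1 : (1 <= r)%N) (R_pd : pdmx R)
  (AR : A *m R = R *m A^T)
  (P_pd : pdmx P) (P_sol : riccati A R S P)
  (Q_pd : pdmx Q) (Q_sol : riccati A^T S R Q) :
  let Ph := invmx (invmx P + Q) in
  let C := pos_sqrt (A *m A + R *m S) in
  let Lam := - (invmx (psd_sqrt Ph) *m C *m psd_sqrt Ph) in
  let T := Z^T *m invmx (psd_sqrt Ph) in
  let D := diag_mx (\row_i lam i) in
  (forall i, 0 < lam i) -> Z^T *m Z = 1%:M ->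
  (forall i, Lam *m col i Z = - lam i *: col i Z) ->
  [/\ T \in unitmx, T *m Ph *m T^T = 1%:M,
      T *m (A - R *m Q) = - (D *m T) & T *m R *m T^T = 2 *: D].
Proof.
move=> Ph C Lam T D lam0 ZZ LamZ.
have Rs : R^T = R by case: R_pd.
have G_pd : pdmx (invmx P + Q) by apply: pdmxD => //; exact: pdmx_inv.
have Phu : Ph \in unitmx by rewrite unitmx_inv; exact: pdmx_unit.
have LamN0 : Lam != 0.
  apply/eqP => L0; have := LamZ (Ordinal r_ge1).
  rewrite L0 mul0mx => /esym/eqP; rewrite scaler_eq0 oppr_eq0 gt_eqF//=.
  move=> /eqP c0; have := congr1 (fun X : 'M[F]_r => X (Ordinal r_ge1) (Ordinal r_ge1)) ZZ.
  rewrite !mxE eqxx big1 => [/esym/eqP|j _]; first by rewrite oner_eq0.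
  have := congr1 (fun X : 'cV[F]_r => X j 0) c0; rewrite !mxE => ->.
  by rewrite mulr0.
have [C_spec CC] : pos_spectrum C /\ C *m C = A *m A + R *m S.
  move: (LamN0); rewrite /Lam /C /pos_sqrt.
  by case: xgetP => [X _ []//|_]; rewrite mulmx0 mul0mx oppr0 eqxx.
have [[Hs _] HH] : psdmx (psd_sqrt Ph) /\ psd_sqrt Ph *m psd_sqrt Ph = Ph.
  move: (LamN0); rewrite /Lam /psd_sqrt.
  by case: xgetP => [X _ []//|_]; rewrite mulmx0 oppr0 eqxx.
set H := psd_sqrt Ph in Hs HH Lam T LamZ LamN0 *.
have Hu : H \in unitmx by apply: mulmx_invmx_unit HH Phu.
have Zu : Z \in unitmx by have := mulmx1_unit ZZ => -[].
have ZZT : Z *m Z^T = 1%:M by exact: mulmx1C.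
have Tu : T \in unitmx by rewrite /T unitmx_mul unitmx_tr Zu unitmx_inv.
have TT : T^T = invmx H *m Z by rewrite /T trmx_mul trmxK (symmx_inv Hs).
have TPT : T *m Ph *m T^T = 1%:M.
  by rewrite TT /T -HH !mulmxA mulmxKV// -!mulmxA mulKVmx.
have LZ : Lam *m Z = - (Z *m D).
  apply/matrixP => i j; have := congr1 (fun X : 'cV[F]_r => X i 0) (LamZ j).
  rewrite [in LHS]colE mulmxA -colE [LHS]mxE => ->; rewrite !mxE.
  rewrite mulNr (bigD1 j)//= big1 ?addr0; last first.
    by move=> k kj; rewrite !mxE (negbTE kj) mulr0n mulr0.
  by rewrite !mxE eqxx mulr1n mulrC.
have TC : T *m C = D *m T.
  have ZL : Z^T *m Lam = - (D *m Z^T).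
    rewrite -[LHS]mulmx1 -ZZT mulmxA -[Z^T *m Lam *m Z]mulmxA LZ mulmxN mulmxA.
    by rewrite ZZ mul1mx mulNmx.
  have -> : T *m C = - (Z^T *m Lam *m invmx H).
    by rewrite /T /Lam mulmxN mulNmx opprK !mulmxA mulmxK.
  by rewrite ZL mulNmx opprK /T mulmxA.
set M := A - R *m Q.
have MM : M *m M = C *m C by rewrite CC; exact: hdrift_sqr.
have lyap := lyapunov_inv P_pd P_sol Q_pd Q_sol Rs.
rewrite -/M -/Ph in lyap.
clear TT; clearbody T M.
pose N := T *m M *m invmx T.
have NN : N *m N = D *m D.
  rewrite /N !mulmxA mulmxKV// -[T *m M *m M]mulmxA MM mulmxA TC.
  by rewrite -[D *m T *m C]mulmxA TC !mulmxA mulmxK.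
have TM : T *m M = N *m T by rewrite /N mulmxKV.
have lyapN : N + N^T + T *m R *m T^T = 0.
  have := congr1 (fun X => T *m X *m T^T) lyap.
  rewrite mulmx0 mul0mx !mulmxDr !mulmxDl !mulmxA TM.
  rewrite -[N *m T *m Ph]mulmxA -[N *m _ *m T^T]mulmxA TPT mulmx1.
  rewrite -[_ *m M^T *m T^T]mulmxA -trmx_mul TM trmx_mul mulmxA TPT mul1mx.
  by [].
have ND : N = - D.
  apply/matrixP => i j.
  pose e := delta_mx j 0 : 'cV[F]_r.
  have De : D *m e = lam j *: e.
    rewrite -[D *m e]colE; apply/matrixP => k l; rewrite !mxE ord1 eqxx andbT.
    by case: eqVneq => [->|kj]; rewrite ?mulr1n ?mulr0n ?mulr1 ?mulr0.
  pose w := N *m e + lam j *: e.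
  have Nw : N *m w = lam j *: w.
    rewrite /w mulmxDr mulmxA NN -mulmxA De -!scalemxAr De scalerDr scalerA.
    by rewrite addrC.
  have w0 : w = 0.
    apply/eqP; apply/negP => /negP w0.
    have := congr1 (fun X => dotv w (X *m w)) lyapN.
    rewrite mul0mx /= !mulmxDl !dotvDr.
    have -> : dotv w (N^T *m w) = dotv w (N *m w).
      by rewrite -dotv_mulmxl dotvC.
    have -> : dotv w (T *m R *m T^T *m w) = dotv (T^T *m w) (R *m (T^T *m w)).
      by rewrite dotv_mulmxl trmxK !mulmxA.
    have : 0 < dotv (T^T *m w) (R *m (T^T *m w)).
      case: R_pd => _; apply; apply: contra_neq w0 => e0.
      have TTu : T^T \in unitmx by rewrite unitmx_tr.
      by rewrite -[w]mul1mx -(mulVmx TTu) -mulmxA e0 mulmx0.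
    have : 0 <= dotv w (N *m w).
      by rewrite Nw /dotv -scalemxAr mxE mulr_ge0 ?(ltW (lam0 j))// dotvv_ge0.
    rewrite (_ : dotv w 0 = 0); last by rewrite /dotv mulmx0 mxE.
    by move=> h1 h2 h3; have := ltr_wpDl (addr_ge0 h1 h1) h2; rewrite h3 ltxx.
  have := congr1 (fun X : 'cV[F]_r => X i 0) w0; rewrite /w -colE !mxE eqxx andbT.
  move/eqP; rewrite addr_eq0 => /eqP ->.
  by case: eqVneq => [->|kj]; rewrite ?mulr1n ?mulr0n ?mulr1 ?mulr0.
split => //; first by rewrite TM ND mulNmx.
have := lyapN; rewrite ND linearN/= tr_diag_mx => /eqP; rewrite addrC addr_eq0.
by move=> /eqP ->; rewrite -opprD opprK scaler_nat.
Qed.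

(** * Hermite polynomials and their generating functions *)

Section double_series.
Context (F : realType).
Implicit Types (a b : nat -> F).

(* Coefficients of the Cauchy product of [sum_i a i * u^i] and
   [sum_j b j * u^(2 * j)]. *)
Definition twist a b k : F := \sum_(j < k.+1 | (j.*2 <= k)%N) a (k - j.*2)%N * b j.

Lemma sum_twist a b N :
  \sum_(k < N) twist a b k = \sum_(j < N) (\sum_(i < N - j.*2) a i) * b j.
Proof.
elim: N => [|N IH]; first by rewrite !big_ord0.
have -> : \sum_(j < N.+1) (\sum_(i < N.+1 - j.*2) a i) * b j =
   \sum_(j < N.+1) (\sum_(i < N - j.*2) a i) * b j +
   \sum_(j < N.+1) (if (j.*2 <= N)%N then a (N - j.*2)%N * b j else 0).
  rewrite -big_split /=; apply: eq_bigr => j _; case: ifPn => jN.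
    by rewrite subSn// big_ord_recr /= mulrDl.
  rewrite addr0; rewrite -ltnNge in jN.
  by rewrite (eqP (_ : N.+1 - j.*2 == 0)%N) ?subn_eq0// (eqP (_ : N - j.*2 == 0)%N) ?subn_eq0// ltnW.
rewrite big_ord_recr /= IH [in RHS]big_ord_recr /= -big_mkcond /=.
by rewrite (eqP (_ : N - N.*2 == 0)%N) ?big_ord0 ?mul0r ?addr0// subn_eq0 -addnn leq_addr.
Qed.

Lemma ler_sum_twist a b N :
  \sum_(k < N) `|twist a b k| <= (\sum_(i < N) `|a i|) * \sum_(j < N) `|b j|.
Proof.
apply: (@le_trans _ _ (\sum_(k < N) twist (fun i => `|a i|) (fun i => `|b i|) k)).
  apply: ler_sum => k _; rewrite /twist; apply: le_trans (ler_norm_sum _ _ _) _.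
  by apply: ler_sum => j _; rewrite normrM.
rewrite sum_twist mulr_sumr; apply: ler_sum => j _; rewrite ler_wpM2r//.
by rewrite (big_ord_widen N (fun i => `|a i|) (leq_subr _ _)) [leLHS]big_mkcond ler_sum// => i _; case: ifP.
Qed.

Lemma cvg_sum_twist a b (A B K : F) :
  (\sum_(k < N) a k) @[N --> \oo] --> A -> (\sum_(k < N) b k) @[N --> \oo] --> B ->
  (forall N, \sum_(k < N) `|b k| <= K) ->
  (\sum_(k < N) twist a b k) @[N --> \oo] --> A * B.
Proof.
move=> aA bB bK.
have babs : cvgn (fun N => \sum_(k < N) `|b k|).
  apply: nondecreasing_is_cvgn.
    apply/nondecreasing_seqP => n; by rewrite big_ord_recr /= lerDl.
  by exists K => _ [n _ <-].
pose e m := (\sum_(i < m) a i) - A.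
have e0 : e n @[n --> \oo] --> 0 by rewrite -(subrr A); apply: cvgB => //; exact: cvg_cst.
have [Ke Ke0 eK] : exists2 Ke : F, 0 < Ke & forall m, `|e m| <= Ke.
  have := cvg_seq_bounded (cvgP _ e0); rewrite /bounded_near => -[M [_ MP]].
  exists (`|M| + 1); first by rewrite ltr_wpDl.
  by move=> m; apply: MP => //; rewrite ltr_pwDr// ler_norm.
suff h : (\sum_(j < N) e (N - j.*2)%N * b j) @[N --> \oo] --> 0.
  rewrite -[A * B]add0r.
  have -> : (fun N => \sum_(k < N) twist a b k) =
    (fun N => (\sum_(j < N) e (N - j.*2)%N * b j) + A * \sum_(j < N) b j).
    apply/funext => N; rewrite sum_twist mulr_sumr -big_split /=.
    by apply: eq_bigr => j _; rewrite /e mulrBl subrK.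
  by apply: cvgD h _; apply: cvgMr.
apply/cvgrPdist_le => /= eps eps0.
set L := limn (fun N => \sum_(k < N) `|b k|).
have bL : (fun N => \sum_(k < N) `|b k|) @ \oo --> L by [].
have K0 : 0 <= K by apply: le_trans (bK 0); rewrite big_ord0.
pose e1 := eps / (2 * (K + 1)); have e10 : 0 < e1 by rewrite divr_gt0// mulr_gt0// ltr_wpDl.
pose e2 := eps / (4 * Ke); have e20 : 0 < e2 by rewrite divr_gt0// mulr_gt0.
move/cvgrPdist_le: (e0) => /(_ _ e10)[N1 _ N1P].
move/cvgrPdist_le: bL => /(_ _ e20)[N2 _ N2P].
exists (N1 + N2.*2)%N => // N /= N12; rewrite sub0r normrN.
apply: le_trans (ler_norm_sum _ _ _) _.
have N2N : (N2 <= N)%N by rewrite (leq_trans _ N12)// -addnn addnA leq_addl.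
rewrite (bigID (fun j : 'I_N => (j < N2)%N)) /=.
have -> : eps = eps / 2 + eps / 2 by rewrite -splitr.
apply: lerD.
  apply: (@le_trans _ _ (e1 * \sum_(j < N) `|b j|)).
    rewrite mulr_sumr [leLHS]big_mkcond; apply: ler_sum => j _; case: ifPn => jN; last first.
      by rewrite mulr_ge0// ltW.
    rewrite normrM ler_wpM2r//.
    have := N1P (N - j.*2)%N; rewrite /= sub0r normrN; apply.
    rewrite leq_subRL; last first.
      by rewrite (leq_trans _ N12)// ltnW// (leq_trans _ (leq_addl _ _))// ltn_double.
    by rewrite addnC (leq_trans _ N12)// leq_add2l leq_double ltnW.
  apply: (@le_trans _ _ (e1 * (K + 1))).
    by rewrite ler_wpM2l ?(ltW e10)// (le_trans (bK N))// lerDl.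
  rewrite /e1 le_eqVlt; apply/orP; left; apply/eqP; field.
  by rewrite gt_eqF// ltr_wpDl.
apply: (@le_trans _ _ (Ke * \sum_(j < N | ~~ (j < N2)%N) `|b j|)).
  by rewrite mulr_sumr; apply: ler_sum => j _; rewrite normrM ler_wpM2r.
have -> : \sum_(j < N | ~~ (j < N2)%N) `|b j| = \sum_(j < N) `|b j| - \sum_(j < N2) `|b j|.
  rewrite (big_ord_widen N (fun i => `|b i|) N2N).
  by rewrite [X in _ = X - _](bigID (fun j : 'I_N => (j < N2)%N)) /= addrC addrK.
apply: (@le_trans _ _ (Ke * (e2 + e2))).
  rewrite ler_wpM2l ?(ltW Ke0)//.
  have h1 := N2P N N2N; have h2 := N2P N2 (leqnn _).
  rewrite -[X in X - _](subrK L) -addrA lerD//.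
    by rewrite (le_trans _ h1)// distrC ler_norm.
  by rewrite (le_trans _ h2)// ler_norm.
rewrite /e2 le_eqVlt; apply/orP; left; apply/eqP; field.
by rewrite gt_eqF.
Qed.

End double_series.

Section hermite1.
Context (F : realType).

(* [hcoef k x] is [He_k(x) / k!], as a coefficient of [exp (u * x) * exp (- u^2 / 2)]. *)
Definition hcoef (k : nat) (x : F) : F :=
  twist (exp_coeff x) (exp_coeff (- 2^-1)) k.

Lemma cvg_exp_coeff (x : F) : (\sum_(k < N) exp_coeff x k) @[N --> \oo] --> expR x.
Proof.
have := is_cvg_series_exp_coeff x; rewrite /expR.
suff -> : (fun N => \sum_(k < N) exp_coeff x k) = series (exp_coeff x) by [].
by apply/funext => N; rewrite seriesEnat /= big_mkord.
Qed.

Lemma sum_norm_exp_coeff (x : F) N : \sum_(k < N) `|exp_coeff x k| <= expR `|x|.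
Proof.
have -> : \sum_(k < N) `|exp_coeff x k| = series (exp_coeff `|x|) N.
  rewrite seriesEnat /= big_mkord; apply: eq_bigr => k _.
  by rewrite /exp_coeff /= normrM normrX [X in _ * X]ger0_norm ?invr_ge0.
apply: nondecreasing_cvgn_le; last exact: is_cvg_series_exp_coeff.
apply/nondecreasing_seqP => n; rewrite /series /= big_nat_recr//= lerDl.
by rewrite exp_coeff_ge0.
Qed.

Lemma exp_coeffS (x : F) k : k.+1%:R * exp_coeff x k.+1 = x * exp_coeff x k.
Proof.
rewrite /exp_coeff /= factS natrM exprS.
have k0 : k.+1%:R != 0 :> F by rewrite pnatr_eq0.
have f0 : k`!%:R != 0 :> F by rewrite pnatr_eq0 gtn_eqF// fact_gt0.
by move: (k.+1%:R) (k`!%:R) k0 f0 => a b a0 b0; field; rewrite a0 b0.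
Qed.

Lemma exp_coeff0 (x : F) : exp_coeff x 0 = 1.
Proof. by rewrite /exp_coeff /= expr0 fact0 divr1. Qed.

Lemma hcoef_scale (u x : F) k :
  u ^+ k * hcoef k x = twist (exp_coeff (u * x)) (exp_coeff (- (u ^+ 2 / 2))) k.
Proof.
rewrite /hcoef /twist mulr_sumr; apply: eq_bigr => j jk.
rewrite /exp_coeff /=.
have -> : - (u ^+ 2 / 2) = u ^+ 2 * (- 2^-1) :> F by rewrite mulrN.
rewrite !exprMn -[u ^+ j * u ^+ j]exprD addnn -{1}(subnK jk) exprD; ring.
Qed.

Lemma hcoef_generating (u x : F) :
  (\sum_(k < N) u ^+ k * hcoef k x) @[N --> \oo] --> expR (u * x - u ^+ 2 / 2).
Proof.
under eq_fun do under eq_bigr do rewrite hcoef_scale.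
rewrite expRD; apply: cvg_sum_twist.
- exact: cvg_exp_coeff.
- exact: cvg_exp_coeff.
- by move=> N; exact: sum_norm_exp_coeff.
Qed.

Lemma hcoef_norm (u x : F) N :
  \sum_(k < N) `|u ^+ k * hcoef k x| <= expR (`|u * x| + u ^+ 2 / 2).
Proof.
under eq_bigr do rewrite hcoef_scale.
apply: le_trans (ler_sum_twist _ _ _) _; rewrite expRD ler_pM ?sumr_ge0//.
  exact: sum_norm_exp_coeff.
apply: le_trans (sum_norm_exp_coeff _ _) _.
by rewrite normrN ger0_norm// divr_ge0// sqr_ge0.
Qed.

Lemma hcoef0 (x : F) : hcoef 0 x = 1.
Proof. by rewrite /hcoef /twist big_mkcond big_ord_recl big_ord0 /= subnn !exp_coeff0 mulr1 addr0. Qed.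

Lemma hcoefS (k : nat) (x : F) :
  x * hcoef k x = k.+1%:R * hcoef k.+1 x + (if k is j.+1 then hcoef j x else 0).
Proof.
have twist_rec m : m%:R * hcoef m x =
    \sum_(j < m.+1 | (j.*2 <= m)%N)
      (m - j.*2)%N%:R * exp_coeff x (m - j.*2)%N * exp_coeff (- 2^-1) j
    + \sum_(j < m.+1 | (j.*2 <= m)%N)
      exp_coeff x (m - j.*2)%N * (j.*2%:R * exp_coeff (- 2^-1) j).
  rewrite /hcoef /twist mulr_sumr -big_split /=; apply: eq_bigr => j jm.
  by rewrite -{1}(subnK jm) natrD; ring.
have -> : x * hcoef k x = \sum_(j < k.+2 | (j.*2 <= k.+1)%N)
      (k.+1 - j.*2)%N%:R * exp_coeff x (k.+1 - j.*2)%N * exp_coeff (- 2^-1) j.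
  rewrite /hcoef /twist mulr_sumr [LHS]big_mkcond [RHS]big_mkcond [in RHS]big_ord_recr /=.
  rewrite [X in _ = _ + X](_ : _ = 0) ?addr0; last first.
    by case: ifP => // h; exfalso; lia.
  apply: eq_bigr => j _; case: ifPn => jk.
    by rewrite (leq_trans jk)// subSn// exp_coeffS mulrA.
  case: ifPn => // jk1; rewrite -ltnNge in jk.
  by rewrite (eqP (_ : k.+1 - j.*2 == 0)%N) ?subn_eq0// mul0r mul0r.
rewrite twist_rec -[LHS]addr0 -addrA; congr (_ + _).
rewrite [in RHS]big_mkcond big_ord_recl /= subn0 double0 mul0r mulr0 add0r.
apply/esym/eqP; rewrite addr_eq0; apply/eqP; case: k => [|k].
  by rewrite big1 ?oppr0// => j _; rewrite ord1.
rewrite /hcoef /twist [in RHS]big_mkcond [in LHS]big_ord_recr /= [X in _ + X](_ : _ = 0) ?addr0; last first.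
  by case: ifP => //; rewrite /bump /= -addnn; lia.
rewrite -sumrN; apply: eq_bigr => j _.
rewrite /bump /= add1n doubleS !ltnS; case: ifP => jk; last by rewrite oppr0.
rewrite !subSS (_ : j.*2.+2%:R = 2 * j.+1%:R :> F); last by rewrite -natrM mul2n.
by rewrite -[2 * _ * _]mulrA exp_coeffS; field.
Qed.

End hermite1.

Section box_sums.
Context (F : realType) (I : finType).
Local Notation multi := {ffun I -> nat}.
Implicit Types (c : multi -> F).

Definition boxidx N (f : {ffun I -> 'I_N}) : multi := [ffun i => val (f i)].

Lemma boxidx_inj N : injective (@boxidx N).
Proof.
move=> f g fg; apply/ffunP => i; apply: val_inj.
by have := congr1 (fun h : multi => h i) fg; rewrite !ffunE.
Qed.

Definition boxsum N c := \sum_(f : {ffun I -> 'I_N}) c (boxidx f).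

Lemma boxidx_onto N (n : multi) : (forall i, n i < N)%N -> exists f, @boxidx N f = n.
Proof.
by move=> nN; exists [ffun i => Ordinal (nN i)]; apply/ffunP => i; rewrite !ffunE.
Qed.

Definition multi_bound (n : multi) := (\max_i n i).+1.

Lemma lt_multi_bound (n : multi) i : (n i < multi_bound n)%N.
Proof. by rewrite ltnS (leq_bigmax i). Qed.

Lemma boxsum_prod (g : I -> nat -> F) N :
  boxsum N (fun n => \prod_i g i (n i)) = \prod_i \sum_(k < N) g i k.
Proof.
rewrite bigA_distr_bigA; apply: eq_bigr => f _.
by apply: eq_bigr => i _; rewrite ffunE.
Qed.

Lemma ler_boxsum N c c' : (forall n, c n <= c' n) -> boxsum N c <= boxsum N c'.
Proof. by move=> cc'; exact: ler_sum. Qed.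

End box_sums.

Lemma digits_inj b r (n m : 'I_r -> nat) :
  (forall i, n i < b)%N -> (forall i, m i < b)%N ->
  (\sum_i n i * b ^ i = \sum_i m i * b ^ i)%N -> n =1 m.
Proof.
elim: r n m => [|r IH] n m nb mb; first by move=> _ [].
rewrite !big_ord_recl /= !expn0 !muln1.
have e (f : 'I_r.+1 -> nat) : (\sum_(i < r) f (lift ord0 i) * b ^ bump 0 i =
    (\sum_(i < r) f (lift ord0 i) * b ^ i) * b)%N.
  by rewrite big_distrl; apply: eq_bigr => i _; rewrite /bump add1n expnSr mulnA.
rewrite !e => E.
have b0 : (0 < b)%N by exact: leq_trans (nb ord0).
have E0 : n ord0 = m ord0.
  by move/(congr1 (modn^~ b)): E; rewrite ![(_ + _ * b)%N]addnC !modnMDl !modn_small.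
move/eqP: E; rewrite E0 eqn_add2l eqn_pmul2r// => /eqP E.
have H := IH _ _ (fun i => nb _) (fun i => mb _) E.
by move=> i; case: (unliftP ord0 i) => [j ->|->//]; exact: H.
Qed.

Section box_series_uniqueness.
Context (F : realType) (I : finType).
Local Notation multi := {ffun I -> nat}.
Implicit Types (c : multi -> F).

Let deg (n : multi) := (\sum_i n i)%N.

(* Weights [K + (k+1)^i], with [k] the least degree of a nonzero coefficient
   and [K] large, single out one nonzero coefficient of least weight. *)
Lemma leading_weight c (m : multi) : c m != 0 ->
  exists (w : I -> nat) (n0 : multi), c n0 != 0 /\
    forall n, c n != 0 -> n != n0 ->
      (\sum_i w i * n0 i < \sum_i w i * n i)%N.
Proof.
move=> cm.
have ex1 : exists d, `[< exists2 n, deg n = d & c n != 0 >].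
  by exists (deg m); apply/asboolP; exists m.
case: (ex_minnP ex1) => k /asboolP[n1 dn1 cn1] kmin.
have {}kmin n : c n != 0 -> (k <= deg n)%N.
  by move=> cn; apply: kmin; apply/asboolP; exists n.
pose w2 (n : multi) := (\sum_i k.+1 ^ enum_rank i * n i)%N.
have ex2 : exists d, `[< exists n, [/\ deg n = k, c n != 0 & w2 n = d] >].
  by exists (w2 n1); apply/asboolP; exists n1.
case: (ex_minnP ex2) => e /asboolP[n0 [dn0 cn0 wn0]] emin.
have {}emin n : deg n = k -> c n != 0 -> (e <= w2 n)%N.
  by move=> dn cn; apply: emin; apply/asboolP; exists n.
exists (fun i => e.+1 + k.+1 ^ enum_rank i)%N, n0; split=> // n cn nn0.
have wE (p : multi) : (\sum_i (e.+1 + k.+1 ^ enum_rank i) * p i = e.+1 * deg p + w2 p)%N.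
  by rewrite big_distrr -big_split; apply: eq_bigr => i _; rewrite mulnDl.
rewrite !wE dn0 wn0.
have := kmin _ cn; rewrite leq_eqVlt => /predU1P[dn|dn]; last first.
  by apply: leq_trans (leq_addr _ _); apply: leq_trans (leq_mul (leqnn _) dn); rewrite mulnS addnC ltn_add2r.
rewrite -dn ltn_add2l ltn_neqAle emin// andbT.
apply: contra nn0 => /eqP en; apply/eqP/ffunP => i.
have degk (p : multi) : deg p = k -> forall j, (p j < k.+1)%N.
  by move=> <- j; rewrite ltnS /deg (bigD1 j)//= leq_addr.
have w2E (p : multi) : w2 p = (\sum_(j < #|I|) p (enum_val j) * k.+1 ^ j)%N.
  rewrite /w2 (reindex (@enum_val I predT)) /=; last exact: onW_bij (enum_val_bij _).
  by apply: eq_bigr => j _; rewrite enum_valK mulnC.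
have /digits_inj : (\sum_(j < #|I|) n (enum_val j) * k.+1 ^ j =
    \sum_(j < #|I|) n0 (enum_val j) * k.+1 ^ j)%N by rewrite -!w2E -en wn0.
move=> /(_ (fun j => degk _ (esym dn) _) (fun j => degk _ dn0 _))/(_ (enum_rank i)).
by rewrite enum_rankK.
Qed.

Lemma boxsum_eq0 c (K : F) : (forall N, boxsum N (fun n => `|c n|) <= K) ->
  (forall u : I -> F, (forall i, 0 < u i <= 1) ->
     boxsum N (fun n => (\prod_i u i ^+ n i) * c n) @[N --> \oo] --> 0) ->
  forall n, c n = 0.
Proof.
move=> cK cu m; apply/eqP; apply: contraT => /leading_weight[w [n0 [cn0 wmin]]].
pose W (n : multi) := (\sum_i w i * n i)%N.
have main s : 0 < s <= 1 -> `|c n0| <= s * K.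
  move=> /andP[s0 s1].
  have prodE (n : multi) : \prod_i (s ^+ w i) ^+ n i = s ^+ W n.
    by under eq_bigr do rewrite -exprM; rewrite -expr_sum.
  have {}cu : boxsum N (fun n => s ^+ W n * c n) @[N --> \oo] --> 0.
    rewrite (_ : (fun n => s ^+ W n * c n) = fun n : multi => (\prod_i (s ^+ w i) ^+ n i) * c n); last first.
      by apply/funext => n; rewrite prodE.
    by apply: cu => i; rewrite exprn_gt0// exprn_ile1// ltW.
  suff : s ^+ W n0 * `|c n0| <= s ^+ W n0 * (s * K) by rewrite ler_pM2l// exprn_gt0.
  apply/ler_addgt0Pr => eps eps0.
  move/cvgrPdist_le: cu => /(_ _ eps0)[N1 _ /(_ (N1 + multi_bound n0)%N (leq_addr _ _))].
  set N := (N1 + _)%N; rewrite /= sub0r normrN => h.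
  have [f0 f0E] : exists f, @boxidx _ N f = n0.
    by apply: boxidx_onto => i; rewrite (leq_trans (lt_multi_bound n0 i))// leq_addl.
  move: h; rewrite /boxsum (bigD1 f0)//= f0E => h.
  have -> : s ^+ W n0 * `|c n0| = `|s ^+ W n0 * c n0| by rewrite normrM [in RHS]ger0_norm// exprn_ge0// ltW.
  rewrite -[X in `|X|](addrK (\sum_(f | f != f0) s ^+ W (boxidx f) * c (boxidx f))).
  rewrite (le_trans (ler_normB _ _))// addrC lerD//.
  apply: le_trans (ler_norm_sum _ _ _) _.
  rewrite mulrA -exprSr.
  apply: (@le_trans _ _ (s ^+ (W n0).+1 * boxsum N (fun n => `|c n|))); last first.
    by rewrite ler_wpM2l// exprn_ge0// ltW.
  rewrite /boxsum mulr_sumr [leRHS](bigD1 f0)//=; apply: ler_wpDl.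
    by rewrite mulr_ge0// exprn_ge0// ltW.
  apply: ler_sum => f ff0; rewrite normrM.
  have [->|cf] := eqVneq (c (boxidx f)) 0; first by rewrite normr0 !mulr0.
  rewrite ler_wpM2r// ger0_norm ?exprn_ge0 ?(ltW s0)//.
  apply: ler_wiXn2l (ltW s0) s1 _ _ _; apply: wmin => //.
  by apply: contra ff0 => /eqP e; apply/eqP; apply: (@boxidx_inj _ N); rewrite e.
have K0 : 0 <= K by apply: le_trans (cK 0%N); apply: sumr_ge0.
have c0 : 0 < `|c n0| by rewrite normr_gt0.
have d0 : 0 < 2 * (K + `|c n0|) by rewrite mulr_gt0// ltr_wpDl.
have := main (`|c n0| / (2 * (K + `|c n0|))).
rewrite divr_gt0//= ler_pdivrMr// mul1r.
have -> : `|c n0| <= 2 * (K + `|c n0|) by move: c0; lra.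
move=> /(_ isT); rewrite mulrAC ler_pdivlMr// ler_pM2l//.
by move: c0; lra.
Qed.

End box_series_uniqueness.

Section unconditional_sums.
Context (F : realType) (I : finType).
Local Notation multi := {ffun I -> nat}.
Local Open Scope fset_scope.

Lemma totally_norm_bounded (T : choiceType) (a : T -> F) (L : F) :
  (\sum_(n <- (J : {fset T})) a n)%R @[J --> totally] --> L ->
  exists K : F, forall J : {fset T}, (\sum_(n <- J) `|a n| <= K)%R.
Proof.
have FT := @totally_filter T.
move=> /cvgrPdist_le/(_ 1%R ltr01)[J0 _ J0P].
exists ((\sum_(n <- J0) `|a n|)%R + 4)%R => J.
have sumD (J1 : {fset T}) : [disjoint J1 & J0]%fset -> (`|\sum_(n <- J1) a n| <= 2)%R.
  move=> dJ; have h1 := J0P J0 (fsubset_refl _).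
  have h2 := J0P (J1 `|` J0) (fsubsetUr _ _).
  have sumU : (\sum_(n <- J1 `|` J0) a n = \sum_(n <- J1) a n + \sum_(n <- J0) a n)%R.
    rewrite (big_fsetID _ (mem J1)) /=; congr (_ + _)%R; apply: eq_fbigl => x.
      by rewrite !inE /=; case: (x \in J1); rewrite ?andbT ?andbF.
    rewrite !inE /=; case: (boolP (x \in J1)) => h /=; rewrite ?andbT//.
    by apply/esym/negbTE; exact: (fdisjointP dJ).
  rewrite /= sumU in h2.
  have -> : (\sum_(n <- J1) a n)%R = ((L - \sum_(n <- J0) a n) - (L - (\sum_(n <- J1) a n + \sum_(n <- J0) a n)))%R by ring.
  by rewrite (le_trans (ler_normB _ _))// -[leRHS]/(1 + 1)%R lerD.
rewrite (big_fsetID _ (mem J0))/= lerD//.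
  rewrite (big_fsetID _ (mem J) J0) /=.
  have -> : [fset x in J | x \in J0] = [fset x in J0 | x \in J].
    by apply/fsetP => x; rewrite !inE /= andbC.
  by rewrite lerDl sumr_ge0.
rewrite (big_fsetID _ (fun n => 0 <= a n)%R) /=.
rewrite (_ : 4 = 2 + 2)%R; last by ring.
apply: lerD.
  apply: le_trans (sumD [fset x in [fset x in J | x \notin J0] | 0 <= a x]%R _); last first.
    by apply/fdisjointP => x; rewrite !inE /= => /andP[/andP[]].
  apply: le_trans (ler_norm _); rewrite big_seq [leRHS]big_seq; apply: ler_sum => x.
  by rewrite !inE /= => /andP[_ x0]; rewrite ger0_norm.
apply: le_trans (sumD [fset x in [fset x in J | x \notin J0] | ~~ (0 <= a x)]%R _); last first.
  by apply/fdisjointP => x; rewrite !inE /= => /andP[/andP[]].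
rewrite -normrN -sumrN; apply: le_trans (ler_norm _).
rewrite big_seq [leRHS]big_seq; apply: ler_sum => x.
by rewrite !inE /= -ltNge => /andP[_ x0]; rewrite ltr0_norm.
Qed.

Definition boxset N : {fset multi} := [fset n in [seq boxidx f | f : {ffun I -> 'I_N}]].

Lemma sum_boxset N (a : multi -> F) : (\sum_(n <- boxset N) a n)%R = boxsum N a.
Proof.
rewrite /boxsum -big_enum /= -[RHS](big_map (@boxidx I N) predT a).
apply: perm_big; apply: uniq_perm; first exact: fset_uniq.
  by rewrite map_inj_uniq ?enum_uniq//; exact: boxidx_inj.
by move=> n; rewrite !inE.
Qed.

Lemma totally_cvg_boxsum (a : multi -> F) (L : F) :
  (\sum_(n <- (J : {fset multi})) a n)%R @[J --> totally] --> L ->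
  boxsum N a @[N --> \oo] --> L.
Proof.
have FT := @totally_filter multi.
move=> /cvgrPdist_le aL; apply/cvgrPdist_le => eps /aL[J0 _ J0P].
exists (\max_(n <- J0) multi_bound n)%N => // N /= N0; rewrite -sum_boxset.
apply: J0P; apply/fsubsetP => n nJ0.
have [f <-] : exists f, @boxidx _ N f = n.
  apply: boxidx_onto => i; rewrite (leq_trans (lt_multi_bound n i))//.
  by rewrite (leq_trans _ N0)// leq_bigmax_seq.
by rewrite !inE map_f// mem_enum.
Qed.

End unconditional_sums.

Section hermite_product.
Context (F : realType) (r : nat) (H : {ffun 'I_r -> nat} -> 'cV[F]_r -> F).
Hypothesis H_hermite : hermite_family H.

Lemma hermite_familyE n x :
  H n x = \prod_i ((n i)`!%:R * hcoef (n i) (x i 0)).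
Proof.
pose c (n : {ffun 'I_r -> nat}) := H n x / (mfact n)%:R - \prod_i hcoef (n i) (x i 0).
have fact0 : (mfact n)%:R != 0 :> F.
  by rewrite pnatr_eq0 -lt0n prodn_gt0// => i; exact: fact_gt0.
suff /(_ n)/eqP : forall m, c m = 0.
  rewrite /c subr_eq0 => /eqP e; rewrite -[LHS](divfK fact0) e mulrC big_split /=.
  by rewrite natr_prod.
have [K KP] := totally_norm_bounded (@H_hermite (const_mx 1) x).
apply: (@boxsum_eq0 _ _ _ (K + \prod_i expR (`|1 * x i 0| + 1 ^+ 2 / 2))).
  move=> N; apply: (@le_trans _ _ (boxsum N (fun n => `|H n x / (mfact n)%:R|) +
     boxsum N (fun n => \prod_i `|1 ^+ n i * hcoef (n i) (x i 0)|))).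
    rewrite -big_split; apply: ler_sum => f _ /=.
    rewrite /c (le_trans (ler_normB _ _))// lerD// normr_prod ler_prod// => i _.
    by rewrite expr1n mul1r normr_ge0 lexx.
  apply: lerD; last first.
    rewrite (boxsum_prod (fun i k => `|1 ^+ k * hcoef k (x i 0)|)).
    by apply: ler_prod => i _; rewrite sumr_ge0// hcoef_norm.
  apply: le_trans (KP (boxset _ N)); rewrite sum_boxset; apply: ler_boxsum => m.
  rewrite (_ : mpow _ _ = 1) ?mul1r 1?mulrC// /mpow big1// => i _.
  by rewrite mxE expr1n.
move=> u _.
have h1 := totally_cvg_boxsum (@H_hermite (\col_i u i) x).
have h2 : boxsum N (fun n => \prod_i (u i ^+ n i * hcoef (n i) (x i 0))) @[N --> \oo]
    --> expR (dotv (\col_i u i) x - 2^-1 * dotv (\col_i u i) (\col_i u i)).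
  under eq_fun do rewrite (boxsum_prod (fun i k => u i ^+ k * hcoef k (x i 0))).
  rewrite !dotvE mulr_sumr -sumrB expR_sum.
  apply: cvg_big => [|i _ /=]; first exact: mul_continuous.
  rewrite !mxE -expr2 [2^-1 * _]mulrC.
  exact: hcoef_generating.
rewrite (_ : (fun N => _) = (fun N =>
    boxsum N (fun n => mpow (\col_i u i) n / (mfact n)%:R * H n x) -
    boxsum N (fun n => \prod_i (u i ^+ n i * hcoef (n i) (x i 0))))).
  have := cvgB h1 h2; rewrite subrr; exact.
apply/funext => N; rewrite -sumrB; apply: eq_bigr => f _.
rewrite /c mulrBr big_split /=; congr (_ - _).
rewrite (_ : mpow _ _ = \prod_i u i ^+ (boxidx f) i); first by ring.
by apply: eq_bigr => i _; rewrite mxE.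
Qed.

End hermite_product.

Section real_integrals.
Context (F : realType) d (T : measurableType d) (mu : {measure set T -> \bar F}).
Implicit Types (f g : T -> F).

Lemma le_integrableR f g : measurable_fun setT f -> (forall t, `|f t| <= g t) ->
  mu.-integrable setT (EFin \o g) -> mu.-integrable setT (EFin \o f).
Proof.
move=> mf fg; apply: le_integrable => //; first exact/measurable_EFinP.
move=> t _ /=; rewrite lee_fin; apply: le_trans (fg t) _; exact: ler_norm.
Qed.

Lemma integrable_sumR (D : set T) (I : Type) (s : seq I) (h : I -> T -> F) :
  measurable D -> (forall i, mu.-integrable D (EFin \o h i)) ->
  mu.-integrable D (EFin \o (fun t => \sum_(i <- s) h i t)).
Proof.
move=> mD hi; rewrite (_ : EFin \o _ = fun t => (\sum_(i <- s) (EFin \o h i) t)%E).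
  by apply: integrable_sum => // i _; exact: hi.
by apply/funext => t; rewrite /= sumEFin.
Qed.

Lemma Rintegral_sum (D : set T) (I : Type) (s : seq I) (h : I -> T -> F) :
  measurable D -> (forall i, mu.-integrable D (EFin \o h i)) ->
  \int[mu]_(t in D) (\sum_(i <- s) h i t) = \sum_(i <- s) \int[mu]_(t in D) h i t.
Proof.
move=> mD hi; elim: s => [|i s IH].
  by under eq_Rintegral do rewrite big_nil; rewrite big_nil Rintegral_cst// mul0r.
under eq_Rintegral do rewrite big_cons.
by rewrite big_cons RintegralD// ?IH//; exact: (integrable_sumR s mD hi).
Qed.

Lemma integrableZR (k : F) f : mu.-integrable setT (EFin \o f) ->
  mu.-integrable setT (EFin \o (fun t => k * f t)).
Proof. by move=> fi; exact: (integrableZl measurableT k fi). Qed.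

Lemma cvg_Rintegral_dominated_ae (f_ : nat -> T -> F) f g :
  (forall n, measurable_fun setT (f_ n)) -> measurable_fun setT f ->
  {ae mu, forall t, f_ n t @[n --> \oo] --> f t} ->
  (forall n t, `|f_ n t| <= g t) -> mu.-integrable setT (EFin \o g) ->
  \int[mu]_t f_ n t @[n --> \oo] --> \int[mu]_t f t.
Proof.
move=> mf_ mf ff fg ig.
have [|||||fi _ h] := @dominated_convergence _ _ _ mu setT measurableT
  (fun n => EFin \o f_ n) (EFin \o f) (EFin \o g).
- by move=> n; exact/measurable_EFinP.
- exact/measurable_EFinP.
- apply: filterS ff => t ft _; apply: cvg_EFin; first exact: nearW.
  exact: ft.
- exact: ig.
- by apply: aeW => t n _ /=; rewrite lee_fin.
- by apply: fine_cvg; rewrite /Rintegral fineK//; exact: integrable_fin_num.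
Qed.

Lemma cvg_Rintegral_dominated (f_ : nat -> T -> F) f g :
  (forall n, measurable_fun setT (f_ n)) -> measurable_fun setT f ->
  (forall t, f_ n t @[n --> \oo] --> f t) ->
  (forall n t, `|f_ n t| <= g t) -> mu.-integrable setT (EFin \o g) ->
  \int[mu]_t f_ n t @[n --> \oo] --> \int[mu]_t f t.
Proof. by move=> mf_ mf ff; apply: cvg_Rintegral_dominated_ae => //; exact: aeW. Qed.

End real_integrals.

Section exponential_domination.
Context (F : realType) d (T : measurableType d) (mu : {measure set T -> \bar F}).
Context (I : finType) (y : I -> T -> F) (psi : T -> F).
Hypothesis my : forall i, measurable_fun setT (y i).
Hypothesis mpsi : measurable_fun setT psi.
Hypothesis psi_exp : forall u : I -> F,
  mu.-integrable setT (EFin \o (fun t => psi t * expR (\sum_i u i * y i t))).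

Lemma expR_norm_sum_le (z : I -> F) (k : F) : 0 <= k ->
  expR (k * \sum_i `|z i|) <=
    \sum_(f : {ffun I -> bool}) expR (\sum_i (-1) ^+ f i * k * z i).
Proof.
move=> k0; under [leRHS]eq_bigr do rewrite expR_sum.
rewrite -(bigA_distr_bigA (fun i (b : bool) => expR ((-1) ^+ b * k * z i))).
rewrite mulr_sumr expR_sum; apply: ler_prod => i _; rewrite expR_ge0/=.
rewrite big_bool /= expr1 expr0 mul1r mulN1r mulNr.
have [z0|z0] := ger0P (z i); first by rewrite lerDr expR_ge0.
by rewrite mulrN lerDl expR_ge0.
Qed.

Lemma integrable_exp_norm (k : F) : 0 <= k ->
  mu.-integrable setT (EFin \o (fun t => `|psi t| * expR (k * \sum_i `|y i t|))).
Proof.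
move=> k0.
apply: (@le_integrableR _ _ _ _ _ (fun t => \sum_(f : {ffun I -> bool})
   `|psi t * expR (\sum_i (-1) ^+ f i * k * y i t)|)).
- apply: measurable_funM; first exact: measurableT_comp.
  apply: measurableT_comp => //; apply: measurable_funM => //.
  by apply: measurable_sum => i; exact: measurableT_comp.
- move=> t; rewrite normrM normr_id [X in _ * X]ger0_norm ?expR_ge0//.
  under [leRHS]eq_bigr do rewrite normrM [X in _ * X]ger0_norm ?expR_ge0//.
  by rewrite -mulr_sumr ler_wpM2l// expR_norm_sum_le.
- apply: integrable_sumR => // f; apply/integrable_norm.
  exact: (psi_exp (fun i => (-1) ^+ f i * k)).
Qed.

End exponential_domination.

Section hermite_expectation.
Context (F : realType) d (T : measurableType d) (mu : {measure set T -> \bar F}).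
Context (I : finType) (y : I -> T -> F) (psi : T -> F).
Hypothesis my : forall i, measurable_fun setT (y i).
Hypothesis mpsi : measurable_fun setT psi.
Hypothesis psi_exp : forall u : I -> F,
  mu.-integrable setT (EFin \o (fun t => psi t * expR (\sum_i u i * y i t))).
Local Notation multi := {ffun I -> nat}.

Lemma measurable_hcoef k : measurable_fun setT (@hcoef F k).
Proof.
rewrite (_ : @hcoef F k = fun x => \sum_(j < k.+1)
  (if (j.*2 <= k)%N then exp_coeff x (k - j.*2)%N * exp_coeff (- 2^-1) j else 0)); last first.
  by apply/funext => x; rewrite /hcoef /twist [LHS]big_mkcond.
apply: measurable_sum => j; case: (j.*2 <= k)%N => /=; last exact: measurable_cst.
by apply: measurable_funM => //; apply: measurable_funM => //; exact: measurable_funX.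
Qed.

Lemma norm_hcoef_le k (x : F) : `|hcoef k x| <= expR (`|x| + 2^-1).
Proof.
have := hcoef_norm 1 x k.+1; rewrite mul1r expr1n mul1r; apply: le_trans.
by rewrite big_ord_recr /= expr1n mul1r lerDr sumr_ge0.
Qed.

Lemma measurable_prod_hcoef (n : multi) :
  measurable_fun setT (fun t => \prod_i hcoef (n i) (y i t)).
Proof.
apply: measurable_prod => i _.
by apply: measurableT_comp; [exact: measurable_hcoef|exact: my].
Qed.

Let G t := `|psi t| * expR (\sum_i (`|y i t| + 2^-1)).

Let G_int : mu.-integrable setT (EFin \o G).
Proof.
rewrite (_ : G = fun t => expR (\sum_(i : I) 2^-1) * (`|psi t| * expR (1 * \sum_i `|y i t|))).
  by apply: integrableZR; apply: integrable_exp_norm.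
by apply/funext => t; rewrite /G big_split /= expRD mul1r; ring.
Qed.

Let mterm (n : multi) : measurable_fun setT (fun t => psi t * \prod_i hcoef (n i) (y i t)).
Proof. by apply: measurable_funM => //; exact: measurable_prod_hcoef. Qed.

Lemma integrable_prod_hcoef (n : multi) :
  mu.-integrable setT (EFin \o (fun t => psi t * \prod_i hcoef (n i) (y i t))).
Proof.
apply: (le_integrableR _ _ G_int) => // t.
rewrite normrM ler_wpM2l// normr_prod expR_sum ler_prod// => i _.
by rewrite normr_ge0 norm_hcoef_le.
Qed.

Let mgen (u : I -> F) : measurable_fun setT
  (fun t => psi t * expR (\sum_i (u i * y i t - u i ^+ 2 / 2))).
Proof.
apply: measurable_funM => //; apply: measurableT_comp => //.
by apply: measurable_sum => i; apply: measurable_funB => //; exact: measurable_funM.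
Qed.

Lemma boxsum_hermite_expectation (u : I -> F) : (forall i, 0 < u i <= 1) ->
  boxsum N (fun n => (\prod_i u i ^+ n i) *
      \int[mu]_t (psi t * \prod_i hcoef (n i) (y i t))) @[N --> \oo] -->
    \int[mu]_t (psi t * expR (\sum_i (u i * y i t - u i ^+ 2 / 2))).
Proof.
move=> u01.
rewrite (_ : (fun N => _) = fun N =>
    \int[mu]_t (psi t * \prod_i \sum_(k < N) u i ^+ k * hcoef k (y i t))).
  apply: (cvg_Rintegral_dominated _ _ _ _ G_int).
  - move=> N; apply: measurable_funM => //; apply: measurable_prod => i _.
    apply: measurable_sum => k; apply: measurable_funM => //.
    by apply: measurableT_comp; [exact: measurable_hcoef|exact: my].
  - exact: mgen.
  - move=> t; apply: cvgMr; rewrite expR_sum.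
    apply: cvg_big => [|i _]; first exact: mul_continuous.
    exact: hcoef_generating.
  - move=> N t; rewrite normrM ler_wpM2l// normr_prod expR_sum ler_prod// => i _.
    rewrite normr_ge0; apply: le_trans (ler_norm_sum _ _ _) _.
    apply: le_trans (hcoef_norm _ _ _) _; rewrite ler_expR.
    have /andP[u0 u1] := u01 i; rewrite normrM (ger0_norm (ltW u0)) lerD//.
      by rewrite ler_piMl.
    by rewrite ler_pdivrMr// mulVf// expr_le1// ltW.
apply/funext => N; rewrite /boxsum.
under eq_bigr do rewrite -RintegralZl ?integrable_prod_hcoef//.
rewrite -(Rintegral_sum _ measurableT); last by move=> f; apply: integrableZR; exact: integrable_prod_hcoef.
apply: eq_Rintegral => t _.
rewrite -(boxsum_prod (fun i k => u i ^+ k * hcoef k (y i t))) /boxsum mulr_sumr.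
by apply: eq_bigr => f _; rewrite big_split /= mulrCA.
Qed.

Lemma boxsum_norm_hermite_expectation N :
  boxsum N (fun n => `|\int[mu]_t (psi t * \prod_i hcoef (n i) (y i t))|) <=
    \int[mu]_t G t.
Proof.
apply: (@le_trans _ _ (boxsum N (fun n =>
    \int[mu]_t `|psi t * \prod_i hcoef (n i) (y i t)|))).
  by apply: ler_boxsum => n; apply: le_normr_Rintegral => //; exact: integrable_prod_hcoef.
rewrite /boxsum -(Rintegral_sum _ measurableT); last by move=> f; apply/integrable_norm/integrable_prod_hcoef.
apply: le_Rintegral => //.
  by apply: integrable_sumR => // f; apply/integrable_norm/integrable_prod_hcoef.
move=> t _; under eq_bigr do rewrite normrM normr_prod.
rewrite -mulr_sumr ler_wpM2l//.
have -> : \sum_(f : {ffun I -> 'I_N}) \prod_i `|hcoef (boxidx f i) (y i t)| =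
   boxsum N (fun n : multi => \prod_i `|hcoef (n i) (y i t)|) by [].
rewrite (boxsum_prod (fun i k => `|hcoef k (y i t)|)) expR_sum ler_prod// => i _.
rewrite sumr_ge0//= (eq_bigr (fun k : 'I_N => `|1 ^+ k * hcoef k (y i t)|)).
  by apply: le_trans (hcoef_norm _ _ _) _; rewrite mul1r expr1n mul1r.
by move=> k _; rewrite expr1n mul1r.
Qed.

Lemma hermite_expectation (D : I -> F -> F) (delta : I -> nat -> F) (K : I -> F) :
  (forall u, (forall i, 0 < u i <= 1) ->
    \int[mu]_t (psi t * expR (\sum_i (u i * y i t - u i ^+ 2 / 2))) = \prod_i D i (u i)) ->
  (forall i u, 0 < u <= 1 ->
     (\sum_(k < N) u ^+ k * delta i k) @[N --> \oo] --> D i u) ->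
  (forall i N, \sum_(k < N) `|delta i k| <= K i) ->
  forall n : multi,
    \int[mu]_t (psi t * \prod_i hcoef (n i) (y i t)) = \prod_i delta i (n i).
Proof.
move=> intD dD dK n.
pose c (m : multi) := \int[mu]_t (psi t * \prod_i hcoef (m i) (y i t)) - \prod_i delta i (m i).
suff : c n = 0 by move/eqP; rewrite subr_eq0 => /eqP.
apply: (@boxsum_eq0 _ _ _ (\int[mu]_t G t + \prod_i K i)).
  move=> N; apply: (@le_trans _ _ (boxsum N (fun n =>
      `|\int[mu]_t (psi t * \prod_i hcoef (n i) (y i t))|) +
      boxsum N (fun n => \prod_i `|delta i (n i)|))).
    rewrite -big_split; apply: ler_sum => f _ /=.
    by rewrite /c (le_trans (ler_normB _ _))// normr_prod.
  apply: lerD; first exact: boxsum_norm_hermite_expectation.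
  rewrite (boxsum_prod (fun i k => `|delta i k|)).
  by apply: ler_prod => i _; rewrite sumr_ge0//= dK.
move=> u u01.
have h1 := boxsum_hermite_expectation u01.
have h2 : boxsum N (fun n => \prod_i (u i ^+ n i * delta i (n i))) @[N --> \oo] -->
    \prod_i D i (u i).
  under eq_fun do rewrite (boxsum_prod (fun i k => u i ^+ k * delta i k)).
  apply: cvg_big => [|i _]; first exact: mul_continuous.
  exact: dD.
rewrite intD// in h1.
rewrite (_ : (fun N => _) = (fun N => boxsum N (fun n => (\prod_i u i ^+ n i) *
      \int[mu]_t (psi t * \prod_i hcoef (n i) (y i t))) -
    boxsum N (fun n => \prod_i (u i ^+ n i * delta i (n i))))).
  by have := cvgB h1 h2; rewrite subrr; exact.
apply/funext => N; rewrite -sumrB; apply: eq_bigr => f _.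
by rewrite /c mulrBr big_split.
Qed.

End hermite_expectation.

(** * Density of polynomials *)

Section square_integrable.
Context (F : realType) d (T : measurableType d) (mu : {measure set T -> \bar F}).
Implicit Types (f g h : T -> F).

Definition sqint f := measurable_fun setT f /\
  mu.-integrable setT (EFin \o (fun x => f x ^+ 2)).

Definition sqn f : F := \int[mu]_x f x ^+ 2.

Lemma sqn_ge0 f : 0 <= sqn f.
Proof. by apply: Rintegral_ge0 => x _; exact: sqr_ge0. Qed.

Lemma sqint_le f g : measurable_fun setT f -> (forall x, `|f x| <= g x) ->
  sqint g -> sqint f.
Proof.
move=> mf fg [mg ig]; split => //; apply: (le_integrableR _ _ ig).
  exact: measurable_funX.
by move=> x; rewrite normrX ler_sqr ?nnegrE// (le_trans _ (fg x)).
Qed.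

Lemma sqint0 : sqint (cst 0).
Proof.
split => //; rewrite (_ : EFin \o _ = cst 0%E); first exact: integrable0.
by apply/funext => x /=; rewrite expr0n.
Qed.

Lemma sqintZ k f : sqint f -> sqint (fun x => k * f x).
Proof.
move=> [mf fi]; split; first exact: measurable_funM.
rewrite (_ : (fun x => _) = (fun x => k ^+ 2 * f x ^+ 2)); first exact: integrableZR.
by apply/funext => x; rewrite exprMn.
Qed.

Lemma integrable_addR f g : mu.-integrable setT (EFin \o f) ->
  mu.-integrable setT (EFin \o g) -> mu.-integrable setT (EFin \o (fun x => f x + g x)).
Proof. by move=> fi gi; exact: (integrableD measurableT fi gi). Qed.

Lemma sqr_add_le (a b : F) : (a + b) ^+ 2 <= 2 * a ^+ 2 + 2 * b ^+ 2.
Proof. by have := sqr_ge0 (a - b); rewrite -subr_ge0 => h; nra. Qed.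

Let sqint_bound f g : sqint f -> sqint g ->
  mu.-integrable setT (EFin \o (fun x => 2 * f x ^+ 2 + 2 * g x ^+ 2)).
Proof. by move=> [_ fi] [_ gi]; apply: integrable_addR; exact: integrableZR. Qed.

Lemma sqintD f g : sqint f -> sqint g -> sqint (fun x => f x + g x).
Proof.
move=> Hf Hg; have [[mf _] [mg _]] := (Hf, Hg).
split; first exact: measurable_funD.
apply: (le_integrableR _ _ (sqint_bound Hf Hg)).
  by apply: measurable_funX; exact: measurable_funD.
by move=> x; rewrite ger0_norm ?sqr_ge0// sqr_add_le.
Qed.

Lemma sqintB f g : sqint f -> sqint g -> sqint (fun x => f x - g x).
Proof.
move=> Hf Hg; have := sqintD Hf (sqintZ (-1) Hg).
by under eq_fun do rewrite mulN1r.
Qed.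

Lemma sqint_sum (I : Type) (s : seq I) (f : I -> T -> F) :
  (forall i, sqint (f i)) -> sqint (fun x => \sum_(i <- s) f i x).
Proof.
move=> fi; elim: s => [|i s IH].
  by under eq_fun do rewrite big_nil; exact: sqint0.
by under eq_fun do rewrite big_cons; exact: sqintD.
Qed.

Lemma sqintM f g : sqint f -> sqint g -> mu.-integrable setT (EFin \o (fun x => f x * g x)).
Proof.
move=> Hf Hg; have [[mf _] [mg _]] := (Hf, Hg).
apply: (le_integrableR _ _ (sqint_bound Hf Hg)); first exact: measurable_funM.
move=> x; rewrite normrM -[f x ^+ 2]real_normK ?num_real// -[g x ^+ 2]real_normK ?num_real//.
have := sqr_ge0 (`|f x| - `|g x|); have := normr_ge0 (f x); have := normr_ge0 (g x).
by move: `|f x| `|g x| => a b; nra.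
Qed.

Lemma sqnD_le f g : sqint f -> sqint g ->
  sqn (fun x => f x + g x) <= 2 * sqn f + 2 * sqn g.
Proof.
move=> Hf Hg; have [[mf fi] [mg gi]] := (Hf, Hg).
rewrite /sqn -!RintegralZl// -RintegralD//; try exact: integrableZR.
apply: le_Rintegral => //; [by case: (sqintD Hf Hg)|exact: sqint_bound|].
by move=> x _; exact: sqr_add_le.
Qed.

Lemma sqn_le f g : measurable_fun setT f -> (forall x, `|f x| <= g x) -> sqint g ->
  sqn f <= sqn g.
Proof.
move=> mf fg Hg; have [_ fi] := sqint_le mf fg Hg.
apply: le_Rintegral => //; first by case: Hg.
move=> x _; rewrite -[f x ^+ 2]real_normK ?num_real// ler_sqr ?nnegrE//.
exact: le_trans (fg x).
Qed.

Lemma sqnZ k f : sqint f -> sqn (fun x => k * f x) = k ^+ 2 * sqn f.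
Proof.
by move=> [_ fi]; rewrite /sqn -RintegralZl//; apply: eq_Rintegral => x _; rewrite exprMn.
Qed.

Lemma sqint_cvg (f_ : nat -> T -> F) f g :
  (forall n, measurable_fun setT (f_ n)) -> measurable_fun setT f ->
  (forall x, f_ n x @[n --> \oo] --> f x) ->
  (forall n x, `|f_ n x| <= g x) -> sqint g ->
  sqint f /\ sqn (fun x => f_ n x - f x) @[n --> \oo] --> 0.
Proof.
move=> mf_ mf ff fg Hg.
have fg' x : `|f x| <= g x.
  apply: (ler_cvg_to (cvg_norm (ff x)) (cvg_cst (g x))).
  by apply: nearW => n; exact: fg.
split; first exact: (sqint_le _ fg').
have h0 : \int[mu]_x cst 0 x = 0 :> F by rewrite Rintegral_cst// mul0r.
rewrite -[X in _ --> X]h0.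
have [_ Hg2] := sqintZ 2 Hg.
apply: (cvg_Rintegral_dominated _ _ _ _ Hg2) => //.
- by move=> n; apply: measurable_funX; exact: measurable_funB.
- move=> x; have h : f_ n x - f x @[n --> \oo] --> 0.
    by rewrite -(subrr (f x)); apply: cvgB => //; exact: cvg_cst.
  by have := cvgM h h; rewrite mulr0; exact.
- move=> n x; rewrite normrX ler_sqr ?nnegrE//.
    by rewrite (le_trans (ler_normB _ _))// mulr2n mulrDl mul1r lerD.
  by rewrite mulr_ge0// (le_trans _ (fg' x)).
Qed.

End square_integrable.

Section sign_iteration.
Context (F : realType).

(* Newton-Schulz iteration for the sign function on [[-1, 1]]: being polynomial, it
   preserves the algebra of multipliers. *)
Definition signstep (x : F) := (3 * x - x ^+ 3) / 2.

Lemma signstepN x : signstep (- x) = - signstep x.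
Proof. by rewrite /signstep; field. Qed.

Lemma iter_signstepN n x : iter n signstep (- x) = - iter n signstep x.
Proof. by elim: n => //= n ->; rewrite signstepN. Qed.

Lemma iter_signstep_bound n (x : F) : 0 < x <= 1 ->
  x <= iter n signstep x <= 1 /\ 1 - iter n signstep x <= (1 - x / 2) ^+ n.
Proof.
move=> /andP[x0 x1]; elim: n => [|n [/andP[IH1 IH2] IH3]] /=.
  by rewrite expr0 lexx x1; split => //; move: x0; lra.
move: (iter n signstep x) IH1 IH2 IH3 => y y1 y2 y3.
have y0 : 0 < y by exact: lt_le_trans y1.
have e : 1 - signstep y = (1 - y) * ((2 - y - y ^+ 2) / 2) by rewrite /signstep; field.
have b1 : 0 <= (2 - y - y ^+ 2) / 2 by nra.
have b2 : (2 - y - y ^+ 2) / 2 <= 1 - x / 2 by nra.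
have b3 : 0 <= 1 - y by rewrite subr_ge0.
split; last first.
  by rewrite e [leRHS]exprSr; apply: ler_pM.
apply/andP; split; last by rewrite -subr_ge0 e mulr_ge0.
have : 0 <= signstep y - y by rewrite (_ : _ - _ = y * ((1 - y) * (1 + y)) / 2); [nra|rewrite /signstep; field].
by rewrite subr_ge0; exact: le_trans.
Qed.

Lemma cvg_iter_signstep (x : F) : `|x| <= 1 -> iter n signstep x @[n --> \oo] --> Num.sg x.
Proof.
have pos (z : F) : 0 < z <= 1 -> iter n signstep z @[n --> \oo] --> (1 : F).
  move=> z01; have /andP[z0 z1] := z01.
  rewrite -[X in _ --> X]subr0.
  have -> : (fun n => iter n signstep z) = (fun n => 1 - (1 - iter n signstep z)).
    by apply/funext => n; rewrite subKr.
  apply: cvgB; first exact: cvg_cst.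
  apply: (@squeeze_cvgr _ _ _ _ (cst 0) (fun n => (1 - z / 2) ^+ n)).
  - apply: nearW => n /=; have [/andP[_ h1] h2] := iter_signstep_bound n z01.
    by rewrite subr_ge0 h1.
  - exact: cvg_cst.
  - by apply: cvg_expr; rewrite ltr_norml; apply/andP; split; lra.
move=> x1; have [x0|x0|->] := ltrgt0P x.
- by rewrite gtr0_sg//; apply: pos; rewrite x0 (le_trans (ler_norm _)).
- rewrite ltr0_sg//; have -> : (fun n => iter n signstep x) = (fun n => - iter n signstep (- x)).
    by apply/funext => n; rewrite iter_signstepN opprK.
  apply: cvgN; apply: pos; rewrite oppr_gt0 x0 (le_trans _ x1)// -normrN; exact: ler_norm.
- rewrite sgr0; apply: (@cvg_near_cst _ _ _ _ _ _).
  by apply: nearW => n; elim: n => //= n ->; rewrite /signstep expr0n/= mulr0 subr0 mul0r.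
Qed.

Lemma norm_iter_signstep n (x : F) : `|x| <= 1 -> `|iter n signstep x| <= 1.
Proof.
have pos (z : F) : 0 < z <= 1 -> `|iter n signstep z| <= 1.
  move=> z01; have [/andP[h0 h1] _] := iter_signstep_bound n z01.
  by rewrite ger0_norm// (le_trans _ h0)// ltW; case/andP: z01.
move=> x1; have [x0|x0|->] := ltrgt0P x.
- by apply: pos; rewrite x0 (le_trans (ler_norm _)).
- by rewrite -normrN -iter_signstepN; apply: pos; rewrite oppr_gt0 x0 (le_trans _ x1)// -normrN ler_norm.
- suff -> : iter n signstep 0 = 0 by rewrite normr0.
  by elim: (n) => //= m ->; rewrite /signstep expr0n/= mulr0 subr0 mul0r.
Qed.

Lemma cvg_sg_sin (z : F) : Num.sg (sin (z / n.+1%:R)) @[n --> \oo] --> Num.sg z.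
Proof.
have pos (w : F) n : 0 < w -> w < n.+1%:R -> 0 < sin (w / n.+1%:R).
  move=> w0 wn; apply: sin_gt0_pi; rewrite divr_gt0//= ltr_pdivrMr//.
  by rewrite (lt_trans wn)// ltr_pMl// (lt_le_trans _ (pi_ge2 F))// ltr1n.
apply: (@cvg_near_cst _ _ _ _ _ _).
have [z0|z0|->] := ltrgt0P z.
- exists (Num.truncn z) => // n /= zn; rewrite gtr0_sg// ?gtr0_sg//.
  by apply: pos => //; rewrite (lt_le_trans (truncnS_gt z))// ler_nat.
- exists (Num.truncn (- z)) => // n /= zn; rewrite [RHS]ltr0_sg//.
  rewrite -[sin _]opprK -sinN -mulNr sgrN gtr0_sg// pos ?oppr_gt0//.
  by rewrite (lt_le_trans (truncnS_gt _))// ler_nat.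
- by apply: nearW => n; rewrite mul0r sin0.
Qed.

End sign_iteration.

Section coordinates.
Context (F : realType) (r : nat).

Lemma measurable_coord (i : 'I_r) : measurable_fun setT (fun x : 'cV[F]_r => x i 0).
Proof.
move=> _ B mB; rewrite setTI; apply: sub_sigma_algebra.
by rewrite /= (bigD1 i)//=; left; exists B => //; rewrite setTI.
Qed.

End coordinates.

Section polynomial_density.
Context (F : realType) (r : nat) (mu : {measure set 'cV[F]_r -> \bar F}).
Implicit Types f g h p : 'cV[F]_r -> F.
Variable P : ('cV[F]_r -> F) -> Prop.
Hypothesis P1 : P (cst 1).
Hypothesis PD : forall f g, P f -> P g -> P (fun x => f x + g x).
Hypothesis PZ : forall k f, P f -> P (fun x => k * f x).
Hypothesis PX : forall i f, P f -> P (fun x => x i 0 * f x).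
Hypothesis Pm : forall f, P f -> measurable_fun setT f.
Hypothesis Pexp : forall f, P f -> exists C k : F,
  [/\ 0 <= C, 0 <= k & forall x, `|f x| <= C * expR (k * \sum_i `|x i 0|)].
Hypothesis mu_exp : forall u : 'I_r -> F,
  mu.-integrable setT (EFin \o (fun x : 'cV[F]_r => expR (\sum_i u i * x i 0))).

Definition approximable (f : 'cV[F]_r -> F) := sqint mu f /\
  forall eps, 0 < eps -> exists2 p, P p & sqn mu (fun x => f x - p x) <= eps.

(* A bounded [g] with this property sends approximable functions to approximable
   ones, so that multipliers form an algebra closed under bounded limits. It
   contains the functions [sin (u * (x i - a))], hence the indicators of
   half-spaces, hence those of all measurable sets. *)
Definition multiplier (g : 'cV[F]_r -> F) := [/\ measurable_fun setT g, exists M, forall x, `|g x| <= M &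
  forall p, P p -> approximable (fun x => g x * p x)].

Let sqint_exp C k : 0 <= k -> sqint mu (fun x : 'cV[F]_r => C * expR (k * \sum_i `|x i 0|)).
Proof.
move=> k0; apply: sqintZ; split.
  apply: measurableT_comp => //; apply: measurable_funM => //.
  by apply: measurable_sum => i; apply: measurableT_comp => //; exact: measurable_coord.
have := @integrable_exp_norm _ _ _ mu _ (fun i (x : 'cV[F]_r) => x i 0) (cst 1) _ _ _ (2 * k) _.
rewrite (_ : (fun x => _ ^+ 2) = (fun x : 'cV[F]_r => `|cst 1 x| * expR (2 * k * \sum_i `|x i 0|))); last first.
  by apply/funext => x; rewrite /cst normr1 mul1r -expRM_natl mulrA.
apply => //.
- by move=> i; exact: measurable_coord.
- move=> u; rewrite (_ : (fun t => _) = (fun x : 'cV[F]_r => expR (\sum_i u i * x i 0)))//.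
  by apply/funext => x; rewrite mul1r.
- by rewrite mulr_ge0.
Qed.

Lemma sqint_poly f : P f -> sqint mu f.
Proof.
by move=> Pf; have [C [k [C0 k0 fC]]] := Pexp Pf; apply: (sqint_le (Pm Pf) fC); exact: sqint_exp.
Qed.

Let sqn_sub_self f : sqn mu (fun x => f x - f x) = 0.
Proof.
rewrite /sqn; under eq_Rintegral do rewrite subrr expr0n/=.
by rewrite Rintegral_cst// mul0r.
Qed.

Lemma approximable_poly f : P f -> approximable f.
Proof.
move=> Pf; split; first exact: sqint_poly.
by move=> eps eps0; exists f => //; rewrite sqn_sub_self ltW.
Qed.

Lemma approximable_closed f : sqint mu f ->
  (forall eps, 0 < eps -> exists2 g, approximable g & sqn mu (fun x => f x - g x) <= eps) ->
  approximable f.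
Proof.
move=> Hf fg; split => // eps eps0.
have [g [Hg ga] fgle] := fg _ (divr_gt0 eps0 (ltr0Sn _ 3)).
have [p Pp gple] := ga _ (divr_gt0 eps0 (ltr0Sn _ 3)).
exists p => //.
rewrite (_ : (fun x => _) = (fun x => (f x - g x) + (g x - p x))); last first.
  by apply/funext => x; ring.
apply: le_trans (sqnD_le (sqintB Hf Hg) (sqintB Hg (sqint_poly Pp))) _.
by move: fgle gple; lra.
Qed.

Lemma approximable_cvg (f_ : nat -> 'cV[F]_r -> F) (f g : 'cV[F]_r -> F) :
  (forall n, approximable (f_ n)) -> measurable_fun setT f ->
  (forall x, f_ n x @[n --> \oo] --> f x) ->
  (forall n x, `|f_ n x| <= g x) -> sqint mu g -> approximable f.
Proof.
move=> fa mf ff fg Hg.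
have [|Hf f0] := sqint_cvg _ mf ff fg Hg; first by move=> n; have [[]] := fa n.
apply: approximable_closed => // eps eps0.
move/cvgrPdist_le: f0 => /(_ _ eps0)[N _ /(_ N (leqnn _))].
rewrite /= sub0r normrN ger0_norm ?sqn_ge0// => h.
exists (f_ N) => //; rewrite (_ : (fun x => _) = (fun x => - 1 * (f_ N x - f x))); last first.
  by apply/funext => x; ring.
by rewrite sqnZ ?sqrrN ?expr1n ?mul1r//; apply: sqintB => //; have [] := fa N.
Qed.

Lemma approximableD f g : approximable f -> approximable g ->
  approximable (fun x => f x + g x).
Proof.
move=> [Hf fa] [Hg ga]; split; first exact: sqintD.
move=> eps eps0.
have [p Pp fp] := fa _ (divr_gt0 eps0 (ltr0Sn _ 3)).
have [q Pq gq] := ga _ (divr_gt0 eps0 (ltr0Sn _ 3)).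
exists (fun x => p x + q x); first exact: PD.
rewrite (_ : (fun x => _) = (fun x => (f x - p x) + (g x - q x))); last first.
  by apply/funext => x; ring.
apply: le_trans (sqnD_le (sqintB Hf (sqint_poly Pp)) (sqintB Hg (sqint_poly Pq))) _.
by move: fp gq; lra.
Qed.

Lemma multiplier_approximable g f : multiplier g -> approximable f ->
  approximable (fun x => g x * f x).
Proof.
move=> [mg [M gM] gp] [Hf fa].
have M0 : 0 <= M by exact: le_trans (gM 0).
have gfM h x : `|g x * h x| <= M * `|h x| by rewrite normrM ler_wpM2r.
have sq_norm h : sqint mu h -> sqint mu (fun x => M * `|h x|).
  move=> [mh hi]; apply: sqintZ; split; first exact: measurableT_comp.
  rewrite (_ : (fun x => _) = (fun x => h x ^+ 2))//.
  by apply/funext => x; rewrite real_normK ?num_real.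
have gh h : sqint mu h -> sqint mu (fun x => g x * h x).
  move=> Hh; apply: (sqint_le _ (gfM h)); last exact: sq_norm.
  by apply: measurable_funM => //; case: Hh.
apply: approximable_closed; first exact: gh.
move=> eps eps0.
have [|p Pp fp] := fa (eps / (M ^+ 2 + 1)).
  by rewrite divr_gt0// ltr_wpDl// sqr_ge0.
exists (fun x => g x * p x); first exact: gp.
have Hfp := sqintB Hf (sqint_poly Pp).
rewrite (_ : (fun x => _) = (fun x => g x * (f x - p x))); last first.
  by apply/funext => x; ring.
apply: le_trans (sqn_le _ (gfM _) (sq_norm _ Hfp)) _.
  by case: (gh _ Hfp).
have [_ Hn] := sq_norm _ Hfp.
have -> : sqn mu (fun x => M * `|f x - p x|) = M ^+ 2 * sqn mu (fun x => f x - p x).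
  rewrite /sqn -RintegralZl//; last by case: Hfp.
  by apply: eq_Rintegral => x _; rewrite exprMn real_normK ?num_real.
rewrite (@le_trans _ _ (M ^+ 2 * (eps / (M ^+ 2 + 1))))// ?ler_wpM2l ?sqr_ge0//.
rewrite mulrA ler_pdivrMr; last by rewrite ltr_wpDl// sqr_ge0.
by rewrite mulrDr mulr1 mulrC lerDl ltW.
Qed.

Lemma multiplier_cst k : multiplier (cst k).
Proof.
split => //; first by exists `|k|.
by move=> p Pp; apply: approximable_poly; exact: PZ.
Qed.

Lemma multiplierM g h : multiplier g -> multiplier h -> multiplier (fun x => g x * h x).
Proof.
move=> Ag [mh [N hN] hp]; have [mg [M gM] _] := Ag; split.
- exact: measurable_funM.
- by exists (M * N) => x; rewrite normrM ler_pM.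
- move=> p Pp; under eq_fun do rewrite -mulrA.
  by apply: multiplier_approximable => //; exact: hp.
Qed.

Lemma multiplierD g h : multiplier g -> multiplier h -> multiplier (fun x => g x + h x).
Proof.
move=> [mg [M gM] gp] [mh [N hN] hp]; split.
- exact: measurable_funD.
- by exists (M + N) => x; rewrite (le_trans (ler_normD _ _))// lerD.
- move=> p Pp; under eq_fun do rewrite mulrDl.
  by apply: approximableD; [exact: gp|exact: hp].
Qed.

Lemma multiplierZ k g : multiplier g -> multiplier (fun x => k * g x).
Proof. by move=> Ag; apply: multiplierM Ag; exact: multiplier_cst. Qed.

Lemma multiplier_cvg (g_ : nat -> 'cV[F]_r -> F) (g : 'cV[F]_r -> F) M :
  (forall n, multiplier (g_ n)) -> (forall n x, `|g_ n x| <= M) ->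
  (forall x, g_ n x @[n --> \oo] --> g x) -> multiplier g.
Proof.
move=> Ag gM gg.
have mg : measurable_fun setT g.
  apply: (measurable_fun_cvg (h := g_)) => //.
  by move=> n; have [] := Ag n.
split => //.
  exists M => x; apply: (ler_cvg_to (cvg_norm (gg x)) (cvg_cst M)).
  by apply: nearW => n; exact: gM.
move=> p Pp; have Hp := sqint_poly Pp.
apply: (@approximable_cvg (fun n x => g_ n x * p x) _ (fun x => M * `|p x|)).
- by move=> n; have [_ _] := Ag n; exact.
- by apply: measurable_funM => //; exact: Pm.
- by move=> x; apply: cvgMl; exact: gg.
- by move=> n x; rewrite normrM ler_wpM2r.
- apply: sqintZ; split; first by apply: measurableT_comp => //; exact: Pm.
  rewrite (_ : (fun x => _) = (fun x => p x ^+ 2)); first by case: Hp.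
  by apply/funext => x; rewrite real_normK ?num_real.
Qed.

Lemma poly_affine_pow i (u a : F) n p : P p ->
  P (fun x : 'cV[F]_r => (u * (x i 0 - a)) ^+ n * p x).
Proof.
elim: n p => [|n IH] p Pp; first by under eq_fun do rewrite expr0 mul1r.
rewrite (_ : (fun x => _) =
    (fun x : 'cV[F]_r => (u * (x i 0 - a)) ^+ n * (u * (x i 0 * p x) + - (u * a) * p x))).
  by apply: IH; apply: PD; apply: PZ => //; exact: PX.
by apply/funext => x; rewrite exprSr; ring.
Qed.

Lemma poly_sum (h : nat -> 'cV[F]_r -> F) n : (forall k, P (h k)) ->
  P (fun x => \sum_(k < n) h k x).
Proof.
move=> Ph; elim: n => [|n IH].
  rewrite (_ : (fun x => _) = (fun x => 0 * cst 1 x)); first exact: PZ.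
  by apply/funext => x; rewrite big_ord0 mul0r.
by under eq_fun do rewrite big_ord_recr /=; exact: PD.
Qed.

Lemma multiplier_sin i (u a : F) : multiplier (fun x : 'cV[F]_r => sin (u * (x i 0 - a))).
Proof.
have mz : measurable_fun setT (fun x : 'cV[F]_r => u * (x i 0 - a)).
  by apply: measurable_funM => //; apply: measurable_funB => //; exact: measurable_coord.
have ms : measurable_fun setT (fun x : 'cV[F]_r => sin (u * (x i 0 - a))).
  apply: measurableT_comp => //; apply: continuous_measurable_fun; exact: continuous_sin.
split => //.
  by exists 1 => x; rewrite ler_norml sin_geN1 sin_le1.
move=> p Pp; have [C [k [C0 k0 pC]]] := Pexp Pp.
apply: (@approximable_cvg (fun n (x : 'cV[F]_r) => (\sum_(k < n) sin_coeff (u * (x i 0 - a)) k) * p x)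
  _ (fun x : 'cV[F]_r => (expR `|u * a| * C) * expR ((`|u| + k) * \sum_i `|x i 0|))).
- move=> n; apply: approximable_poly; under eq_fun do rewrite mulr_suml.
  apply: (poly_sum (h := fun k (x : 'cV[F]_r) => sin_coeff (u * (x i 0 - a)) k * p x)) => m.
  rewrite (_ : (fun x => _) = (fun x : 'cV[F]_r => ((odd m)%:R * (-1) ^+ m.-1./2 / m`!%:R) *
      ((u * (x i 0 - a)) ^+ m * p x))).
    by apply: PZ; exact: poly_affine_pow.
  by apply/funext => x; rewrite /sin_coeff /=; ring.
- by apply: measurable_funM => //; exact: Pm.
- move=> x; apply: cvgMl; rewrite (_ : sin _ = lim (series (sin_coeff (u * (x i 0 - a))) @ \oo)); last by rewrite unlock.
  have := @is_cvg_series_sin_coeff _ (u * (x i 0 - a)).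
  suff -> : (fun n => \sum_(k < n) sin_coeff (u * (x i 0 - a)) k) =
    series (sin_coeff (u * (x i 0 - a))) by [].
  by apply/funext => n; rewrite seriesEnat /= big_mkord.
- move=> n x; rewrite normrM.
  rewrite (_ : _ * expR _ = (expR `|u * a| * expR (`|u| * \sum_i `|x i 0|)) *
      (C * expR (k * \sum_i `|x i 0|))); last by rewrite mulrDl expRD; ring.
  apply: ler_pM => //.
  apply: le_trans (ler_norm_sum _ _ _) _.
  apply: (@le_trans _ _ (\sum_(k < n) `|exp_coeff (u * (x i 0 - a)) k|)).
    apply: ler_sum => j _; rewrite /sin_coeff /exp_coeff /= !normrM.
    rewrite ler_wpM2r// ler_piMl// normrX normrN1 expr1n mulr1.
    by case: (odd j); rewrite ?normr1 ?normr0.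
  apply: le_trans (sum_norm_exp_coeff _ _) _.
  rewrite -expRD ler_expR mulrBr (le_trans (ler_normB _ _))// addrC lerD//.
  by rewrite normrM ler_wpM2l// (bigD1 i)//= lerDl sumr_ge0.
- by apply: sqint_exp; rewrite addr_ge0.
Qed.

Lemma multiplier_iter_signstep g n : multiplier g -> (forall x, `|g x| <= 1) ->
  multiplier (fun x => iter n (@signstep F) (g x)).
Proof.
move=> Ag g1; elim: n => //= n IH.
rewrite (_ : (fun x => _) = (fun x => (3 / 2) * iter n (@signstep F) (g x) +
    - 2^-1 * (iter n (@signstep F) (g x) * (iter n (@signstep F) (g x) * iter n (@signstep F) (g x))))).
  by apply: multiplierD; apply: multiplierZ => //; do 2 apply: multiplierM => //.
by apply/funext => x; rewrite /signstep; field.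
Qed.

Lemma multiplier_sg g : multiplier g -> (forall x, `|g x| <= 1) ->
  multiplier (fun x => Num.sg (g x)).
Proof.
move=> Ag g1; apply: (@multiplier_cvg (fun n x => iter n (@signstep F) (g x)) _ 1).
- by move=> n; exact: multiplier_iter_signstep.
- by move=> n x; exact: norm_iter_signstep.
- by move=> x; exact: cvg_iter_signstep.
Qed.

Lemma multiplier_ray i (a : F) : multiplier (\1_[set x : 'cV[F]_r | a < x i 0]).
Proof.
have As : multiplier (fun x : 'cV[F]_r => Num.sg (x i 0 - a)).
  apply: (@multiplier_cvg (fun n (x : 'cV[F]_r) => Num.sg (sin (n.+1%:R^-1 * (x i 0 - a)))) _ 1).
  - move=> n; apply: multiplier_sg; first exact: multiplier_sin.
    by move=> x; rewrite ler_norml sin_geN1 sin_le1.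
  - by move=> n x; rewrite normr_sg; case: (_ != 0).
  - by move=> x; under eq_fun do rewrite mulrC; exact: cvg_sg_sin.
rewrite (_ : \1__ = fun x : 'cV[F]_r => 2^-1 * (Num.sg (x i 0 - a) * Num.sg (x i 0 - a)
    + Num.sg (x i 0 - a))).
  by apply: multiplierZ; apply: multiplierD => //; exact: multiplierM.
apply/funext => x; rewrite indicE.
have [xa|xa|xa] := ltrgtP a (x i 0).
- by rewrite mem_set// gtr0_sg ?subr_gt0//=; field.
- by rewrite memNset/= ?ltr0_sg ?subr_lt0//; [field|apply/negP; rewrite -leNgt ltW].
- by rewrite xa memNset/= ?subrr ?sgr0 ?ltxx//; field.
Qed.

Let setM : set (set 'cV[F]_r) := [set E | multiplier \1_E].

Let setM_sigma : sigma_algebra setT setM.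
Proof.
have setMC E : setM E -> setM (~` E).
  move=> AE; rewrite /setM /= (_ : \1__ = fun x => cst 1 x + -1 * \1_E x).
    by apply: multiplierD; [exact: multiplier_cst|exact: multiplierZ].
  by apply/funext => x; rewrite !indicE in_setC; case: (_ \in _); rewrite /cst/=; ring.
have setMI E G : setM E -> setM G -> setM (E `&` G).
  by move=> AE AG; rewrite /setM /= indicI; exact: multiplierM.
have setM0 : setM set0 by rewrite /setM /= indic0; exact: multiplier_cst.
split => //; first by move=> E AE; rewrite setTD; exact: setMC.
move=> G AG; pose U n := \bigcup_(k < n) G k.
have AU n : setM (U n).
  elim: n => [|n IH]; first by rewrite /U bigcup_mkord big_ord0.
  rewrite /U bigcup_mkord big_ord_recr /= -bigcup_mkord -/(U n) -[_ `|` _]setCK setCU.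
  by apply: (setMC); apply: setMI; exact: setMC.
apply: (@multiplier_cvg (fun n => \1_(U n)) _ 1) => //.
  by move=> n x; rewrite indicE; case: (_ \in _); rewrite ?normr1 ?normr0.
move=> x; apply: cvg_near_cst.
have [xG|xG] := pselect ((\bigcup_k G k) x); last first.
  apply: nearW => n; rewrite !indicE !memNset//; apply: contra_not xG => -[k _ Gk].
  by exists k.
have [k _ Gk] := xG; exists k.+1 => // n /= kn.
by rewrite !indicE !mem_set//; exists k.
Qed.

Lemma multiplier_indic E : measurable E -> multiplier \1_E.
Proof.
suff : g_sigma_preimage (fun (i : 'I_r) (x : 'cV[F]_r) => x i 0) `<=` setM by apply.
apply: smallest_sub => //.
apply: (big_ind (fun S : set (set 'cV[F]_r) => S `<=` setM)) => //.
  by move=> S1 S2 H1 H2 E0 [/H1|/H2].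
move=> i _ _ [B mB <-]; rewrite setTI.
have sB : sigma_algebra setT [set D : set F | setM ((fun x : 'cV[F]_r => x i 0) @^-1` D)].
  have [s0 sC sU] := setM_sigma; split => /=.
  - by rewrite preimage_set0.
  - by move=> D; rewrite !setTD preimage_setC; move/sC; rewrite setTD.
  - by move=> G AG; rewrite preimage_bigcup; exact: sU.
have {}mB : (@ocitv F).-sigma.-measurable B by exact: mB.
rewrite RGenOInfty.measurableE in mB.
suff /(_ _ mB) : <<s @RGenOInfty.G F >> `<=`
  [set D : set F | setM ((fun x : 'cV[F]_r => x i 0) @^-1` D)] by [].
apply: smallest_sub => // _ [a ->] /=.
rewrite /setM /= (_ : _ @^-1` _ = [set x : 'cV[F]_r | a < x i 0]); first exact: multiplier_ray.
by apply/seteqP; split => x /=; rewrite in_itv /= andbT.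
Qed.

Import HBNNSimple.

Lemma multiplier_nnsfun (h : {nnsfun 'cV[F]_r >-> F}) : multiplier h.
Proof.
rewrite (_ : (h : _ -> _) = fun x => \sum_(y <- fset_set (range h)) y * \1_(h @^-1` [set y]) x).
  elim: (fset_set _ : seq F) => [|y s IH].
    by under eq_fun do rewrite big_nil; exact: multiplier_cst.
  under eq_fun do rewrite big_cons.
  by apply: multiplierD => //; apply: multiplierZ; exact: multiplier_indic.
by apply/funext => x; rewrite [LHS]fimfunE fsbig_finite.
Qed.

Theorem polynomial_density f : sqint mu f -> approximable f.
Proof.
have ge0 g : sqint mu g -> (forall x, 0 <= g x) -> approximable g.
  move=> Hg g0; have [mg _] := Hg.
  have mEg : measurable_fun setT (EFin \o g) by exact/measurable_EFinP.
  pose h n := nnsfun_approx measurableT mEg n.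
  have hg x : h n x @[n --> \oo] --> g x.
    have := @cvg_nnsfun_approx _ _ _ _ measurableT _ mEg (fun x _ => g0 x : (0 <= (g x)%:E)%E) x I.
    by move/fine_cvg.
  apply: (@approximable_cvg h g g) => //.
    move=> n; have [_ _ /(_ _ P1)] := multiplier_nnsfun (h n).
    by under eq_fun do rewrite mulr1.
  move=> n x; rewrite ger0_norm// -(cvg_lim _ (hg x))//.
  apply: (@nondecreasing_cvgn_le _ (h ^~ x)); last by apply/cvg_ex; exists (g x); exact: hg.
  by move=> a b ab; have /lefP := nd_nnsfun_approx measurableT mEg ab; exact.
move=> Hf; have [mf _] := Hf.
have Hn : sqint mu (fun x => `|f x|).
  split; first exact: measurableT_comp.
  rewrite (_ : (fun x => _) = (fun x => f x ^+ 2)); first by case: Hf.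
  by apply/funext => x; rewrite real_normK ?num_real.
have part k : approximable (fun x => Order.max (k * f x) 0).
  apply: (ge0 (fun x => Order.max (k * f x) 0)).
    apply: (sqint_le (g := fun x => `|k| * `|f x|)); last exact: sqintZ.
      by apply: measurable_maxr => //; exact: measurable_funM.
    by move=> x; rewrite ger0_norm ?le_max ?lexx ?orbT// ge_max -normrM ler_norm normr_ge0.
  by move=> x; rewrite le_max lexx orbT.
rewrite (_ : f = fun x => Order.max (1 * f x) 0 + cst (-1) x * Order.max (-1 * f x) 0).
  by apply: approximableD => //; apply: multiplier_approximable => //; exact: multiplier_cst.
apply/funext => x; rewrite /cst mul1r !mulN1r.
by have [x0|x0] := leP (f x) 0; have [y0|y0] := leP (- f x) 0; lra.
Qed.

End polynomial_density.

(** * Gaussian moments *)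

Section density_integral.
Context (F : realType).
Import HBNNSimple.

Lemma integral_weighted_nnsfun d (X : measurableType d) (mu : {measure set X -> \bar F})
    d' (T : measurableType d') (Y : X -> T) (phi : X -> F) (h : {nnsfun T >-> F}) :
  measurable_fun setT Y -> measurable_fun setT phi -> (forall x, 0 <= phi x) ->
  (\int[mu]_x (phi x * h (Y x))%:E =
   \sum_(y <- fset_set (range h))
     `|y|%:E * \int[mu]_x (phi x * \1_(h @^-1` [set y]) (Y x))%:E)%E.
Proof.
move=> mY mphi phi0.
have mh y : measurable (h @^-1` [set y]) by exact: measurable_funPTI.
have mterm y : measurable_fun setT (fun x => phi x * \1_(h @^-1` [set y]) (Y x)).
  apply: measurable_funM => //; apply: (measurableT_comp _ mY).
  exact: measurable_indic.
transitivity (\int[mu]_x (\sum_(y <- fset_set (range h))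
    (`|y| * (phi x * \1_(h @^-1` [set y]) (Y x)))%:E))%E.
  apply: eq_integral => x _; rewrite sumEFin fimfunE fsbig_finite// mulr_sumr.
  congr EFin; rewrite big_seq [RHS]big_seq; apply: eq_bigr => y.
  rewrite in_fset_set// inE => -[t _ <-].
  by rewrite ger0_norm//; ring.
rewrite ge0_integral_sum//; last 2 first.
- by move=> y; apply/measurable_EFinP; exact: measurable_funM.
- by move=> y x _; rewrite lee_fin !mulr_ge0.
apply: eq_bigr => y _; under eq_integral do rewrite EFinM.
rewrite ge0_integralZl_EFin//; first by move=> x _; rewrite lee_fin mulr_ge0.
exact/measurable_EFinP.
Qed.

Lemma ge0_integral_weighted d (X : measurableType d) (mu : {measure set X -> \bar F})
    d' (T : measurableType d') (nu : {measure set T -> \bar F})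
    (Y : X -> T) (phi : X -> F) (kappa : F) (g : T -> F) :
  measurable_fun setT Y -> measurable_fun setT phi -> (forall x, 0 <= phi x) ->
  0 <= kappa ->
  (forall D, measurable D ->
    (\int[mu]_x (phi x * \1_D (Y x))%:E = kappa%:E * nu D)%E) ->
  measurable_fun setT g -> (forall t, 0 <= g t) ->
  (\int[mu]_x (phi x * g (Y x))%:E = kappa%:E * \int[nu]_t (g t)%:E)%E.
Proof.
move=> mY mphi phi0 kappa0 HD mg g0.
have simple (h : {nnsfun T >-> F}) :
    (\int[mu]_x (phi x * h (Y x))%:E = kappa%:E * \int[nu]_t (h t)%:E)%E.
  have mh y : measurable (h @^-1` [set y]) by exact: measurable_funPTI.
  rewrite integral_weighted_nnsfun//.
  have -> : (\int[nu]_t (h t)%:E = \int[nu]_t (cst 1 t * h (id t))%:E)%E.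
    by apply: eq_integral => t _; rewrite /cst mul1r.
  rewrite integral_weighted_nnsfun// ge0_sume_distrr; last first.
    by move=> y _; rewrite mule_ge0 ?lee_fin// integral_ge0// => t _; rewrite lee_fin mulr_ge0.
  apply: eq_bigr => y _; rewrite HD// muleCA; congr (_ * (_ * _))%E.
  under eq_integral do rewrite /cst mul1r.
  by rewrite integral_indic// setIT.
have mEg : measurable_fun setT (EFin \o g) by exact/measurable_EFinP.
pose h n := nnsfun_approx measurableT mEg n.
have hg t : (h n t)%:E @[n --> \oo] --> (g t)%:E.
  have := @cvg_nnsfun_approx _ _ _ _ measurableT _ mEg
    (fun x _ => g0 x : (0 <= (g x)%:E)%E) t I.
  exact.
have hnd t : {homo (fun n => h n t) : m n / (m <= n)%N >-> m <= n}.
  by move=> a b ab; have /lefP := nd_nnsfun_approx measurableT mEg ab; exact.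
have mono d0 (X0 : measurableType d0) (m : {measure set X0 -> \bar F}) (Z : X0 -> T)
    (psi : X0 -> F) : measurable_fun setT Z -> measurable_fun setT psi ->
    (forall x, 0 <= psi x) ->
    (\int[m]_x (psi x * h n (Z x))%:E)%E @[n --> \oo] -->
    (\int[m]_x (psi x * g (Z x))%:E)%E.
  move=> mZ mpsi psi0.
  rewrite (_ : (\int[m]_x (psi x * g (Z x))%:E =
      \int[m]_x (limn (fun n => (psi x * h n (Z x))%:E)))%E); last first.
    apply: eq_integral => x _; apply/esym/cvg_lim => //.
    under eq_fun do rewrite EFinM.
    by rewrite EFinM; apply: cvgeZl => //; exact: hg.
  apply: cvg_monotone_convergence => //.
  - move=> n; apply/measurable_EFinP; apply: measurable_funM => //.
    exact: measurableT_comp.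
  - by move=> n x _; rewrite lee_fin mulr_ge0.
  - by move=> x _ a b ab; rewrite lee_fin ler_wpM2l// hnd.
have h1 := mono _ _ mu _ _ mY mphi phi0.
have h2 := mono _ _ nu id (cst 1) (@measurable_id _ _ _) (measurable_cst _)
  (fun=> ler01).
have h2' : (\int[nu]_t (cst 1 t * h n (id t))%:E)%E @[n --> \oo] --> (\int[nu]_t (g t)%:E)%E.
  by have -> : (\int[nu]_t (g t)%:E = \int[nu]_t (cst 1 t * g (id t))%:E)%E by
    apply: eq_integral => t _; rewrite /cst mul1r.
have h3 : (kappa%:E * \int[nu]_t (cst 1 t * h n (id t))%:E)%E @[n --> \oo] -->
    (kappa%:E * \int[nu]_t (g t)%:E)%E by apply: cvgeZl.
apply: (cvg_unique _ h1); first exact: ereal_hausdorff.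
rewrite (_ : (fun n => _) = fun n => (kappa%:E * \int[nu]_t (cst 1 t * h n (id t))%:E)%E)//.
apply/funext => n; rewrite simple; congr (_ * _)%E.
by apply: eq_integral => t _; rewrite /cst mul1r.
Qed.

End density_integral.

Section gaussian_mgf.
Context (F : realType).

Lemma normal_mgf (s : F) : s != 0 ->
  (\int[normal_prob 0 s]_x (expR x)%:E = (expR (s ^+ 2 / 2))%:E)%E.
Proof.
move=> s0.
have mpdf : measurable_fun setT (@normal_pdf F 0 s) by exact: measurable_normal_pdf.
have := @ge0_integral_weighted F _ _ lebesgue_measure _ _ (normal_prob 0 s) id
  (normal_pdf 0 s) 1 (@expR F) (@measurable_id _ _ _) mpdf
  (normal_pdf_ge0 0 s) ler01.
rewrite mul1e => <- //; first last.
- move=> D mD; rewrite mul1e /normal_prob [RHS]integral_mkcond.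
  apply: eq_integral => x _; rewrite patchE indicE.
  by case: (_ \in _); rewrite ?mulr1 ?mulr0.
transitivity (\int[lebesgue_measure]_x ((expR (s ^+ 2 / 2))%:E * (normal_pdf (s ^+ 2) s x)%:E))%E.
  apply: eq_integral => x _; rewrite -EFinM; congr EFin.
  rewrite /normal_pdf (negbTE s0) mulrCA -mulrA; congr (_ * _).
  by rewrite /normal_fun -!expRD; congr expR; rewrite subr0; field.
rewrite ge0_integralZl_EFin//.
- by rewrite integral_normal_pdf mule1.
- by move=> x _; rewrite lee_fin normal_pdf_ge0.
- by apply/measurable_EFinP; exact: measurable_normal_pdf.
Qed.

Lemma gauss1_mgf d (Om : measurableType d) (Pr : probability Om F) (z : Om -> F) (v : F) :
  0 <= v -> measurable_fun setT z ->
  (forall D, measurable D -> Pr (z @^-1` D) = gauss1 v D) ->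
  (\int[Pr]_w (expR (z w))%:E = (expR (v / 2))%:E)%E.
Proof.
move=> v0 mz law.
have weighted (T := measurableTypeR F) (nu : {measure set T -> \bar F}) :
    (forall D : set T, measurable D -> Pr (z @^-1` D) = nu D) ->
    (\int[Pr]_w (expR (z w))%:E = \int[nu]_x (expR x)%:E)%E.
  move=> nuE; have mexp : measurable_fun [set: T] (@expR F) by exact: measurable_expR.
  have := @ge0_integral_weighted F _ _ Pr _ T nu z (cst 1) 1 (@expR F) mz
    (measurable_cst _) (fun=> ler01) ler01.
  rewrite mul1e => <- //; first by apply: eq_integral => w _; rewrite /cst mul1r.
  move=> D mD; rewrite mul1e -nuE// /cst; under eq_integral do rewrite mul1r.
  have mzD : measurable (z @^-1` D) by rewrite -[X in measurable X]setTI; exact: mz.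
  rewrite (_ : (fun w => _) = (fun w => (\1_(z @^-1` D) w)%:E))//.
  by rewrite integral_indic// setIT.
have [v00|vN0] := eqVneq v 0.
  rewrite (weighted (dirac (0 : measurableTypeR F))).
    have mexp : measurable_fun [set: measurableTypeR F] (EFin \o @expR F).
      by apply/measurable_EFinP; exact: measurable_expR.
    by rewrite (integral_dirac _ measurableT mexp) diracT mul1e /= v00 mul0r.
  by move=> D mD; transitivity (gauss1 v D); [exact: law|rewrite /gauss1 v00 eqxx].
rewrite (weighted (normal_prob 0 (Num.sqrt v))).
  by rewrite normal_mgf ?sqr_sqrtr// sqrtr_eq0 -ltNge lt_neqAle eq_sym vN0.
by move=> D mD; transitivity (gauss1 v D); [exact: law|rewrite /gauss1 (negbTE vN0)].
Qed.

End gaussian_mgf.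

Section independent_products.
Context (F : realType) d (Om : measurableType d) (Pr : probability Om F).
Context k n (Y : 'I_k -> Om -> 'cV[F]_n).
Hypothesis mY : forall i, measurable_fun setT (Y i).
Hypothesis indep : mutually_independent Pr Y.

Lemma expectation_independent_prod (g : 'I_k -> 'cV[F]_n -> F) (e : 'I_k -> F) :
  (forall i, measurable_fun setT (g i)) -> (forall i x, 0 <= g i x) ->
  (forall i, (\int[Pr]_w (g i (Y i w))%:E = (e i)%:E)%E) ->
  (\int[Pr]_w (\prod_i g i (Y i w))%:E = (\prod_i e i)%:E)%E.
Proof.
move=> mg g0 ge.
have e0 i : 0 <= e i.
  by rewrite -lee_fin -ge integral_ge0// => w _; rewrite lee_fin.
pose a j (D : 'I_k -> set 'cV[F]_n) (i : 'I_k) (x : 'cV[F]_n) : F :=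
  if (i < j)%N then g i x else \1_(D i) x.
pose b j (D : 'I_k -> set 'cV[F]_n) (i : 'I_k) : F :=
  if (i < j)%N then e i else fine (Pr (Y i @^-1` D i)).
have a0 j D i x : 0 <= a j D i x by rewrite /a; case: ifP.
have b0 j D i : 0 <= b j D i by rewrite /b; case: ifP => // _; exact: fine_ge0.
have ma j D i : (forall i, measurable (D i)) -> measurable_fun setT (a j D i).
  by move=> mD; rewrite /a; case: ltnP => // _; exact: measurable_indic.
have main j D : (j <= k)%N -> (forall i, measurable (D i)) ->
    (\int[Pr]_w (\prod_i a j D i (Y i w))%:E = (\prod_i b j D i)%:E)%E.
  elim: j D => [|j IH] D jk mD.
    transitivity (\int[Pr]_w (\1_(\bigcap_i (Y i @^-1` D i)) w)%:E)%E.
      apply: eq_integral => w _; congr EFin; rewrite indicE.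
      have [wD|wD] := pselect ((\bigcap_i (Y i @^-1` D i)) w).
        rewrite mem_set// big1// => i _; rewrite /a ltn0 indicE mem_set//.
        exact: wD.
      rewrite memNset//; move/existsNP: wD => [i /not_implyP[_ wi]].
      by rewrite (bigD1 i)//= /a ltn0 indicE memNset// mul0r.
    have mYD i : measurable (Y i @^-1` D i) by rewrite -[X in measurable X]setTI; exact: mY.
    rewrite integral_indic//; last by apply: fin_bigcap_measurable.
    rewrite setIT; transitivity (\prod_(i < k) Pr (Y i @^-1` D i))%E; first exact: (indep mD).
    rewrite -prodEFin; apply: eq_bigr => i _.
    by rewrite /b ltn0 fineK// fin_num_measure.
  pose i0 := Ordinal jk.
  have ne (i : 'I_k) : i != i0 -> (val i == j) = false by move=> /negbTE; rewrite -val_eqE.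
  have aN i : i != i0 -> a j.+1 D i = a j D i.
    by move=> ii0; rewrite /a ltnS leq_eqVlt ne//.
  have bN i : i != i0 -> b j.+1 D i = b j D i.
    by move=> ii0; rewrite /b ltnS leq_eqVlt ne//.
  pose phi w := \prod_(i | i != i0) a j D i (Y i w).
  pose kappa := \prod_(i | i != i0) b j D i.
  transitivity (\int[Pr]_w (phi w * g i0 (Y i0 w))%:E)%E.
    apply: eq_integral => w _; rewrite (bigD1 i0)//= mulrC; congr (_ * _)%:E.
      by apply: eq_bigr => i ii0; rewrite aN.
    by rewrite /a /= ltnSn.
  pose Yi : {mfun Om >-> 'cV[F]_n} := mfun_Sub (mem_set (mY i0)).
  rewrite (@ge0_integral_weighted F _ _ Pr _ _ (pushforward Pr Yi) (Y i0) phi kappa).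
  - rewrite ge0_integral_pushforward//; last 2 first.
    + exact/measurable_EFinP.
    + by move=> y _; rewrite lee_fin.
    rewrite preimage_setT (_ : (fun x => _) = (fun w => (g i0 (Y i0 w))%:E))// ge -EFinM.
    congr EFin; rewrite [RHS](bigD1 i0)//= mulrC; congr (_ * _).
      by rewrite /b ltnSn.
    by apply: eq_bigr => i ii0; rewrite bN.
  - exact: mY.
  - rewrite /phi; under eq_fun do rewrite big_mkcond.
    apply: measurable_prod => i _; case: (i != i0); last exact: measurable_cst.
    by apply: (measurableT_comp _ (mY i)); exact: ma.
  - by move=> w; apply: prodr_ge0.
  - by apply: prodr_ge0.
  - move=> E mE.
    pose D' i := if i == i0 then E else D i.
    have mD' i : measurable (D' i) by rewrite /D'; case: ifP.
    have := IH D' (ltnW jk) mD'.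
    rewrite (_ : (\int[Pr]_w _ = \int[Pr]_w (phi w * \1_E (Y i0 w))%:E)%E); last first.
      apply: eq_integral => w _; rewrite (bigD1 i0)//= mulrC; congr (_ * _)%:E.
        by apply: eq_bigr => i ii0; rewrite /a /D' (negbTE ii0).
      by rewrite /a ltnn /D' eqxx.
    move=> ->; rewrite (bigD1 i0)//= mulrC EFinM; congr (_ * _)%E.
      by congr EFin; apply: eq_bigr => i ii0; rewrite /b /D' (negbTE ii0).
    rewrite /b ltnn /D' eqxx fineK//.
    have mYE : measurable (Y i0 @^-1` E) by rewrite -[X in measurable X]setTI; exact: mY.
    exact: fin_num_measure.
  - exact: mg.
  - exact: g0.
have := main k (fun=> setT) (leqnn _) (fun=> measurableT).
rewrite (eq_integral (fun w => (\prod_i g i (Y i w))%:E)); last first.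
  by move=> w _; congr EFin; apply: eq_bigr => i _; rewrite /a ltn_ord.
by move=> ->; congr EFin; apply: eq_bigr => i _; rewrite /b ltn_ord.
Qed.

End independent_products.

Section square_bounded_limit.
Context (F : realType) d (Om : measurableType d) (Pr : probability Om F).

Lemma sqn_EFin (f : Om -> F) : sqint Pr f ->
  (\int[Pr]_w (f w ^+ 2)%:E = (sqn Pr f)%:E)%E.
Proof. by move=> [_ fi]; rewrite /sqn /Rintegral fineK//; exact: (integrable_fin_num _ fi). Qed.

Lemma fatou_sqint (Z_ : nat -> Om -> F) (Z : Om -> F) (K : F) :
  (forall n, sqint Pr (Z_ n)) -> measurable_fun setT Z ->
  {ae Pr, forall w, Z_ n w @[n --> \oo] --> Z w} ->
  (forall n, sqn Pr (Z_ n) <= K) -> sqint Pr Z /\ sqn Pr Z <= K.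
Proof.
move=> HZ mZ ZZ ZK.
have mZ2 n : measurable_fun setT (fun w => (Z_ n w ^+ 2)%:E).
  by apply/measurable_EFinP; apply: measurable_funX; case: (HZ n).
have le : (\int[Pr]_w (Z w ^+ 2)%:E <= K%:E)%E.
  apply: (@le_trans _ _ (\int[Pr]_w limn_einf (fun n => (Z_ n w ^+ 2)%:E))%E).
    apply: ae_ge0_le_integral => //.
    - by move=> w _; rewrite lee_fin sqr_ge0.
    - by apply/measurable_EFinP; exact: measurable_funX.
    - move=> w _; rewrite limn_einf_lim; apply: lime_ge; first exact: is_cvg_einfs.
      by apply: nearW => n; apply: le_ereal_inf_tmp => _ [m _ <-]; rewrite lee_fin sqr_ge0.
    - rewrite (_ : (fun w => _) = (fun w => limn (einfs (fun n => (Z_ n w ^+ 2)%:E)))).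
        apply: (emeasurable_fun_cvg (fun n w => einfs (fun n => (Z_ n w ^+ 2)%:E) n)).
          by move=> n; exact: measurable_fun_einfs.
        by move=> w _; exact: is_cvg_einfs.
      by apply/funext => w; rewrite limn_einf_lim.
    apply: filterS ZZ => w Zw _.
    have h : (Z_ n w ^+ 2)%:E @[n --> \oo] --> (Z w ^+ 2)%:E.
      apply: cvg_EFin; first exact: nearW.
      by have := cvgM Zw Zw; exact.
    by have [-> _] := cvg_limn_einf_sup h.
  apply: le_trans (fatou _ _ _ _) _ => //.
    by move=> n w _; rewrite lee_fin sqr_ge0.
  rewrite limn_einf_lim; apply: lime_le; first exact: is_cvg_einfs.
  apply: nearW => n; apply: (@le_trans _ _ (\int[Pr]_w (Z_ n w ^+ 2)%:E)%E).
    by apply: ereal_inf_lbound; exists n => //=.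
  by rewrite sqn_EFin// lee_fin.
have HZ0 : sqint Pr Z.
  split => //; apply/integrableP; split; first by apply/measurable_EFinP; exact: measurable_funX.
  under eq_integral do rewrite /= ger0_norm ?sqr_ge0//.
  by rewrite (le_lt_trans le)// ltry.
by split => //; rewrite -lee_fin -sqn_EFin.
Qed.

Lemma sqint_integrable (f : Om -> F) : sqint Pr f -> Pr.-integrable setT (EFin \o f).
Proof.
move=> Hf; have H1 : sqint Pr (cst 1).
  split => //; rewrite (_ : EFin \o _ = cst 1%E); first exact: finite_measure_integrable_cst.
  by apply/funext => w /=; rewrite expr1n.
have := sqintM H1 Hf; rewrite (_ : (fun w => _) = f)//.
by apply/funext => w; rewrite mul1r.
Qed.

(* An L2 bound makes the sequence uniformly integrable, through the inequality
   [a <= min(a, L) + a^2 / L] for [a >= 0] and [L > 0]. *)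
Lemma cvg_Rintegral_sqn_bounded (Z_ : nat -> Om -> F) (Z : Om -> F) (K : F) :
  (forall n, sqint Pr (Z_ n)) -> measurable_fun setT Z ->
  {ae Pr, forall w, Z_ n w @[n --> \oo] --> Z w} ->
  (forall n, sqn Pr (Z_ n) <= K) ->
  Pr.-integrable setT (EFin \o Z) /\ \int[Pr]_w Z_ n w @[n --> \oo] --> \int[Pr]_w Z w.
Proof.
move=> HZ_ mZ ZZ ZK; have [HZ ZK0] := fatou_sqint HZ_ mZ ZZ ZK.
split; first exact: sqint_integrable.
have K0 : 0 <= K by rewrite (le_trans _ (ZK 0%N))// sqn_ge0.
apply/cvgrPdist_le => eps eps0.
pose L := (8 * K + 1) / eps; have L0 : 0 < L by rewrite divr_gt0// ltr_wpDl// mulr_ge0.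
have mD n : measurable_fun setT (fun w => `|Z_ n w - Z w|).
  by apply: measurableT_comp => //; apply: measurable_funB => //; case: (HZ_ n).
have HD n : sqint Pr (fun w => Z_ n w - Z w) by exact: sqintB.
have mmin n : measurable_fun setT (fun w => Order.min `|Z_ n w - Z w| L).
  by apply: measurable_minr.
have h0 : \int[Pr]_w Order.min `|Z_ n w - Z w| L @[n --> \oo] --> \int[Pr]_w (cst 0 w : F).
  apply: (@cvg_Rintegral_dominated_ae _ _ _ Pr _ _ (cst L)) => //.
  - apply: filterS ZZ => w Zw.
    have h1 : `|Z_ n w - Z w| @[n --> \oo] --> 0.
      rewrite -[X in _ --> X](normr0 F) -(subrr (Z w)).
      by apply: cvg_norm; apply: cvgB => //; exact: cvg_cst.
    apply: (@squeeze_cvgr _ _ _ _ (cst 0) (fun n => `|Z_ n w - Z w|)) => //.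
      by apply: nearW => n; rewrite /= le_min normr_ge0 (ltW L0) ge_min lexx.
    exact: cvg_cst.
  - by move=> n w; rewrite ger0_norm ?le_min ?normr_ge0 ?(ltW L0)// ge_min lexx orbT.
  - exact: finite_measure_integrable_cst.
rewrite Rintegral_cst// mul0r in h0.
have e20 : 0 < eps / 2 by rewrite divr_gt0.
move/cvgrPdist_le: h0 => /(_ _ e20)[N _ NP]; exists N => // n /= Nn.
have {NP} := NP n Nn; rewrite /= sub0r normrN => hmin.
have imin : Pr.-integrable setT (EFin \o (fun w => Order.min `|Z_ n w - Z w| L)).
  apply: (@le_integrableR _ _ _ _ _ (cst L)) => //.
    by move=> w; rewrite ger0_norm ?le_min ?normr_ge0 ?(ltW L0)// ge_min lexx orbT.
  exact: finite_measure_integrable_cst.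
have [_ iD2] := HD n.
rewrite distrC -RintegralB//; [|exact: sqint_integrable..].
apply: le_trans (le_normr_Rintegral _ _) _ => //.
  exact: (sqint_integrable (HD n)).
apply: (@le_trans _ _ (\int[Pr]_w (Order.min `|Z_ n w - Z w| L + L^-1 * (Z_ n w - Z w) ^+ 2))).
  apply: le_Rintegral => //.
  - by apply/integrable_norm; exact: (sqint_integrable (HD n)).
  - by apply: integrable_addR => //; exact: integrableZR.
  - move=> w _; rewrite -[(_ - _) ^+ 2]real_normK ?num_real//.
    move: `|_| (normr_ge0 (Z_ n w - Z w)) => a a0.
    have [aL|aL] := leP a L; first by rewrite lerDl mulr_ge0 ?invr_ge0 ?sqr_ge0 ?(ltW L0).
    apply: (@le_trans _ _ (L^-1 * a ^+ 2)); last by rewrite lerDr ltW.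
    by rewrite ler_pdivlMl// expr2 ler_wpM2r// ltW.
rewrite RintegralD//; last exact: integrableZR.
have -> : eps = eps / 2 + eps / 2 by rewrite -splitr.
apply: lerD; first exact: le_trans (ler_norm _) hmin.
rewrite RintegralZl//.
have hsq : sqn Pr (fun w => Z_ n w - Z w) <= 4 * K.
  have -> : (fun w => Z_ n w - Z w) = (fun w => Z_ n w + -1 * Z w).
    by apply/funext => w; rewrite mulN1r.
  apply: le_trans (sqnD_le (HZ_ n) (sqintZ _ HZ)) _.
  by rewrite sqnZ// sqrrN expr1n mul1r; move: (ZK n) ZK0; lra.
rewrite ler_pdivrMl// -/(sqn Pr _); apply: le_trans hsq _.
rewrite (_ : L * (eps / 2) = (8 * K + 1) / 2); last first.
  by rewrite /L; field; rewrite gt_eqF.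
by move: K0; lra.
Qed.

Lemma gaussian_mgf_limit (S_ : nat -> Om -> F) (S : Om -> F) (v_ : nat -> F) (v : F) :
  (forall n, measurable_fun setT (S_ n)) -> measurable_fun setT S ->
  {ae Pr, forall w, S_ n w @[n --> \oo] --> S w} ->
  (forall n (c : F), (\int[Pr]_w (expR (c * S_ n w))%:E = (expR (c ^+ 2 * v_ n / 2))%:E)%E) ->
  v_ n @[n --> \oo] --> v ->
  (\int[Pr]_w (expR (S w))%:E = (expR (v / 2))%:E)%E.
Proof.
move=> mS_ mS SS mgf vv.
have [K vK] : exists K, forall n, v_ n <= K.
  have [M [_ MP]] := cvg_seq_bounded (cvgP _ vv).
  exists (M + 1) => n; apply: le_trans (ler_norm _) _.
  by apply: (MP (M + 1)) => //; rewrite ltrDl.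
have HZ n : sqint Pr (fun w => expR (S_ n w)) /\ sqn Pr (fun w => expR (S_ n w)) = expR (2 * v_ n).
  have e w : expR (S_ n w) ^+ 2 = expR (2 * S_ n w) by rewrite expRM_natl.
  have h := mgf n 2.
  have me : measurable_fun setT (fun w => expR (S_ n w)) by exact: measurableT_comp.
  split; last first.
    rewrite /sqn /Rintegral; under eq_integral do rewrite e.
    by rewrite h /=; congr expR; field.
  split => //; apply/integrableP; split; first by apply/measurable_EFinP; exact: measurable_funX.
  under eq_integral do rewrite /= ger0_norm ?sqr_ge0// e.
  by rewrite h ltry.
have [|||iZ hZ] := @cvg_Rintegral_sqn_bounded (fun n w => expR (S_ n w))
  (fun w => expR (S w)) (expR (2 * K)) (fun n => (HZ n).1).
- exact: measurableT_comp.
- apply: filterS SS => w Sw.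
  by apply: continuous_cvg => //; exact: continuous_expR.
- by move=> n; rewrite (HZ n).2 ler_expR ler_wpM2l.
have -> : (\int[Pr]_w (expR (S w))%:E = (\int[Pr]_w expR (S w))%:E)%E.
  by rewrite /Rintegral fineK//; exact: (integrable_fin_num _ iZ).
congr EFin; rewrite -(cvg_lim _ hZ)//; apply: cvg_lim => //.
rewrite (_ : (fun n => _) = (fun n => expR (v_ n / 2))).
  apply: continuous_cvg; first exact: continuous_expR.
  by apply: cvgMl.
apply/funext => n; rewrite /Rintegral.
rewrite (_ : (\int[Pr]_w _ = \int[Pr]_w (expR (1 * S_ n w))%:E)%E).
  by rewrite mgf expr1n mul1r.
by apply: eq_integral => w _; rewrite mul1r.
Qed.

End square_bounded_limit.

Section vector_measurability.
Context (F : realType) (n : nat).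

Lemma measurable_cV d (Om : measurableType d) (f : Om -> 'cV[F]_n) :
  (forall i, measurable_fun setT (fun w => f w i 0)) -> measurable_fun setT f.
Proof.
move=> mf; apply: (measurability (\big[setU/set0]_(i < n)
  preimage_set_system setT (fun x : 'cV[F]_n => x i 0) measurable)) => //.
move=> _ [E + <-]; rewrite setTI.
apply: (big_ind (fun S : set (set 'cV[F]_n) => S E -> measurable (f @^-1` E))) => //.
  by move=> S1 S2 H1 H2 [/H1|/H2].
move=> i _ [D mD <-]; rewrite setTI.
by have := mf i measurableT D mD; rewrite setTI.
Qed.

Lemma measurable_mulmx_coord m (A : 'M[F]_(m, n)) i :
  measurable_fun setT (fun x : 'cV[F]_n => (A *m x) i 0).
Proof.
rewrite (_ : (fun x => _) = (fun x : 'cV[F]_n => \sum_j A i j * x j 0)).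
  apply: measurable_sum => j; apply: measurable_funM => //; exact: measurable_coord.
by apply/funext => x; rewrite mxE.
Qed.

End vector_measurability.

Section gaussian_hermite.
Context (F : realType) d (X : measurableType d) (mu : {measure set X -> \bar F}).
Context (I : finType) (y : I -> X -> F) (s : I -> F).
Hypothesis my : forall i, measurable_fun setT (y i).
Hypothesis mgf : forall u : I -> F,
  (\int[mu]_x (expR (\sum_i u i * y i x))%:E = (expR (\sum_i u i ^+ 2 * s i / 2))%:E)%E.
Local Notation multi := {ffun I -> nat}.

Lemma measurable_lin (u : I -> F) : measurable_fun setT (fun x => \sum_i u i * y i x).
Proof. by apply: measurable_sum => i; exact: measurable_funM. Qed.

Lemma integrable_mgf (u : I -> F) :
  mu.-integrable setT (EFin \o (fun x => expR (\sum_i u i * y i x))).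
Proof.
apply/integrableP; split.
  by apply/measurable_EFinP; apply: measurableT_comp => //; exact: measurable_lin.
by under eq_integral do rewrite /= ger0_norm ?expR_ge0//; rewrite mgf ltry.
Qed.

Lemma Rintegral_mgf (u : I -> F) :
  \int[mu]_x expR (\sum_i u i * y i x) = expR (\sum_i u i ^+ 2 * s i / 2).
Proof. by rewrite /Rintegral mgf. Qed.

Let integrable_mgf_mul (v u : I -> F) : mu.-integrable setT
  (EFin \o (fun x => expR (\sum_i v i * y i x) * expR (\sum_i u i * y i x))).
Proof.
rewrite (_ : (fun x => _) = fun x => expR (\sum_i (v i + u i) * y i x)).
  exact: integrable_mgf.
apply/funext => x; rewrite -expRD -big_split /=; congr expR.
by apply: eq_bigr => i _; rewrite mulrDl.
Qed.

Lemma sum_norm_indicator (a : F) (n N : nat) :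
  \sum_(k < N) `|(k == n :> nat)%:R * a| <= `|a|.
Proof.
have [nN|Nn] := ltnP n N.
  rewrite (bigD1 (Ordinal nN))//= eqxx mul1r big1 ?addr0// => k kn.
  by rewrite -val_eqE /= in kn; rewrite (negbTE kn) mul0r normr0.
rewrite big1// => k _; rewrite (_ : (k == n :> nat) = false) ?mul0r ?normr0//.
by apply/negbTE; rewrite neq_ltn (leq_trans (ltn_ord k) Nn).
Qed.

Lemma cvg_sum_indicator (f : nat -> F) (n : nat) :
  (\sum_(k < N) f k * (k == n :> nat)%:R) @[N --> \oo] --> f n.
Proof.
apply: cvg_near_cst; exists n.+1 => // N /= nN.
rewrite (bigD1 (Ordinal nN))//= eqxx mulr1 big1 ?addr0// => k kn.
by rewrite -val_eqE /= in kn; rewrite (negbTE kn) mulr0.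
Qed.

Lemma hermite_mehler (c e : I -> F) : (forall i, s i = 1 - e i ^+ 2) ->
  forall n : multi,
    mu.-integrable setT (EFin \o (fun x => \prod_i hcoef (n i) (e i * c i + y i x))) /\
    \int[mu]_x (\prod_i hcoef (n i) (e i * c i + y i x)) =
    \prod_i (e i ^+ n i * hcoef (n i) (c i)).
Proof.
move=> sE n.
have my' i : measurable_fun setT (fun x => e i * c i + y i x).
  by apply: measurable_funD.
have linE (u : I -> F) x : expR (\sum_i u i * (e i * c i + y i x)) =
    expR (\sum_i u i * (e i * c i)) * expR (\sum_i u i * y i x).
  rewrite -expRD -big_split /=; congr expR; apply: eq_bigr => i _; exact: mulrDr.
have iexp (u : I -> F) : mu.-integrable setT (EFin \o (fun x =>
    cst 1 x * expR (\sum_i u i * (e i * c i + y i x)))).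
  rewrite (_ : (fun x => _) = fun x => expR (\sum_i u i * (e i * c i)) * expR (\sum_i u i * y i x)).
    by apply: integrableZR; exact: integrable_mgf.
  by apply/funext => x; rewrite /cst mul1r linE.
have m1 : measurable_fun setT (cst 1 : X -> F) by exact: measurable_cst.
have drop1 (f : X -> F) : (fun x => cst 1 x * f x) = f.
  by apply/funext => x; rewrite /cst mul1r.
split.
  by have := integrable_prod_hcoef my' m1 iexp n; rewrite drop1.
transitivity (\int[mu]_x (cst 1 x * \prod_i hcoef (n i) (e i * c i + y i x))).
  by rewrite drop1.
apply: (@hermite_expectation _ _ _ mu I _ _ my' m1 iexp
  (fun i u => expR (u * e i * c i - (u * e i) ^+ 2 / 2))
  (fun i k => e i ^+ k * hcoef k (c i)) (fun i => expR (`|e i * c i| + e i ^+ 2 / 2))).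
- move=> u _.
  rewrite (_ : Rintegral _ _ _ = \int[mu]_x (expR (\sum_i (u i * (e i * c i) - u i ^+ 2 / 2)) *
      expR (\sum_i u i * y i x))); last first.
    apply: eq_Rintegral => x _; rewrite /cst mul1r -expRD -big_split; congr expR.
    by apply: eq_bigr => i _ /=; ring.
  rewrite RintegralZl//; last exact: integrable_mgf.
  rewrite Rintegral_mgf -expRD -expR_sum -big_split; congr expR.
  by apply: eq_bigr => i _ /=; rewrite sE; field.
- move=> i u _.
  rewrite (_ : (fun N => _) = fun N => \sum_(k < N) (u * e i) ^+ k * hcoef k (c i)).
    exact: hcoef_generating.
  by apply/funext => N; apply: eq_bigr => k _; rewrite exprMn mulrA.
- by move=> i N; exact: hcoef_norm.
Qed.

Hypothesis s1 : forall i, s i = 1.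

Let tilted (v : I -> F) (n : multi) :
  \int[mu]_x (expR (\sum_i v i * y i x) * \prod_i hcoef (n i) (y i x)) =
  \prod_i (expR (v i ^+ 2 / 2) * exp_coeff (v i) (n i)).
Proof.
have mv : measurable_fun setT (fun x => expR (\sum_i v i * y i x)).
  by apply: measurableT_comp => //; exact: measurable_lin.
apply: (@hermite_expectation _ _ _ mu I _ _ my mv (integrable_mgf_mul v)
  (fun i u => expR (v i ^+ 2 / 2) * expR (u * v i))
  (fun i k => expR (v i ^+ 2 / 2) * exp_coeff (v i) k)
  (fun i => expR (v i ^+ 2 / 2) * expR `|v i|)).
- move=> u _.
  rewrite (_ : Rintegral _ _ _ = \int[mu]_x (expR (- \sum_i u i ^+ 2 / 2) *
      expR (\sum_i (v i + u i) * y i x))); last first.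
    apply: eq_Rintegral => x _; rewrite -!expRD; congr expR.
    by rewrite -sumrN -!big_split; apply: eq_bigr => i _ /=; ring.
  rewrite RintegralZl//; last exact: integrable_mgf.
  rewrite Rintegral_mgf -expRD big_split /= -!expR_sum -expRD; congr expR.
  by rewrite -sumrN -!big_split; apply: eq_bigr => i _ /=; rewrite s1; field.
- move=> i u _.
  rewrite (_ : (fun N => _) = fun N => expR (v i ^+ 2 / 2) * \sum_(k < N) (u ^+ k * exp_coeff (v i) k)).
    2: by apply/funext => N; rewrite mulr_sumr; apply: eq_bigr => k _; rewrite mulrCA.
  apply: cvgMr.
  rewrite (_ : (fun N => _) = fun N => \sum_(k < N) exp_coeff (u * v i) k).
    exact: cvg_exp_coeff.
  by apply/funext => N; apply: eq_bigr => k _; rewrite /exp_coeff /= exprMn mulrA.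
- move=> i N; under eq_bigr do rewrite normrM ger0_norm ?expR_ge0//.
  by rewrite -mulr_sumr ler_wpM2l ?expR_ge0// sum_norm_exp_coeff.
Qed.

Lemma hermite_orthogonal (n m : multi) :
  \int[mu]_x ((\prod_i hcoef (n i) (y i x)) * \prod_i hcoef (m i) (y i x)) =
  \prod_i ((m i == n i)%:R / (n i)`!%:R).
Proof.
have mn := measurable_prod_hcoef my n.
have iexp (u : I -> F) : mu.-integrable setT (EFin \o (fun x =>
    (\prod_i hcoef (n i) (y i x)) * expR (\sum_i u i * y i x))).
  under eq_fun do rewrite mulrC.
  have mv : measurable_fun setT (fun x => expR (\sum_i u i * y i x)).
    by apply: measurableT_comp => //; exact: measurable_lin.
  exact: (integrable_prod_hcoef my mv (integrable_mgf_mul u)).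
apply: (@hermite_expectation _ _ _ mu I _ _ my mn iexp
  (fun i u => u ^+ n i / (n i)`!%:R)
  (fun i k => (k == n i)%:R / (n i)`!%:R)
  (fun i => `|(n i)`!%:R^-1|)).
- move=> u _.
  rewrite (_ : Rintegral _ _ _ = \int[mu]_x (expR (- \sum_i u i ^+ 2 / 2) *
      (expR (\sum_i u i * y i x) * \prod_i hcoef (n i) (y i x)))); last first.
    apply: eq_Rintegral => x _; rewrite sumrB expRD; ring.
  rewrite RintegralZl//; last first.
    by have := iexp u; under eq_fun do rewrite mulrC.
  rewrite tilted big_split /= -expR_sum mulrA -expRD addrC subrr expR0 mul1r.
  by apply: eq_bigr => i _.
- move=> i u _.
  rewrite (_ : (fun N => _) = fun N => (\sum_(k < N) u ^+ k * (k == n i :> nat)%:R) / (n i)`!%:R).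
    by apply: cvgMl; have := @cvg_sum_indicator (GRing.exp u) (n i); exact.
  by apply/funext => N; rewrite mulr_suml; apply: eq_bigr => k _; rewrite mulrA.
- by move=> i N; exact: sum_norm_indicator.
Qed.

Lemma hermite_mean (n : multi) :
  mu.-integrable setT (EFin \o (fun x => \prod_i hcoef (n i) (y i x))) /\
  \int[mu]_x (\prod_i hcoef (n i) (y i x)) = \prod_i (n i == 0%N)%:R.
Proof.
have [|h1 h2] := @hermite_mehler (fun=> 0) (fun=> 0) _ n.
  by move=> i; rewrite expr0n subr0.
have e : (fun x => \prod_i hcoef (n i) (0 * 0 + y i x)) = (fun x => \prod_i hcoef (n i) (y i x)).
  by apply/funext => x; apply: eq_bigr => i _; rewrite mul0r add0r.
rewrite e in h1 h2; rewrite h2; split => //; apply: eq_bigr => i _.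
by case: (n i) => [|k]; rewrite ?expr0 ?hcoef0 ?mul1r// expr0n mul0r.
Qed.

End gaussian_hermite.

(** * Uniqueness of the Gaussian law *)

Section hermite_span.
Context (F : realType) (r : nat) (T : 'M[F]_r).
Hypothesis Tu : T \in unitmx.
Local Notation multi := {ffun 'I_r -> nat}.
Implicit Types (f g : 'cV[F]_r -> F) (n : multi).

Definition hfun n (x : 'cV[F]_r) : F := \prod_i hcoef (n i) ((T *m x) i 0).

Inductive hspan : ('cV[F]_r -> F) -> Prop :=
| hspan_nil : hspan (cst 0)
| hspan_cons c n f : hspan f -> hspan (fun x => c * hfun n x + f x).

Lemma hspanZ c f : hspan f -> hspan (fun x => c * f x).
Proof.
elim=> [|c' n g _ IH].
  rewrite (_ : (fun x => _) = cst 0); first exact: hspan_nil.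
  by apply/funext => x; rewrite /cst mulr0.
rewrite (_ : (fun x => _) = fun x => (c * c') * hfun n x + c * g x); first exact: hspan_cons.
by apply/funext => x; rewrite mulrDr mulrA.
Qed.

Lemma hspanD f g : hspan f -> hspan g -> hspan (fun x => f x + g x).
Proof.
move=> + gs; elim=> [|c n h _ IH].
  by under eq_fun do rewrite add0r.
by under eq_fun do rewrite -addrA; exact: hspan_cons.
Qed.

Lemma hspan_hfun n : hspan (hfun n).
Proof.
rewrite (_ : hfun n = fun x => 1 * hfun n x + cst 0 x); first by apply: hspan_cons; exact: hspan_nil.
by apply/funext => x; rewrite mul1r /cst addr0.
Qed.

Lemma hspan1 : hspan (cst 1).
Proof.
rewrite (_ : cst 1 = hfun [ffun=> 0%N]); first exact: hspan_hfun.
by apply/funext => x; rewrite /hfun big1// => i _; rewrite ffunE hcoef0.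
Qed.

Lemma hspan_mul_coord i f : hspan f -> hspan (fun x => (T *m x) i 0 * f x).
Proof.
elim=> [|c n g _ IH].
  rewrite (_ : (fun x => _) = cst 0); first exact: hspan_nil.
  by apply/funext => x; rewrite /cst mulr0.
pose upd k : multi := [ffun j => if j == i then k else n j].
have hupd k x : hfun (upd k) x =
    hcoef k ((T *m x) i 0) * \prod_(j | j != i) hcoef (n j) ((T *m x) j 0).
  rewrite /hfun (bigD1 i)//= ffunE eqxx; congr (_ * _).
  by apply: eq_bigr => j ji; rewrite ffunE (negbTE ji).
rewrite (_ : (fun x => _) = fun x => (c * (n i).+1%:R) * hfun (upd (n i).+1) x +
    ((if n i is k.+1 then c else 0) * hfun (upd (n i).-1) x + (T *m x) i 0 * g x)).
  by do 2 apply: hspan_cons.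
apply/funext => x; rewrite mulrDr addrA; congr (_ + _).
rewrite !hupd {1}/hfun (bigD1 i)//=; set p := \prod_(j | _) _.
transitivity (c * ((T *m x) i 0 * hcoef (n i) ((T *m x) i 0)) * p); first by ring.
rewrite hcoefS.
by case: (n i) => [|k]; rewrite ?(mul0r, addr0) ?(mulrDr, mulrDl) !mulrA.
Qed.

Lemma hspan_sum (I : Type) (s : seq I) (h : I -> 'cV[F]_r -> F) :
  (forall i, hspan (h i)) -> hspan (fun x => \sum_(i <- s) h i x).
Proof.
move=> hs; elim: s => [|i s IH].
  by under eq_fun do rewrite big_nil; exact: hspan_nil.
by under eq_fun do rewrite big_cons; exact: hspanD.
Qed.

Lemma coord_inv (x : 'cV[F]_r) i : x i 0 = \sum_j invmx T i j * (T *m x) j 0.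
Proof. by rewrite -{1}(mulKmx Tu x) mxE. Qed.

Lemma hspan_mul_x i f : hspan f -> hspan (fun x => x i 0 * f x).
Proof.
move=> fs; rewrite (_ : (fun x => _) =
    fun x => \sum_j invmx T i j * ((T *m x) j 0 * f x)).
  by apply: hspan_sum => j; apply: hspanZ; exact: hspan_mul_coord.
apply/funext => x; rewrite {1}coord_inv mulr_suml.
by apply: eq_bigr => j _; rewrite mulrA.
Qed.

Lemma measurable_hfun n : measurable_fun setT (hfun n).
Proof.
by apply: measurable_prod_hcoef => i; exact: measurable_mulmx_coord.
Qed.

Lemma measurable_hspan f : hspan f -> measurable_fun setT f.
Proof.
elim=> [|c n g _ IH]; first exact: measurable_cst.
apply: measurable_funD => //; apply: measurable_funM => //; exact: measurable_hfun.
Qed.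

Definition exp_bounded f := exists C k : F,
  [/\ 0 <= C, 0 <= k & forall x, `|f x| <= C * expR (k * \sum_i `|x i 0|)].

Lemma exp_boundedD f g : exp_bounded f -> exp_bounded g -> exp_bounded (fun x => f x + g x).
Proof.
move=> [C [k [C0 k0 fC]]] [C' [k' [C0' k0' gC]]].
exists (C + C'), (k + k'); split; [exact: addr_ge0|exact: addr_ge0|] => x.
rewrite (le_trans (ler_normD _ _))// mulrDl lerD//.
  by rewrite (le_trans (fC x))// ler_wpM2l// ler_expR ler_wpM2r ?lerDl// sumr_ge0.
by rewrite (le_trans (gC x))// ler_wpM2l// ler_expR ler_wpM2r ?lerDr// sumr_ge0.
Qed.

Lemma exp_boundedM f g : exp_bounded f -> exp_bounded g -> exp_bounded (fun x => f x * g x).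
Proof.
move=> [C [k [C0 k0 fC]]] [C' [k' [C0' k0' gC]]].
exists (C * C'), (k + k'); split; [exact: mulr_ge0|exact: addr_ge0|] => x.
by rewrite normrM mulrDl expRD mulrACA ler_pM.
Qed.

Lemma exp_bounded_cst c : exp_bounded (cst c).
Proof. by exists `|c|, 0; split => // x; rewrite mul0r expR0 mulr1. Qed.

Lemma exp_bounded_hcoef k i : exp_bounded (fun x => hcoef k ((T *m x) i 0)).
Proof.
exists (expR 2^-1), (\sum_j `|T i j|); split; [exact: expR_ge0|exact: sumr_ge0|] => x.
rewrite (le_trans (norm_hcoef_le _ _))// -expRD ler_expR addrC lerD2l mxE.
rewrite (le_trans (ler_norm_sum _ _ _))// mulr_suml; apply: ler_sum => j _.
by rewrite normrM ler_wpM2l// (bigD1 j)//= lerDl sumr_ge0.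
Qed.

Lemma exp_bounded_hspan f : hspan f -> exp_bounded f.
Proof.
elim=> [|c n g _ IH]; first exact: exp_bounded_cst.
apply: exp_boundedD => //; apply: exp_boundedM; first exact: exp_bounded_cst.
rewrite /hfun; elim: (index_enum _) => [|i s IHs].
  by under eq_fun do rewrite big_nil; exact: exp_bounded_cst.
under eq_fun do rewrite big_cons; apply: exp_boundedM => //.
exact: exp_bounded_hcoef.
Qed.

Lemma hermite_density (mu : {measure set 'cV[F]_r -> \bar F}) f :
  (forall u : 'I_r -> F,
    mu.-integrable setT (EFin \o (fun x : 'cV[F]_r => expR (\sum_i u i * x i 0)))) ->
  sqint mu f -> forall eps, 0 < eps ->
    exists2 p, hspan p & sqn mu (fun x => f x - p x) <= eps.
Proof.
move=> mu_exp Hf; have [_] := polynomial_density hspan1 hspanD hspanZ hspan_mul_x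
  measurable_hspan exp_bounded_hspan mu_exp Hf.
exact.
Qed.

Lemma sqint_hspan (mu : {measure set 'cV[F]_r -> \bar F}) f :
  (forall u : 'I_r -> F,
    mu.-integrable setT (EFin \o (fun x : 'cV[F]_r => expR (\sum_i u i * x i 0)))) ->
  hspan f -> sqint mu f.
Proof.
move=> mu_exp fs.
exact: (sqint_poly measurable_hspan exp_bounded_hspan mu_exp fs).
Qed.

Definition std_gaussian (mu : set 'cV[F]_r -> \bar F) := forall u : 'I_r -> F,
  (\int[mu]_x (expR (\sum_i u i * (T *m x) i 0))%:E = (expR (\sum_i u i ^+ 2 * 1 / 2))%:E)%E.

Let my i : measurable_fun setT (fun x : 'cV[F]_r => (T *m x) i 0).
Proof. exact: measurable_mulmx_coord. Qed.

Lemma std_gaussian_exp (mu : {measure set 'cV[F]_r -> \bar F}) : std_gaussian mu ->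
  forall u : 'I_r -> F,
    mu.-integrable setT (EFin \o (fun x : 'cV[F]_r => expR (\sum_i u i * x i 0))).
Proof.
move=> g u; pose v j := \sum_i u i * invmx T i j.
rewrite (_ : (fun x => _) = fun x => expR (\sum_j v j * (T *m x) j 0)).
  exact: (integrable_mgf my g).
apply/funext => x; congr expR; rewrite /v.
under [RHS]eq_bigr do rewrite mulr_suml.
rewrite exchange_big /=; apply: eq_bigr => i _.
rewrite [in LHS]coord_inv mulr_sumr; apply: eq_bigr => j _.
by rewrite mulrA.
Qed.

Lemma hspan_same_mean (m1 m2 : probability 'cV[F]_r F) p :
  std_gaussian m1 -> std_gaussian m2 -> hspan p ->
  [/\ m1.-integrable setT (EFin \o p), m2.-integrable setT (EFin \o p) &
      \int[m1]_x p x = \int[m2]_x p x].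
Proof.
move=> g1 g2; elim=> [|c n f _ [i1 i2 e]].
  have i0 (m : probability 'cV[F]_r F) : m.-integrable setT (EFin \o (cst 0 : 'cV[F]_r -> F)).
    exact: finite_measure_integrable_cst.
  by split => //; rewrite !Rintegral_cst// !mul0r.
have [h1 e1] := hermite_mean my g1 (fun=> erefl) n.
have [h2 e2] := hermite_mean my g2 (fun=> erefl) n.
have c1 := integrableZR c h1; have c2 := integrableZR c h2.
split; [exact: integrable_addR|exact: integrable_addR|].
by rewrite !RintegralD// !RintegralZl// e e1 e2.
Qed.

Theorem std_gaussian_unique (m1 m2 : probability 'cV[F]_r F) :
  std_gaussian m1 -> std_gaussian m2 -> forall E, measurable E -> m1 E = m2 E.
Proof.
move=> g1 g2 E mE.
pose m := measure_add m1 m2.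
have addE (f : 'cV[F]_r -> F) : measurable_fun setT f -> (forall x, 0 <= f x) ->
    (\int[m]_x (f x)%:E = \int[m1]_x (f x)%:E + \int[m2]_x (f x)%:E)%E.
  move=> mf f0; rewrite ge0_integral_measure_add//; first by move=> x _; rewrite lee_fin.
  exact/measurable_EFinP.
have addI (f : 'cV[F]_r -> F) : m1.-integrable setT (EFin \o f) ->
    m2.-integrable setT (EFin \o f) -> m.-integrable setT (EFin \o f).
  move=> /integrableP[mf f1] /integrableP[_ f2]; apply/integrableP; split => //.
  rewrite (_ : (\int[m]_x _ = \int[m]_x (`|f x|)%:E)%E); last by apply: eq_integral.
  rewrite addE//; first by rewrite lte_add_pinfty.
  by apply: measurableT_comp => //; exact/measurable_EFinP.
have m_exp (u : 'I_r -> F) :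
    m.-integrable setT (EFin \o (fun x : 'cV[F]_r => expR (\sum_i u i * x i 0))).
  by apply: addI; exact: std_gaussian_exp.
have H1 : sqint m \1_E.
  split; first exact: measurable_indic.
  rewrite (_ : (fun x => _) = \1_E); last first.
    by apply/funext => x; rewrite indicE; case: (_ \in _); rewrite ?expr1n ?expr0n.
  by apply: addI; apply: integrable_indic => //; rewrite ltey_eq fin_num_measure.
have bound (mi : probability 'cV[F]_r F) p eta : 0 < eta -> std_gaussian mi -> hspan p ->
    (forall h : 'cV[F]_r -> F, measurable_fun setT h ->
      (\int[mi]_x (h x ^+ 2)%:E <= \int[m]_x (h x ^+ 2)%:E)%E) ->
    sqn m (fun x => \1_E x - p x) <= eta ^+ 2 ->
    `|fine (mi E) - \int[mi]_x p x| <= 2 * eta.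
  move=> eta0 gi ps le_m sq.
  have ip : mi.-integrable setT (EFin \o p) by have [] := hspan_same_mean gi gi ps.
  have mp := measurable_hspan ps.
  have i1 : mi.-integrable setT (EFin \o (\1_E : 'cV[F]_r -> F)).
    by apply: integrable_indic => //; rewrite ltey_eq fin_num_measure.
  have -> : fine (mi E) = \int[mi]_x (\1_E x : F).
    by rewrite /Rintegral integral_indic// setIT.
  have mh : measurable_fun setT (fun x => \1_E x - p x).
    by apply: measurable_funB => //; exact: measurable_indic.
  have [_ i2m] : sqint m (fun x => \1_E x - p x) by apply: sqintB => //; exact: sqint_hspan.
  have i2 : mi.-integrable setT (EFin \o (fun x => (\1_E x - p x) ^+ 2)).
    apply/integrableP; split; first by apply/measurable_EFinP; exact: measurable_funX.
    under eq_integral do rewrite /= ger0_norm ?sqr_ge0//.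
    apply: le_lt_trans (le_m _ mh) _; case/integrableP: i2m => _.
    by under eq_integral do rewrite /= ger0_norm ?sqr_ge0//.
  rewrite -RintegralB//; apply: le_trans (le_normr_Rintegral _ _) _ => //.
    by have := integrableB measurableT i1 ip; exact.
  apply: (@le_trans _ _ (\int[mi]_x (eta + eta^-1 * (\1_E x - p x) ^+ 2))).
    apply: le_Rintegral => //.
    - by apply/integrable_norm; have := integrableB measurableT i1 ip; exact.
    - apply: integrable_addR; last exact: integrableZR.
      exact: finite_measure_integrable_cst.
    - move=> x _; rewrite -[(_ - _) ^+ 2]real_normK ?num_real//.
      move: `|_| (normr_ge0 (\1_E x - p x)) => a a0.
      rewrite -(ler_pM2l eta0) mulrDr mulVKf ?gt_eqF//.
      by have := sqr_ge0 (a - eta); have := sqr_ge0 (a + eta); nra.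
  rewrite RintegralD//; last 2 first.
  - exact: finite_measure_integrable_cst.
  - exact: integrableZR.
  rewrite RintegralZl// Rintegral_cst//.
  have -> : fine (mi [set: _]) = 1 by have := probability_setT mi; rewrite /= => ->.
  rewrite mulr1 mulr_natl mulr2n lerD2l.
  rewrite ler_pdivrMl// -expr2; apply: le_trans sq.
  by rewrite /sqn /Rintegral fine_le// ?le_m//; exact: (integrable_fin_num measurableT _).
have le1 (h : 'cV[F]_r -> F) : measurable_fun setT h -> (\int[m1]_x (h x ^+ 2)%:E <= \int[m]_x (h x ^+ 2)%:E)%E.
  move=> mh; rewrite (addE (fun x => h x ^+ 2)) => [||x]; [|exact: measurable_funX|exact: sqr_ge0].
  by rewrite leeDl// integral_ge0// => x _; rewrite lee_fin sqr_ge0.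
have le2 (h : 'cV[F]_r -> F) : measurable_fun setT h -> (\int[m2]_x (h x ^+ 2)%:E <= \int[m]_x (h x ^+ 2)%:E)%E.
  move=> mh; rewrite (addE (fun x => h x ^+ 2)) => [||x]; [|exact: measurable_funX|exact: sqr_ge0].
  by rewrite leeDr// integral_ge0// => x _; rewrite lee_fin sqr_ge0.
rewrite -[m1 E]fineK ?fin_num_measure// -[m2 E]fineK ?fin_num_measure//; congr EFin.
apply/eqP; rewrite -subr_eq0 -normr_le0; apply/ler_addgt0Pr => eps eps0; rewrite add0r.
have eta0 : 0 < eps / 4 by rewrite divr_gt0.
have [p ps hp] := hermite_density m_exp H1 (exprn_gt0 2 eta0).
have b1 := bound m1 p _ eta0 g1 ps le1 hp; have b2 := bound m2 p _ eta0 g2 ps le2 hp.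
have [_ _ ep] := hspan_same_mean g1 g2 ps; rewrite ep in b1.
rewrite -[X in X <= _](_ : `|(fine (m1 E) - \int[m2]_x p x) - (fine (m2 E) - \int[m2]_x p x)| = _).
  by apply: le_trans (ler_normB _ _) _; move: b1 b2; lra.
by congr `|_|; ring.
Qed.

End hermite_span.

(** * The Ornstein-Uhlenbeck process *)

Section paths.
Context (F : realType).
Notation leb := (@lebesgue_measure F).
Implicit Types (Y b : F -> F).

Lemma itv_uniform_continuous Y (t eps : F) : {within `[0, t], continuous Y} -> 0 < eps ->
  exists2 del : F, 0 < del & forall x s, 0 <= x <= t -> 0 <= s <= t -> `|x - s| <= del ->
    `|Y x - Y s| <= eps.
Proof.
move=> /subspace_continuousP cY eps0.
have itvE x : `[0, t]%classic x = (0 <= x <= t) by rewrite /= in_itv.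
have /compact_near_coveringP K := @segment_compact F 0 t.
have e20 : 0 < eps / 2 by rewrite divr_gt0.
have [|N _ NP] := K nat \oo (fun n x => forall s, 0 <= x <= t -> 0 <= s <= t ->
    `|x - s| <= n.+1%:R^-1 -> `|Y x - Y s| <= eps).
  move=> x0 Kx0; have /cvgrPdist_le/(_ _ e20) := cY x0 Kx0.
  rewrite near_withinE => /nbhs_ballP[eta /= eta0 etaP].
  have eta20 : 0 < eta / 2 by rewrite divr_gt0.
  have [N _ NP] := near_infty_natSinv_lt (PosNum eta20).
  exists (ball x0 (eta / 2), [set n | (N <= n)%N]) => /=.
    by split; [exact: nbhsx_ballx|exists N].
  move=> [z n] /= [zx0 nN] s zt st zs.
  have b1 : ball x0 eta z by apply: le_ball zx0; rewrite ler_pdivrMr// ler_peMr ?(ltW eta0)// ler1n.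
  have b2 : ball x0 eta s.
    rewrite /ball /= in zx0 *; rewrite -(subrK z x0) -addrA.
    rewrite (le_lt_trans (ler_normD _ _))// (splitr eta) ltrD//.
    by rewrite (le_lt_trans zs)//; have := NP n nN.
  rewrite -(subrK (Y x0) (Y z)) -addrA (le_trans (ler_normD _ _))//.
  rewrite (splitr eps) lerD//; last by apply: etaP => //; rewrite itvE.
  by rewrite distrC; apply: etaP => //; rewrite itvE.
exists N.+1%:R^-1; first by rewrite invr_gt0.
by move=> x s xt st xs; apply: (NP N) => //=; rewrite in_itv.
Qed.

Lemma itv_bounded Y (t : F) : {within `[0, t], continuous Y} ->
  exists2 M : F, 0 <= M & forall x, 0 <= x <= t -> `|Y x| <= M.
Proof.
move=> cY.
have /compact_bounded[M [_ MP]] := continuous_compact cY (@segment_compact F 0 t).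
exists (`|M| + 1); first by rewrite addr_ge0.
move=> x xt; apply: (MP (`|M| + 1)); first by rewrite (le_lt_trans (ler_norm _))// ltrDl.
by exists x => //=; rewrite in_itv.
Qed.

Lemma itv_integrable Y (t : F) : {within `[0, t], continuous Y} ->
  leb.-integrable `[0, t] (EFin \o Y).
Proof. by move=> cY; apply: continuous_compact_integrable => //; exact: segment_compact. Qed.

Lemma Rintegral_increment Y (t x z om : F) : {within `[0, t], continuous Y} ->
  0 <= x -> x <= z -> z <= t ->
  (forall s, x <= s <= z -> `|Y s - Y z| <= om) ->
  `|(\int[leb]_(s in `[0, z]) Y s - \int[leb]_(s in `[0, x]) Y s) - (z - x) * Y z| <= om * (z - x).
Proof.
move=> cY x0 xz zt Yom.
have cYz : {within `[0, z], continuous Y}.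
  by apply: continuous_subspaceW cY => s /=; rewrite !in_itv /= => /andP[-> /le_trans ->].
have iz := itv_integrable cYz.
have sub : `]x, z] `<=` `[0, z].
  by move=> s /=; rewrite !in_itv /= => /andP[xs ->]; rewrite andbT (le_trans x0)// ltW.
have ixz : leb.-integrable `]x, z] (EFin \o Y) by apply: integrableS iz.
rewrite (Rintegral_itvB (a := BLeft 0) (b := BRight z)) ?bnd_simp//.
have mleb : leb `]x, z] = (z - x)%:E.
  rewrite lebesgue_measure_itv /= lte_fin; case: ltP => // zx.
  by rewrite (le_anti (_ : x <= z <= x)) ?xz// subrr.
have icst (c : F) : leb.-integrable `]x, z] (EFin \o cst c).
  apply/integrableP; split; first exact/measurable_EFinP.
  rewrite (_ : (\int[leb]_(_ in _) _ = \int[leb]_(s in `]x, z]) `|c|%:E)%E); last exact: eq_integral.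
  by rewrite integral_cst//= mleb -EFinM ltry.
have intcst (c : F) : \int[leb]_(s in `]x, z]) (cst c s) = c * (z - x).
  by rewrite Rintegral_cst//; congr (_ * _); exact: (congr1 fine mleb).
have -> : (z - x) * Y z = \int[leb]_(s in `]x, z]) (cst (Y z) s).
  by rewrite intcst mulrC.
rewrite -RintegralB//.
have iD : leb.-integrable `]x, z] (EFin \o (fun s => Y s - cst (Y z) s)).
  by apply: (integrableB _ ixz (icst (Y z))).
apply: le_trans (le_normr_Rintegral _ _) _ => //.
apply: (@le_trans _ _ (\int[leb]_(s in `]x, z]) (cst om s))).
  apply: le_Rintegral => //; first exact: integrable_norm.
  by move=> s /=; rewrite in_itv /= => /andP[xs sz]; apply: Yom; rewrite (ltW xs).
by rewrite intcst.
Qed.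

Lemma expR_second_order (z : F) : 0 <= z <= 2^-1 -> 0 <= expR z - 1 - z <= 2 * z ^+ 2.
Proof.
move=> /andP[z0 z1].
have h1 := expR_ge1Dx z; have h2 := expR_ge1Dx (- z).
have e0 := expR_gt0 z.
have h3 : expR z * expR (- z) = 1 by rewrite expRxMexpNx_1.
have h4 : expR z * (1 - z) <= 1 by rewrite -[leRHS]h3 ler_pM2l.
apply/andP; split; first by move: h1; lra.
have h5 : (1 + z + 2 * z ^+ 2) * (1 - z) >= 1 by nra.
have h6 : expR z <= 1 + z + 2 * z ^+ 2.
  have z2 : 0 < 1 - z by lra.
  by rewrite -(ler_pM2r z2) (le_trans h4).
by move: h6; lra.
Qed.

Definition mesh (t : F) (N k : nat) : F := t / N.+1%:R * k%:R.

Lemma mesh_ge0 t N k : 0 <= t -> 0 <= mesh t N k.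
Proof. by move=> t0; rewrite mulr_ge0// divr_ge0. Qed.

Lemma meshS t N k : mesh t N k.+1 - mesh t N k = t / N.+1%:R.
Proof. by rewrite /mesh -mulrBr -natrB// subSnn mulr1. Qed.

Lemma mesh_le t N k : 0 <= t -> mesh t N k <= mesh t N k.+1.
Proof. by move=> t0; rewrite -subr_ge0 meshS divr_ge0. Qed.

Lemma mesh_last t N : mesh t N N.+1 = t.
Proof. by rewrite /mesh divfK// pnatr_eq0. Qed.

Lemma mesh_le_last t N k : 0 <= t -> (k <= N.+1)%N -> mesh t N k <= t.
Proof.
by move=> t0 kN; rewrite -[leRHS](mesh_last t N) ler_wpM2l ?divr_ge0// ler_nat.
Qed.

Lemma cvg_divS (c : F) : c / N.+1%:R @[N --> \oo] --> 0.
Proof.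
rewrite -[X in _ --> X](mulr0 c); apply: cvgMr.
exact: cvg_harmonic.
Qed.

(* The left-point sums are compared with the telescoping sum of
   [exp (- lam (t - s)) Y s] along the mesh. *)
Lemma cvg_stochastic_convolution Y b (lam y0 t : F) : 0 < lam -> 0 <= t ->
  {within `[0, t], continuous Y} -> b 0 = 0 ->
  (forall s, 0 <= s <= t -> Y s = y0 - lam * (\int[leb]_(z in `[0, s]) Y z) + b s) ->
  \sum_(k < N.+1) expR (- (lam * (t - mesh t N k))) * (b (mesh t N k.+1) - b (mesh t N k))
    @[N --> \oo] --> Y t - expR (- (lam * t)) * y0.
Proof.
move=> lam0 t0 cY b0 Yeq.
have Y0 : Y 0 = y0.
  by rewrite Yeq ?lexx//= b0 addr0 set_itv1 Rintegral_set1 mulr0 subr0.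
have [M M0 YM] := itv_bounded cY.
apply/cvgrPdist_le => eps eps0.
have lt0 : 0 < lam * t + 1 by rewrite ltr_wpDl// mulr_ge0// ltW.
pose om := eps / 2 / (lam * t + 1).
have om0 : 0 < om by rewrite !divr_gt0.
have [del del0 Ydel] := itv_uniform_continuous cY om0.
have h2 : 0 < (2 : F)^-1 by rewrite invr_gt0.
have e2 : 0 < eps / 2 by rewrite divr_gt0.
have /cvgrPdist_le/(_ _ del0) c1 := cvg_divS t.
have /cvgrPdist_le/(_ _ h2) c2 := cvg_divS (lam * t).
have /cvgrPdist_le/(_ _ e2) c3 := cvg_divS (2 * (lam * t) ^+ 2 * M).
near=> N.
have hdel : t / N.+1%:R <= del.
  by near: N; apply: filterS c1 => n /=; rewrite sub0r normrN ger0_norm ?divr_ge0.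
have hlam : lam * t / N.+1%:R <= 2^-1.
  near: N; apply: filterS c2 => n /=.
  by rewrite sub0r normrN ger0_norm ?divr_ge0 ?mulr_ge0// ltW.
have hM : 2 * (lam * t) ^+ 2 * M / N.+1%:R <= eps / 2.
  near: N; apply: filterS c3 => n /=.
  by rewrite sub0r normrN ger0_norm// divr_ge0// mulr_ge0// mulr_ge0// sqr_ge0.
pose h := t / N.+1%:R; pose tk := mesh t N.
have h0 : 0 <= h by rewrite divr_ge0.
pose a k := expR (- (lam * (t - tk k))).
have aS k : a k.+1 = a k * expR (lam * h).
  by rewrite /a -expRD; congr expR; rewrite -[h](meshS t N k) -/tk; ring.
have tk0 k : 0 <= tk k by exact: mesh_ge0.
have a01 k : (k <= N.+1)%N -> 0 <= a k <= 1.
  move=> kN; rewrite expR_ge0/= -expR0 ler_expR oppr_le0 mulr_ge0 ?(ltW lam0)//.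
  by rewrite subr_ge0 mesh_le_last.
have tel : Y t - expR (- (lam * t)) * y0 = \sum_(k < N.+1) (a k.+1 * Y (tk k.+1) - a k * Y (tk k)).
  rewrite -(big_mkord xpredT (fun k => a k.+1 * Y (tk k.+1) - a k * Y (tk k))).
  rewrite telescope_sumr// /a /tk mesh_last subrr mulr0 oppr0 expR0 mul1r.
  by rewrite /mesh mulr0 subr0 Y0.
rewrite tel -sumrB.
have term (k : 'I_N.+1) :
    `|a k.+1 * Y (tk k.+1) - a k * Y (tk k) - a k * (b (tk k.+1) - b (tk k))| <=
      lam * om * h + 2 * (lam * h) ^+ 2 * M.
  have kN : (k <= N.+1)%N by rewrite ltnW.
  have kN1 : (k.+1 <= N.+1)%N by [].
  have r1 : 0 <= tk k <= t by rewrite tk0/= mesh_le_last.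
  have r2 : 0 <= tk k.+1 <= t by rewrite tk0/= mesh_le_last.
  have tkh : tk k.+1 - tk k = h by exact: meshS.
  have inc : `|(\int[leb]_(s in `[0, tk k.+1]) Y s - \int[leb]_(s in `[0, tk k]) Y s)
      - h * Y (tk k.+1)| <= om * h.
    rewrite -tkh; apply: (@Rintegral_increment Y t) => //.
    - exact: mesh_le.
    - by case/andP: r2.
    - move=> s /andP[s1 s2]; case/andP: r1 => r11 r12; case/andP: r2 => r21 r22.
      apply: Ydel; rewrite ?r21 ?r22 ?(le_trans r11 s1) ?(le_trans s2)//.
      rewrite distrC ger0_norm ?subr_ge0// (le_trans _ hdel)// -/h -tkh lerD2l.
      by rewrite lerN2.
  have := Yeq _ r1; have := Yeq _ r2.
  move: inc; set I1 := Rintegral _ _ _; set I0 := Rintegral _ _ _ => inc E1 E0.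
  have -> : b (tk k.+1) - b (tk k) = Y (tk k.+1) - Y (tk k) + lam * (I1 - I0).
    by rewrite E1 E0; ring.
  rewrite aS.
  have -> : a k * expR (lam * h) * Y (tk k.+1) - a k * Y (tk k) -
      a k * (Y (tk k.+1) - Y (tk k) + lam * (I1 - I0)) =
      a k * ((expR (lam * h) - 1 - lam * h) * Y (tk k.+1) - lam * ((I1 - I0) - h * Y (tk k.+1))) by ring.
  have /andP[a0 a1] := a01 k kN.
  rewrite normrM (ger0_norm a0) -[leRHS]mul1r ler_pM//.
  rewrite (le_trans (ler_normB _ _))// addrC lerD//.
    by rewrite normrM (gtr0_norm lam0) -mulrA ler_wpM2l// ltW.
  have /andP[x0 x1] : 0 <= expR (lam * h) - 1 - lam * h <= 2 * (lam * h) ^+ 2.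
    by apply: expR_second_order; rewrite mulr_ge0 ?(ltW lam0)//= mulrA.
  by rewrite normrM (ger0_norm x0) ler_pM// YM.
apply: le_trans (ler_norm_sum _ _ _) _.
apply: (@le_trans _ _ (\sum_(k < N.+1) (lam * om * h + 2 * (lam * h) ^+ 2 * M))).
  by apply: ler_sum => k _; exact: term.
have N0 : N.+1%:R != 0 :> F by rewrite pnatr_eq0.
have -> : \sum_(k < N.+1) (lam * om * h + 2 * (lam * h) ^+ 2 * M) =
    lam * t * om + 2 * (lam * t) ^+ 2 * M / N.+1%:R.
  rewrite sumr_const card_ord -[LHS]mulr_natr /h.
  by move: (N.+1%:R : F) N0 => n n0; field.
rewrite (splitr eps).
apply: lerD => //.
rewrite /om mulrA ler_pdivrMr// mulrC ler_wpM2l ?(ltW e2)// lerDl//.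
Unshelve. all: by end_near. Qed.

Lemma cvg_exp_riemann (lam t : F) : 0 < lam -> 0 <= t ->
  \sum_(k < N.+1) (t / N.+1%:R * (2 * lam) * expR (- (lam * (t - mesh t N k))) ^+ 2)
    @[N --> \oo] --> 1 - expR (- (lam * t)) ^+ 2.
Proof.
move=> lam0 t0; pose c := 2 * lam; have c0 : 0 < c by rewrite mulr_gt0.
apply/cvgrPdist_le => eps eps0.
have h2 : 0 < (2 : F)^-1 by rewrite invr_gt0.
have /cvgrPdist_le/(_ _ h2) c2 := cvg_divS (c * t).
have /cvgrPdist_le/(_ _ eps0) c3 := cvg_divS (2 * (c * t) ^+ 2).
near=> N.
have hlam : c * t / N.+1%:R <= 2^-1.
  near: N; apply: filterS c2 => n /=.
  by rewrite sub0r normrN ger0_norm ?divr_ge0 ?mulr_ge0// ltW.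
have hM : 2 * (c * t) ^+ 2 / N.+1%:R <= eps.
  near: N; apply: filterS c3 => n /=.
  by rewrite sub0r normrN ger0_norm// divr_ge0// mulr_ge0// sqr_ge0.
pose h := t / N.+1%:R; pose tk := mesh t N.
have h0 : 0 <= h by rewrite divr_ge0.
pose a k := expR (- (c * (t - tk k))).
have aE x : expR (- (lam * x)) ^+ 2 = expR (- (c * x)).
  by rewrite -expRM_natl; congr expR; rewrite /c; ring.
have aS k : a k.+1 = a k * expR (c * h).
  by rewrite /a -expRD; congr expR; rewrite -[h](meshS t N k) -/tk; ring.
have a01 k : (k <= N.+1)%N -> 0 <= a k <= 1.
  move=> kN; rewrite expR_ge0/= -expR0 ler_expR oppr_le0 mulr_ge0 ?(ltW c0)//.
  by rewrite subr_ge0 mesh_le_last.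
have tel : 1 - expR (- (lam * t)) ^+ 2 = \sum_(k < N.+1) (a k.+1 - a k).
  rewrite -(big_mkord xpredT (fun k => a k.+1 - a k)) telescope_sumr//.
  by rewrite aE /a /tk mesh_last subrr mulr0 oppr0 expR0 /mesh mulr0 subr0.
rewrite tel -sumrB.
apply: le_trans (ler_norm_sum _ _ _) _.
have /andP[x0 x1] : 0 <= expR (c * h) - 1 - c * h <= 2 * (c * h) ^+ 2.
  by apply: expR_second_order; rewrite mulr_ge0 ?(ltW c0)//= mulrA.
apply: (@le_trans _ _ (\sum_(k < N.+1) (2 * (c * h) ^+ 2))).
  apply: ler_sum => k _; rewrite aE -/(tk k) -/(a k) aS -/c.
  have /andP[a0 a1] := a01 k (ltnW (ltn_ord k)).
  rewrite (_ : _ - _ = a k * (expR (c * h) - 1 - c * h)); last by rewrite /h; ring.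
  by rewrite normrM (ger0_norm a0) (ger0_norm x0) -[leRHS]mul1r ler_pM.
apply: le_trans hM; rewrite sumr_const card_ord -[leLHS]mulr_natr /h le_eqVlt; apply/orP; left.
have N0 : N.+1%:R != 0 :> F by rewrite pnatr_eq0.
by move: (N.+1%:R : F) N0 => n n0; apply/eqP; field.
Unshelve. all: by end_near. Qed.

End paths.

Lemma mx_subE (V : zmodType) m n (A B : 'M[V]_(m, n)) i j : (A - B) i j = A i j - B i j.
Proof. by rewrite !mxE. Qed.

Lemma mx_addE (V : zmodType) m n (A B : 'M[V]_(m, n)) i j : (A + B) i j = A i j + B i j.
Proof. by rewrite !mxE. Qed.

Lemma mx_scaleE (V : pzRingType) m n (a : V) (A : 'M[V]_(m, n)) i j : (a *: A) i j = a * A i j.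
Proof. by rewrite mxE. Qed.

Section ornstein_uhlenbeck.
Context (F : realType) (r q : nat) (M T : 'M[F]_r) (lam : 'I_r -> F) (B : 'M[F]_(r, q)).
Hypothesis lam0 : forall i, 0 < lam i.
Hypothesis TM : T *m M = - (diag_mx (\row_i lam i) *m T).
Hypothesis TBT : T *m (B *m B^T) *m T^T = 2 *: diag_mx (\row_i lam i).
Context d (Om : measurableType d) (Pr : probability Om F).
Context (W : F -> {RV Pr >-> 'cV[F]_q}) (W_bm : brownian W).
Notation leb := (@lebesgue_measure F).

Lemma within_continuous_mulmx_coord m n (A : 'M[F]_(m, n)) (Z : F -> 'cV[F]_n) (t : F) i :
  {within `[0, +oo[, continuous Z} ->
  {within `[0, t], continuous (fun s => (A *m Z s) i 0)}.
Proof.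
move=> cZ; have {}cZ : {within `[0, t], continuous Z}.
  by apply: continuous_subspaceW cZ => s /=; rewrite !in_itv /= andbT => /andP[].
apply/subspace_continuousP => s ts; move/subspace_continuousP: cZ => /(_ s ts) cZ.
rewrite (_ : (fun s => _) = fun s => \sum_j A i j * Z s j 0); last first.
  by apply/funext => z; rewrite mxE.
apply: cvg_big => [|j _]; first exact: add_continuous.
apply: cvgMr; apply: (cvg_comp _ (fun v : 'cV[F]_n => v j 0) cZ).
exact: coord_continuous.
Qed.

Lemma ou_pathwise x (X : F -> {RV Pr >-> 'cV[F]_r}) : linear_sde M B W x X ->
  {ae Pr, forall w, forall (t : F) i, 0 <= t ->
    \sum_(k < N.+1) expR (- (lam i * (t - mesh t N k))) *
       (T *m B *m (W (mesh t N k.+1) w - W (mesh t N k) w)) i 0 @[N --> \oo] -->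
    (T *m X t w) i 0 - expR (- (lam i * t)) * (T *m x) i 0}.
Proof.
move=> sde; case: W_bm => W0 _ _ _.
apply: filterS2 W0 sde => w W0 [cX Xeq] t i t0.
have := @cvg_stochastic_convolution F (fun s => (T *m X s w) i 0)
  (fun s => (T *m B *m W s w) i 0) (lam i) ((T *m x) i 0) t (lam0 i) t0.
move=> h.
rewrite (_ : (fun N => _) = fun N => \sum_(k < N.+1) expR (- (lam i * (t - mesh t N k))) *
    ((T *m B *m W (mesh t N k.+1) w) i 0 - (T *m B *m W (mesh t N k) w) i 0)); last first.
  by apply/funext => N; apply: eq_bigr => k _; rewrite mulmxBr mx_subE.
apply: h => [||s /andP[s0 st]]; first exact: within_continuous_mulmx_coord.
  by rewrite W0 mulmx0 mxE.
have cXs : {within `[0, s], continuous (fun z => (T *m X z w) i 0)}.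
  exact: within_continuous_mulmx_coord.
rewrite {1}(Xeq s s0) !mulmxDr mulmxA !mx_addE; congr (_ + _ + _); rewrite mxE.
transitivity (\int[leb]_(z in `[0, s]) \sum_j T i j * (M *m X z w) j 0).
  rewrite Rintegral_sum//; last first.
    move=> j; have /itv_integrable iM := @within_continuous_mulmx_coord _ _ M _ s j cX.
    by apply: (integrableZl _ (T i j) iM).
  apply: eq_bigr => j _; rewrite mxE RintegralZl//.
  by apply: itv_integrable; exact: within_continuous_mulmx_coord.
rewrite -mulNr -RintegralZl//; last exact: itv_integrable.
apply: eq_Rintegral => z _.
have -> : \sum_j T i j * (M *m X z w) j 0 = (T *m M *m X z w) i 0 by rewrite -mulmxA mxE.
rewrite TM mulNmx mxE -mulmxA mxE (bigD1 i)//= big1 ?addr0; last first.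
  by move=> j ji; rewrite !mxE eq_sym (negbTE ji) mulr0n mul0r.
by rewrite !mxE eqxx mulr1n mulNr.
Qed.

Lemma ou_translation x (X Y : F -> {RV Pr >-> 'cV[F]_r}) :
  linear_sde M B W x X -> linear_sde M B W 0 Y ->
  {ae Pr, forall w, forall (t : F) i, 0 <= t ->
    (T *m X t w) i 0 = expR (- (lam i * t)) * (T *m x) i 0 + (T *m Y t w) i 0}.
Proof.
move=> /ou_pathwise hX /ou_pathwise hY; apply: filterS2 hX hY => w hX hY t i t0.
have T0 : (T *m (0 : 'cV[F]_r)) i 0 = 0 by rewrite mulmx0 mxE.
have := hX t i t0; have := hY t i t0; rewrite T0 mulr0 subr0.
move=> hy hx; rewrite -(cvg_lim _ hy)// (cvg_lim _ hx)//.
by rewrite addrC subrK.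
Qed.

Let e t i := expR (- (lam i * t)).

Let increment_mgf (s t c : F) (u : 'cV[F]_q) : 0 <= s <= t ->
  (\int[Pr]_w (expR (c * dotv u (W t w - W s w)))%:E =
    (expR (c ^+ 2 * ((t - s) * dotv u u) / 2))%:E)%E.
Proof.
move=> st; case: W_bm => _ _ /(_ _ _ st) g _.
have mz : measurable_fun setT (fun w => c * dotv u (W t w - W s w)).
  apply: measurable_funM => //.
  rewrite (_ : (fun w => _) = fun w => (u^T *m W t w) 0 0 - (u^T *m W s w) 0 0).
    apply: measurable_funB; apply: (measurableT_comp (measurable_mulmx_coord _ _));
    exact: measurable_funPT.
  by apply/funext => w; rewrite /dotv mulmxBr mx_subE.
have zE w : c * dotv u (W t w - W s w) = dotv (c *: u) (W t w - W s w).
  by rewrite /dotv linearZ /= -scalemxAl [RHS]mxE.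
have vE : dotv (c *: u) ((t - s)%:M *m (c *: u)) = c ^+ 2 * ((t - s) * dotv u u).
  by rewrite mul_scalar_mx scalerA !dotvE !mulr_sumr; apply: eq_bigr => j _; rewrite !mxE; ring.
rewrite -vE; apply: gauss1_mgf => //.
  rewrite vE mulr_ge0 ?sqr_ge0// mulr_ge0 ?dotvv_ge0// subr_ge0.
  by case/andP: st.
move=> D mD; have := g (c *: u) D mD; rewrite /pushforward => <-.
congr (Pr _); apply/seteqP; split => w /=; by rewrite zE.
Qed.

Lemma ou_riemann_mgf (u : 'I_r -> F) (t c : F) N : 0 <= t ->
  (\int[Pr]_w (expR (c * \sum_i u i * \sum_(k < N.+1) e (t - mesh t N k) i *
       (T *m B *m (W (mesh t N k.+1) w - W (mesh t N k) w)) i 0))%:E =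
   (expR (c ^+ 2 * (\sum_i u i ^+ 2 *
       \sum_(k < N.+1) (t / N.+1%:R * (2 * lam i) * e (t - mesh t N k) i ^+ 2)) / 2))%:E)%E.
Proof.
move=> t0.
pose cu (k : nat) : 'cV[F]_r := \col_i (u i * e (t - mesh t N k) i).
pose v k := (T *m B)^T *m cu k.
pose dW (k : 'I_N.+1) w : 'cV[F]_q := W (mesh t N k.+1) w - W (mesh t N k) w.
have mdW k : measurable_fun setT (dW k).
  apply: measurable_cV => j; rewrite /dW.
  rewrite (_ : (fun w => _) = fun w => W (mesh t N k.+1) w j 0 - W (mesh t N k) w j 0).
    apply: measurable_funB; apply: (measurableT_comp (measurable_coord _));
    exact: measurable_funPT.
  by apply/funext => w; rewrite !mxE.
have meshr (k : nat) : 0 <= mesh t N k <= mesh t N k.+1 by rewrite mesh_ge0//= mesh_le.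
have ind : mutually_independent Pr dW.
  case: W_bm => _ _ _ /(_ N.+1 (mesh t N)); apply; first exact: mesh_ge0.
  by move=> k; exact: mesh_le.
have := expectation_independent_prod mdW ind (g := fun k x => expR (c * dotv (v k) x))
  (e := fun k => expR (c ^+ 2 * ((mesh t N k.+1 - mesh t N k) * dotv (v k) (v k)) / 2)).
rewrite -expR_sum => h.
transitivity (\int[Pr]_w (\prod_(k < N.+1) expR (c * dotv (v k) (dW k w)))%:E)%E.
  apply: eq_integral => w _; rewrite -expR_sum -mulr_sumr; congr (expR (c * _))%:E.
  under eq_bigr do rewrite mulr_sumr.
  rewrite exchange_big /=; apply: eq_bigr => k _.
  rewrite /v dotv_mulmxl trmxK dotvE; apply: eq_bigr => i _.
  by rewrite [cu k i 0]mxE mulrA.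
rewrite h; last 3 first.
- move=> k; apply: measurableT_comp => //; apply: measurable_funM => //.
  exact: measurable_mulmx_coord.
- by move=> k x; exact: expR_ge0.
- by move=> k; exact: increment_mgf.
congr (expR _)%:E; rewrite -mulr_suml -mulr_sumr; congr (_ * _ / _).
under [RHS]eq_bigr do rewrite mulr_sumr.
rewrite exchange_big /=; apply: eq_bigr => k _.
rewrite meshS /v dotv_mulmxl trmxK mulmxA.
have -> : T *m B *m (T *m B)^T = 2 *: diag_mx (\row_i lam i).
  by rewrite -TBT trmx_mul !mulmxA.
rewrite dotvE mulr_sumr; apply: eq_bigr => i _.
rewrite -scalemxAl mx_scaleE [fun_of_matrix (_ *m _) i 0]mxE (bigD1 i)//= big1 ?addr0; last first.
  by move=> j ji; rewrite !mxE eq_sym (negbTE ji) mulr0n mul0r.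
rewrite !mxE eqxx mulr1n; ring.
Qed.

Lemma ou_mgf (Y : F -> {RV Pr >-> 'cV[F]_r}) : linear_sde M B W 0 Y ->
  forall (t : F), 0 <= t -> forall u : 'I_r -> F,
  (\int[Pr]_w (expR (\sum_i u i * (T *m Y t w) i 0))%:E =
   (expR (\sum_i u i ^+ 2 * (1 - e t i ^+ 2) / 2))%:E)%E.
Proof.
move=> sdeY t t0 u; rewrite -mulr_suml.
apply: (@gaussian_mgf_limit _ _ _ Pr
  (fun N w => \sum_i u i * \sum_(k < N.+1) e (t - mesh t N k) i *
     (T *m B *m (W (mesh t N k.+1) w - W (mesh t N k) w)) i 0) _
  (fun N => \sum_i u i ^+ 2 *
     \sum_(k < N.+1) (t / N.+1%:R * (2 * lam i) * e (t - mesh t N k) i ^+ 2))).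
- move=> N; apply: measurable_sum => i; apply: measurable_funM => //.
  apply: measurable_sum => k; apply: measurable_funM => //.
  rewrite (_ : (fun w => _) = fun w => (T *m B *m W (mesh t N k.+1) w) i 0 -
      (T *m B *m W (mesh t N k) w) i 0).
    apply: measurable_funB; apply: (measurableT_comp (measurable_mulmx_coord _ _));
    exact: measurable_funPT.
  by apply/funext => w; rewrite mulmxBr mx_subE.
- apply: measurable_sum => i; apply: measurable_funM => //.
  by apply: (measurableT_comp (measurable_mulmx_coord _ _)); exact: measurable_funPT.
- have := ou_pathwise sdeY; apply: filterS => w h.
  apply: cvg_big => [|i _]; first exact: add_continuous.
  have T0 : (T *m (0 : 'cV[F]_r)) i 0 = 0 by rewrite mulmx0 mxE.
  apply: cvgMr; have := h t i t0; rewrite T0 mulr0 subr0.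
  exact.
- by move=> N c; exact: ou_riemann_mgf.
- apply: cvg_big => [|i _]; first exact: add_continuous.
  by apply: cvgMr; exact: cvg_exp_riemann.
Qed.

End ornstein_uhlenbeck.

(** * Spectral expansion of the semigroup *)

Section orthonormal_systems.
Context (F : realType) d (T : measurableType d) (eta : probability T F).
Implicit Types f g : T -> F.

Lemma Lnorm2_sqn f : sqint eta f ->
  ('N[eta]_2%:E[EFin \o f] = (Num.sqrt (sqn eta f))%:E)%E.
Proof.
move=> Hf; rewrite unlock.
rewrite (_ : (\int[eta]_x _)%E = (sqn eta f)%:E).
  by rewrite poweR_EFin powR12_sqrt// sqn_ge0.
rewrite -sqn_EFin//; apply: eq_integral => x _ /=.
by rewrite powR_mulrn// real_normK ?num_real.
Qed.

Lemma Lfun2P f : f \in Lfun eta 2%:E <-> sqint eta f.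
Proof.
split=> [Hf|Hf].
  have mf : measurable_fun setT f by case/andP: Hf => /[!inE].
  split => //; exact: Lfun2_integrable_sqr.
apply/andP; split; first by rewrite inE /=; case: Hf.
by rewrite inE /= /finite_norm Lnorm2_sqn// ltry.
Qed.

Lemma L2_sumP (I : choiceType) (g : I -> T -> F) f :
  sqint eta f -> (forall i, sqint eta (g i)) ->
  (forall eps, 0 < eps -> exists J0 : {fset I}, forall J : {fset I}, (J0 `<=` J)%fset ->
     sqn eta (fun x => f x - \sum_(i <- J) g i x) <= eps) ->
  L2_sum eta g f.
Proof.
move=> Hf Hg small.
rewrite /L2_sum (_ : (fun J : {fset I} => _) = EFin \o
    (fun J : {fset I} => Num.sqrt (sqn eta (fun x => f x - \sum_(i <- J) g i x)))).
  have FT := @totally_filter I.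
  apply: cvg_EFin; first by exists fset0.
  apply/cvgrPdist_le => /= eps eps0.
  have [J0 J0P] := small (eps ^+ 2) (exprn_gt0 _ eps0).
  exists J0 => // J /J0P Jeps /=.
  rewrite sub0r normrN ger0_norm ?sqrtr_ge0//.
  by rewrite -[leRHS]ger0_norm ?(ltW eps0)// -sqrtr_sqr ler_wsqrtr.
apply/funext => J /=; rewrite -Lnorm2_sqn//.
by apply: sqintB => //; exact: sqint_sum.
Qed.

Lemma inner_sum (I : Type) (s : seq I) f (g : I -> T -> F) :
  sqint eta f -> (forall i, sqint eta (g i)) ->
  inner eta f (fun x => \sum_(i <- s) g i x) = \sum_(i <- s) inner eta f (g i).
Proof.
move=> Hf Hg; rewrite /inner -Rintegral_sum//; last by move=> i; exact: sqintM.
by apply: eq_Rintegral => x _; rewrite mulr_sumr.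
Qed.

Lemma innerDl f g h : sqint eta f -> sqint eta g -> sqint eta h ->
  inner eta (fun x => f x + g x) h = inner eta f h + inner eta g h.
Proof.
move=> Hf Hg Hh; rewrite /inner -RintegralD//; [|exact: sqintM..].
by apply: eq_Rintegral => x _; rewrite mulrDl.
Qed.

Lemma innerZl k f g : sqint eta f -> sqint eta g ->
  inner eta (fun x => k * f x) g = k * inner eta f g.
Proof.
move=> Hf Hg; rewrite /inner -RintegralZl//; last exact: sqintM.
by apply: eq_Rintegral => x _; rewrite mulrA.
Qed.

Lemma innerC f g : inner eta f g = inner eta g f.
Proof. by apply: eq_Rintegral => x _; rewrite mulrC. Qed.

Lemma innerff f : inner eta f f = sqn eta f.
Proof. by apply: eq_Rintegral => x _; rewrite expr2. Qed.

Lemma sqnD_orthogonal f g : sqint eta f -> sqint eta g -> inner eta f g = 0 ->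
  sqn eta (fun x => f x + g x) = sqn eta f + sqn eta g.
Proof.
move=> Hf Hg fg; have Hfg := sqintD Hf Hg.
rewrite -innerff innerDl// [inner _ f _]innerC [inner _ g _]innerC !innerDl//.
by rewrite !innerff [inner _ g f]innerC fg addr0 add0r.
Qed.

Context (I : choiceType) (e : I -> T -> F).
Hypothesis He : forall i, sqint eta (e i).
Hypothesis e_ortho : forall i j, inner eta (e i) (e j) = (i == j)%:R.

Definition proj (J : {fset I}) f x := \sum_(i <- J) inner eta f (e i) * e i x.

Lemma sqint_proj J f : sqint eta (proj J f).
Proof. by apply: sqint_sum => i; exact: sqintZ. Qed.

Lemma inner_proj J f j : j \in J -> inner eta (proj J f) (e j) = inner eta f (e j).
Proof.
move=> jJ; rewrite innerC inner_sum//; last by move=> i; exact: sqintZ.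
rewrite (big_fsetD1 j)//= innerC innerZl// e_ortho eqxx mulr1 big_seq big1 ?addr0// => i.
by rewrite !inE => /andP[/negbTE ij _]; rewrite innerC innerZl// e_ortho ij mulr0.
Qed.

Lemma bessel J f : sqint eta f -> sqn eta (fun x => f x - proj J f x) <= sqn eta f.
Proof.
move=> Hf; have HJ := sqint_proj J f; have HB := sqintB Hf HJ.
have o : inner eta (proj J f) (fun x => f x - proj J f x) = 0.
  rewrite innerC inner_sum//; last by move=> i; exact: sqintZ.
  rewrite big_seq big1// => i iJ; rewrite innerC innerZl// [X in _ * X]innerC.
  rewrite (_ : (fun x => f x - _) = fun x => f x + (-1) * proj J f x); last first.
    by apply/funext => x; rewrite mulN1r.
  rewrite innerDl//; last exact: sqintZ.
  by rewrite innerZl// inner_proj// mulN1r subrr mulr0.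
have -> : sqn eta f = sqn eta (fun x => (f x - proj J f x) + proj J f x).
  by congr (sqn eta _); apply/funext => x; rewrite subrK.
by rewrite [leRHS](sqnD_orthogonal HB HJ)// 1?innerC// lerDl sqn_ge0.
Qed.

Lemma proj_fix J i : i \in J -> forall x, proj J (e i) x = e i x.
Proof.
move=> iJ x; rewrite /proj (big_fsetD1 i)//= e_ortho eqxx mul1r big_seq big1 ?addr0// => j.
by rewrite !inE => /andP[ji _]; rewrite e_ortho eq_sym (negbTE ji) mul0r.
Qed.

Lemma projD J f g x : sqint eta f -> sqint eta g ->
  proj J (fun x => f x + g x) x = proj J f x + proj J g x.
Proof.
move=> Hf Hg; rewrite /proj -big_split /=.
by apply: eq_bigr => i _; rewrite innerDl// mulrDl.
Qed.

Lemma projZ J k f x : sqint eta f -> proj J (fun x => k * f x) x = k * proj J f x.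
Proof.
move=> Hf; rewrite /proj mulr_sumr.
by apply: eq_bigr => i _; rewrite innerZl// mulrA.
Qed.

Lemma proj_cvg (P : (T -> F) -> Prop) :
  (forall p, P p -> sqint eta p) ->
  (forall p, P p -> exists J0 : {fset I}, forall J : {fset I}, (J0 `<=` J)%fset ->
      forall x, proj J p x = p x) ->
  (forall f, sqint eta f -> forall eps, 0 < eps ->
      exists2 p, P p & sqn eta (fun x => f x - p x) <= eps) ->
  forall f, sqint eta f -> forall eps, 0 < eps ->
    exists J0 : {fset I}, forall J : {fset I}, (J0 `<=` J)%fset ->
      sqn eta (fun x => f x - proj J f x) <= eps.
Proof.
move=> HP projP dense f Hf eps eps0.
have [p Pp fp] := dense f Hf eps eps0; have Hp := HP p Pp.
have [J0 J0P] := projP p Pp; exists J0 => J /J0P pJ.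
apply: le_trans fp; apply: le_trans (bessel J (sqintB Hf Hp)).
rewrite le_eqVlt; apply/orP; left; apply/eqP; congr (sqn eta _); apply/funext => x.
rewrite (_ : (fun x => f x - p x) = fun x => f x + (-1) * p x); last first.
  by apply/funext => y; rewrite mulN1r.
rewrite projD//; last exact: sqintZ.
by rewrite projZ// pJ; ring.
Qed.

End orthonormal_systems.

Section averaging_operator.
Context (F : realType) dS (S : measurableType dS) dO (Om : measurableType dO).
Context (eta : probability S F) (Pr : probability Om F) (G : S * Om -> S).
Hypothesis mG : measurable_fun setT G.
Hypothesis invG : forall E, measurable E -> (eta \x Pr)%E (G @^-1` E) = eta E.
Implicit Types f : S -> F.

Definition averaging f x : F := \int[Pr]_w f (G (x, w)).

Lemma measurable_section f x : measurable_fun setT f ->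
  measurable_fun setT (fun w => f (G (x, w))).
Proof.
move=> mf; apply: (measurableT_comp mf).
exact: (measurable_fun_pair2 x mG).
Qed.

Lemma invariant_integral (h : S -> \bar F) : measurable_fun setT h ->
  (forall x, 0 <= h x)%E ->
  (\int[eta]_x h x = \int[eta]_x \int[Pr]_w h (G (x, w)))%E.
Proof.
move=> mh h0.
have mhG : measurable_fun setT (h \o G) by exact: measurableT_comp.
have h0G z : (0 <= (h \o G) z)%E by exact: h0.
transitivity (\int[(eta \x Pr)%E]_z (h \o G) z)%E.
  rewrite -[setT in RHS](@preimage_setT _ _ G) -(@ge0_integral_pushforward _ _ _ _ _ _ mG)//.
  by apply: eq_measure_integral => E mE _; exact/esym/invG.
by rewrite fubini_tonelli1.
Qed.

Lemma measurable_averaging f : measurable_fun setT f -> measurable_fun setT (averaging f).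
Proof.
move=> mf; apply: measurableT_comp; first exact: fine_measurable.
have mfG : measurable_fun setT (EFin \o f \o G).
  by apply: measurableT_comp => //; exact/measurable_EFinP.
rewrite (_ : (fun x => _) = (fun x => \int[Pr]_w (EFin \o f \o G)^\+%E (x, w)) \-
    (fun x => \int[Pr]_w (EFin \o f \o G)^\-%E (x, w)))%E.
  apply: emeasurable_funB.
    exact: (measurable_fun_fubini_tonelli_F _ (measurable_funepos mfG) (funepos_ge0 _)).
  exact: (measurable_fun_fubini_tonelli_F _ (measurable_funeneg mfG) (funeneg_ge0 _)).
apply/funext => x; rewrite integralE /=; congr (_ - _)%E; apply: eq_integral => w _.
  by rewrite !funeposE.
by rewrite !funenegE.
Qed.

Lemma sqr_Rintegral_le (h : Om -> F) : sqint Pr h -> (\int[Pr]_w h w) ^+ 2 <= sqn Pr h.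
Proof.
move=> Hh; set m := Rintegral _ _ _.
have ih := sqint_integrable Hh.
have i1 : Pr.-integrable setT (EFin \o (fun=> - m ^+ 2 : F)) by exact: finite_measure_integrable_cst.
have -> : m ^+ 2 = \int[Pr]_w (2 * m * h w - m ^+ 2).
  rewrite RintegralD//; last exact: integrableZR.
  rewrite RintegralZl// -/m Rintegral_cst//.
  have -> : fine (Pr [set: _]) = 1 by have := probability_setT Pr; rewrite /= => ->.
  by ring.
apply: le_Rintegral => //; [|by case: Hh|].
  by apply: integrable_addR => //; exact: integrableZR.
by move=> w _; have := sqr_ge0 (h w - m); rewrite -subr_ge0; nra.
Qed.

Lemma ae_sqint_section f : sqint eta f ->
  {ae eta, forall x, sqint Pr (fun w => f (G (x, w)))}.
Proof.
move=> Hf; have [mf fi] := Hf.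
have mh : measurable_fun setT (fun x => (f x ^+ 2)%:E).
  by apply/measurable_EFinP; exact: measurable_funX.
have h0 x : (0 <= (f x ^+ 2)%:E)%E by rewrite lee_fin sqr_ge0.
have mhG : measurable_fun setT ((fun x => (f x ^+ 2)%:E) \o G) by exact: measurableT_comp.
have mJ := @measurable_fun_fubini_tonelli_F _ _ _ _ F Pr _ mhG (fun z => h0 (G z)).
have iJ : eta.-integrable setT (fun x => \int[Pr]_w (f (G (x, w)) ^+ 2)%:E)%E.
  apply/integrableP; split; first exact: mJ.
  under eq_integral do rewrite gee0_abs ?integral_ge0//.
  by rewrite -(invariant_integral mh h0) sqn_EFin// ltry.
have := integrable_ae measurableT iJ; apply: filterS => x /(_ I) fin.
split; first exact: measurable_section.
apply/integrableP; split.
  by apply/measurable_EFinP; apply: measurable_funX; exact: measurable_section.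
under eq_integral do rewrite gee0_abs ?lee_fin ?sqr_ge0//.
by rewrite ltey_eq fin.
Qed.

Lemma averaging_contraction f : sqint eta f ->
  sqint eta (averaging f) /\ sqn eta (averaging f) <= sqn eta f.
Proof.
move=> Hf; have [mf fi] := Hf.
have mA := measurable_averaging mf.
have mh : measurable_fun setT (fun x => (f x ^+ 2)%:E).
  by apply/measurable_EFinP; exact: measurable_funX.
have h0 x : (0 <= (f x ^+ 2)%:E)%E by rewrite lee_fin sqr_ge0.
have mhG : measurable_fun setT ((fun x => (f x ^+ 2)%:E) \o G) by exact: measurableT_comp.
have mJ := @measurable_fun_fubini_tonelli_F _ _ _ _ F Pr _ mhG (fun z => h0 (G z)).
have le : (\int[eta]_x (averaging f x ^+ 2)%:E <= (sqn eta f)%:E)%E.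
  rewrite -sqn_EFin// (invariant_integral mh h0).
  apply: ae_ge0_le_integral => //.
  - by move=> x _; rewrite lee_fin sqr_ge0.
  - by apply/measurable_EFinP; exact: measurable_funX.
  - by move=> x _; exact: integral_ge0.
  have := ae_sqint_section Hf; apply: filterS => x Hx _.
  by rewrite sqn_EFin// lee_fin sqr_Rintegral_le.
have Ha : sqint eta (averaging f).
  split => //; apply/integrableP; split.
    by apply/measurable_EFinP; exact: measurable_funX.
  under eq_integral do rewrite gee0_abs ?lee_fin ?sqr_ge0//.
  exact: le_lt_trans le (ltry _).
by split => //; rewrite -lee_fin -sqn_EFin.
Qed.

Lemma averagingB (I : choiceType) (J : {fset I}) f (g : I -> S -> F) x :
  Pr.-integrable setT (EFin \o (fun w => f (G (x, w)))) ->
  (forall i, Pr.-integrable setT (EFin \o (fun w => g i (G (x, w))))) ->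
  averaging (fun x => f x - \sum_(i <- J) g i x) x =
  averaging f x - \sum_(i <- J) averaging (g i) x.
Proof.
move=> Hf Hg; rewrite /averaging RintegralB//.
  by rewrite Rintegral_sum.
exact: integrable_sumR.
Qed.

End averaging_operator.

Lemma centered_gaussian_std (F : realType) (r : nat) (T V : 'M[F]_r)
    (eta : probability 'cV[F]_r F) :
  T *m V *m T^T = 1%:M -> centered_gaussian eta V -> std_gaussian T eta.
Proof.
move=> TVT g u; pose v := T^T *m \col_i u i.
have vE x : dotv v x = \sum_i u i * (T *m x) i 0.
  by rewrite dotv_mulmxl trmxK dotvE; apply: eq_bigr => i _; rewrite mxE.
have vv : dotv v (V *m v) = \sum_i u i ^+ 2.
  rewrite dotv_mulmxl trmxK /v !mulmxA TVT mul1mx dotvE.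
  by apply: eq_bigr => i _; rewrite !mxE expr2.
transitivity (\int[eta]_x (expR (dotv v x))%:E)%E.
  by apply: eq_integral => x _; rewrite vE.
rewrite (@gauss1_mgf _ _ _ eta (dotv v) (\sum_i u i ^+ 2)).
- by congr (expR _)%:E; rewrite mulr_suml; apply: eq_bigr => i _; rewrite mulr1.
- by rewrite sumr_ge0// => i _; exact: sqr_ge0.
- rewrite (_ : dotv v = fun x => \sum_i u i * (T *m x) i 0); last exact/funext.
  by apply: measurable_sum => i; apply: measurable_funM => //; exact: measurable_mulmx_coord.
- by move=> D mD; rewrite -vv; exact: g.
Qed.

Section mehler_semigroup.
Context (F : realType) (r : nat) (T : 'M[F]_r) (e : 'I_r -> F).
Hypothesis Tu : T \in unitmx.
Context (eta : probability 'cV[F]_r F) (eta_std : std_gaussian T eta).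
Context dO (Om : measurableType dO) (Pr : probability Om F) (Y : Om -> 'cV[F]_r).
Hypothesis mY : measurable_fun setT Y.
Hypothesis Y_mgf : forall u : 'I_r -> F,
  (\int[Pr]_w (expR (\sum_i u i * (T *m Y w) i 0))%:E =
   (expR (\sum_i u i ^+ 2 * (1 - e i ^+ 2) / 2))%:E)%E.
Local Notation multi := {ffun 'I_r -> nat}.

Definition mehler_map (z : 'cV[F]_r * Om) : 'cV[F]_r :=
  invmx T *m (diag_mx (\row_i e i) *m (T *m z.1)) + Y z.2.

Lemma mehler_mapE x w i :
  (T *m mehler_map (x, w)) i 0 = e i * (T *m x) i 0 + (T *m Y w) i 0.
Proof.
by rewrite /mehler_map /= mulmxDr mulKVmx// mx_addE mul_diag_mx mxE [in X in X * _]mxE.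
Qed.

Lemma measurable_mehler_map : measurable_fun setT mehler_map.
Proof.
apply: measurable_cV => i.
rewrite (_ : (fun z => _) = fun z : 'cV[F]_r * Om =>
    (invmx T *m diag_mx (\row_i e i) *m T *m z.1) i 0 + Y z.2 i 0); last first.
  by apply/funext => z; rewrite /mehler_map mx_addE !mulmxA.
apply: measurable_funD.
  exact: (measurableT_comp (measurable_mulmx_coord _ i) measurable_fst).
exact: (measurableT_comp (measurableT_comp (measurable_coord i) mY) measurable_snd).
Qed.

Let my i : measurable_fun setT (fun x : 'cV[F]_r => (T *m x) i 0).
Proof. exact: measurable_mulmx_coord. Qed.

Let G : {RV (eta \x Pr)%E >-> 'cV[F]_r} := mfun_Sub (mem_set measurable_mehler_map).

Lemma mehler_map_std : std_gaussian T (distribution (eta \x Pr)%E G).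
Proof.
move=> u.
have mexp : measurable_fun setT (fun x : 'cV[F]_r => (expR (\sum_i u i * (T *m x) i 0))%:E).
  apply/measurable_EFinP; apply: measurableT_comp => //.
  by apply: measurable_sum => i; exact: measurable_funM.
rewrite ge0_integral_distribution//.
have mexpG := measurableT_comp mexp measurable_mehler_map.
have expG0 z : (0 <= ((fun x : 'cV[F]_r => (expR (\sum_i u i * (T *m x) i 0))%:E) \o mehler_map) z)%E.
  by rewrite /= lee_fin expR_ge0.
rewrite (fubini_tonelli1 _ mexpG expG0).
pose c := expR (\sum_i u i ^+ 2 * (1 - e i ^+ 2) / 2).
transitivity (\int[eta]_x (c%:E * (expR (\sum_i (u i * e i) * (T *m x) i 0))%:E))%E.
  apply: eq_integral => x _; rewrite /fubini_F /=.
  transitivity (\int[Pr]_w ((expR (\sum_i (u i * e i) * (T *m x) i 0))%:E *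
      (expR (\sum_i u i * (T *m Y w) i 0))%:E))%E.
    apply: eq_integral => w _; rewrite -EFinM -expRD -big_split /=; congr (expR _)%:E.
    by apply: eq_bigr => i _; rewrite mehler_mapE mulrDr mulrA.
  rewrite ge0_integralZl//; last first.
    apply/measurable_EFinP; apply: measurableT_comp => //.
    apply: measurable_sum => i; apply: measurable_funM => //.
    exact: (measurableT_comp (my i) mY).
  by rewrite Y_mgf muleC.
rewrite ge0_integralZl//; last 2 first.
- apply/measurable_EFinP; apply: measurableT_comp => //.
  by apply: measurable_sum => i; exact: measurable_funM.
- by rewrite lee_fin expR_ge0.
rewrite eta_std -EFinM -expRD -big_split /=; congr (expR _)%:E.
by apply: eq_bigr => i _; field.
Qed.

Lemma mehler_invariant E : measurable E ->
  (eta \x Pr)%E (mehler_map @^-1` E) = eta E.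
Proof.
move=> mE.
exact: (@std_gaussian_unique F r T Tu (distribution (eta \x Pr)%E G) eta mehler_map_std eta_std E mE).
Qed.

Lemma mehler_hfun n x :
  Pr.-integrable setT (EFin \o (fun w => hfun T n (mehler_map (x, w)))) /\
  averaging Pr mehler_map (hfun T n) x = (\prod_i e i ^+ n i) * hfun T n x.
Proof.
have mTY i : measurable_fun setT (fun w => (T *m Y w) i 0).
  exact: (measurableT_comp (my i) mY).
have [i1 i2] := @hermite_mehler _ _ _ Pr _ _ _ mTY Y_mgf
  (fun i => (T *m x) i 0) e (fun i => erefl) n.
have E w : hfun T n (mehler_map (x, w)) =
    \prod_i hcoef (n i) (e i * (T *m x) i 0 + (T *m Y w) i 0).
  by apply: eq_bigr => i _; rewrite mehler_mapE.
split; first by under eq_fun do rewrite E.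
rewrite /averaging; under eq_Rintegral do rewrite E.
by rewrite i2 big_split.
Qed.

Definition nhfun (n : multi) (x : 'cV[F]_r) : F := Num.sqrt (mfact n)%:R * hfun T n x.

Lemma sqint_nhfun n : sqint eta (nhfun n).
Proof.
apply: sqintZ; apply: (sqint_hspan (std_gaussian_exp Tu eta_std)).
exact: hspan_hfun.
Qed.

Lemma nhfun_orthonormal m n : inner eta (nhfun m) (nhfun n) = (m == n)%:R.
Proof.
have Hh k : sqint eta (hfun T k).
  by apply: (sqint_hspan (std_gaussian_exp Tu eta_std)); exact: hspan_hfun.
rewrite /nhfun innerZl//; last exact: sqintZ.
rewrite innerC innerZl// /inner.
rewrite (hermite_orthogonal my eta_std (fun=> erefl)).
have [->|mn] := eqVneq m n; last first.
  have [i mni] : exists i, m i != n i.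
    apply/existsP; rewrite -negb_forall; apply: contra mn => /forallP h.
    by apply/eqP/ffunP => i; apply/eqP; exact: h.
  by rewrite (bigD1 i)//= (negbTE mni) mul0r mul0r !mulr0.
under eq_bigr do rewrite eqxx mul1r.
rewrite prodfV -natr_prod mulrA -expr2 sqr_sqrtr ?ler0n// mulfV//.
by rewrite pnatr_eq0 -lt0n prodn_gt0// => i; exact: fact_gt0.
Qed.

Lemma nhfun_complete f : sqint eta f -> forall eps, 0 < eps ->
  exists J0 : {fset multi}, forall J : {fset multi}, (J0 `<=` J)%fset ->
    sqn eta (fun x => f x - proj eta nhfun J f x) <= eps.
Proof.
have Hp p : hspan T p -> sqint eta p by exact: (sqint_hspan (std_gaussian_exp Tu eta_std)).
apply: (proj_cvg sqint_nhfun nhfun_orthonormal Hp); last first.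
  by move=> f' Hf'; exact: (hermite_density Tu (std_gaussian_exp Tu eta_std) Hf').
move=> p; elim=> [|c n g gs [J0 IH]].
  exists fset0 => J _ x; rewrite /proj big1// => i _.
  rewrite (_ : inner _ _ _ = 0) ?mul0r// /inner.
  by under eq_Rintegral do rewrite mul0r; rewrite Rintegral_cst// mul0r.
exists (n |` J0)%fset => J; rewrite fsubUset fsub1set => /andP[nJ J0J] x.
have s0 : Num.sqrt (mfact n)%:R != 0 :> F.
  by rewrite gt_eqF// sqrtr_gt0 ltr0n prodn_gt0// => i; exact: fact_gt0.
rewrite (_ : (fun x => _) = fun x => c / Num.sqrt (mfact n)%:R * nhfun n x + g x); last first.
  by apply/funext => y; rewrite /nhfun mulrA divfK.
rewrite projD//; [|exact: sqint_nhfun|exact/sqintZ/sqint_nhfun|exact: Hp].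
rewrite projZ//; [|exact: sqint_nhfun..].
rewrite (proj_fix nhfun_orthonormal nJ) IH//.
by rewrite /nhfun mulrA divfK.
Qed.

Lemma mehler_nhfun n x :
  averaging Pr mehler_map (nhfun n) x = (\prod_i e i ^+ n i) * nhfun n x.
Proof.
have [i1 i2] := mehler_hfun n x.
rewrite /averaging /nhfun RintegralZl//; move: i2; rewrite /averaging => ->.
by rewrite mulrCA.
Qed.

Theorem mehler_expansion f : sqint eta f ->
  L2_sum eta (fun (n : multi) x => (\prod_i e i ^+ n i) * inner eta f (nhfun n) * nhfun n x)
    (averaging Pr mehler_map f).
Proof.
move=> Hf; have mG := measurable_mehler_map.
have [Ha _] := averaging_contraction mG mehler_invariant Hf.
have Hs (n : multi) : sqint eta (fun x => (\prod_i e i ^+ n i) * inner eta f (nhfun n) * nhfun n x).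
  exact/sqintZ/sqint_nhfun.
apply: L2_sumP => // eps eps0.
have [J0 J0P] := nhfun_complete Hf eps0; exists J0 => J /J0P; apply: le_trans.
have Hp := sqint_proj sqint_nhfun J f.
have [Hc] := averaging_contraction mG mehler_invariant (sqintB Hf Hp).
apply: le_trans; rewrite le_eqVlt; apply/orP; left; apply/eqP; congr fine.
apply: ae_eq_integral => //.
- by apply/measurable_EFinP; apply: measurable_funX; case: (sqintB Ha (sqint_sum J Hs)).
- by apply/measurable_EFinP; apply: measurable_funX; case: Hc.
have := ae_sqint_section mG mehler_invariant Hf; apply: filterS => x Hx _.
have Hn (n : multi) : Pr.-integrable setT (EFin \o (fun w => nhfun n (mehler_map (x, w)))).
  by apply: integrableZR; case: (mehler_hfun n x).
congr (_ ^+ 2)%:E; rewrite /proj averagingB//; last 2 first.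
- exact: sqint_integrable.
- by move=> n; exact: integrableZR.
congr (_ - _); apply: eq_bigr => n _.
rewrite /averaging RintegralZl//.
have := mehler_nhfun n x; rewrite /averaging => ->.
by rewrite mulrA [X in X * _]mulrC.
Qed.

End mehler_semigroup.

Lemma integral_pushforward_ae (F : realType) dO (Om : measurableType dO)
    (Pr : probability Om F) dS (S : measurableType dS)
    (X : {RV Pr >-> S}) (G : Om -> S) (f : S -> \bar F) :
  measurable_fun setT G -> measurable_fun setT f -> {ae Pr, forall w, X w = G w} ->
  (\int[distribution Pr X]_y f y = \int[Pr]_w f (G w))%E.
Proof.
move=> mG mf XG.
have ge0 (h : S -> \bar F) : measurable_fun setT h -> (forall y, 0 <= h y)%E ->
    (\int[distribution Pr X]_y h y = \int[Pr]_w h (G w))%E.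
  move=> mh h0; rewrite ge0_integral_distribution//.
  apply: ge0_ae_eq_integral => //.
  - by apply: measurableT_comp => //; exact: measurable_funPT.
  - exact: measurableT_comp.
  - by move=> w _; exact: h0.
  - by apply: filterS XG => w /= -> _.
rewrite integralE [RHS]integralE; congr (_ - _)%E.
  rewrite ge0//; last exact: measurable_funepos.
  by apply: eq_integral => w _; rewrite !funeposE.
rewrite ge0//; last exact: measurable_funeneg.
by apply: eq_integral => w _; rewrite !funenegE.
Qed.

Lemma integrable_distribution_ae (F : realType) dO (Om : measurableType dO)
    (Pr : probability Om F) dS (S : measurableType dS)
    (X : {RV Pr >-> S}) (G : Om -> S) (f : S -> \bar F) :
  measurable_fun setT G -> measurable_fun setT f -> {ae Pr, forall w, X w = G w} ->
  Pr.-integrable setT (f \o G) -> (distribution Pr X).-integrable setT f.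
Proof.
move=> mG mf XG /integrableP[_ fi]; apply/integrableP; split => //.
rewrite (integral_pushforward_ae mG _ XG)//.
exact: measurableT_comp.
Qed.

Theorem theorem3p5 (F : realType) (r : nat) (r_ge1 : (1 <= r)%N)
  (A R S : 'M[F]_r) (R_psd : psdmx R) (S_psd : psdmx S)
  (rkAS : rank_condition A R S)
  (R_pd : pdmx R) (AR : A *m R = R *m A^T)
  (Pinf Qinf : 'M[F]_r)
  (Pinf_pd : pdmx Pinf) (Pinf_sol : riccati A R S Pinf)
  (Qinf_pd : pdmx Qinf) (Qinf_sol : riccati A^T S R Qinf)
  (* the h-process *)
  (q : nat) (B : 'M[F]_(r, q)) (BB : B *m B^T = R)
  (d : measure_display) (Om : measurableType d) (Pr : probability Om F)
  (W : F -> {RV Pr >-> 'cV[F]_q}) (W_bm : brownian W)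
  (X : 'cV[F]_r -> F -> {RV Pr >-> 'cV[F]_r})
  (X_sde : forall x, linear_sde (A - R *m Qinf) B W x (X x))
  (eta : probability 'cV[F]_r F)
  (Z : 'M[F]_r) (lam : 'I_r -> F)
  (H : {ffun 'I_r -> nat} -> 'cV[F]_r -> F) (H_hermite : hermite_family H) :
  let Ph := invmx (invmx Pinf + Qinf) in
  let C := pos_sqrt (A *m A + R *m S) in
  let Lam := - (invmx (psd_sqrt Ph) *m C *m psd_sqrt Ph) in
  centered_gaussian eta Ph ->
  (forall i, 0 < lam i) ->
  (forall i j : 'I_r, (i <= j)%N -> lam i <= lam j) ->
  char_poly (A *m A + R *m S) = \prod_i ('X - (lam i ^+ 2)%:P) ->
  Z^T *m Z = 1%:M ->
  (forall i, Lam *m col i Z = - lam i *: col i Z) ->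
  let phi := fun (n : {ffun 'I_r -> nat}) (x : 'cV[F]_r) =>
    (Num.sqrt (mfact n)%:R)^-1 * H n (Z^T *m invmx (psd_sqrt Ph) *m x) in
  let lamn := fun n : {ffun 'I_r -> nat} => \sum_i (n i)%:R * lam i in
  let K := kernel_op X in
  [/\ orthonormal_basis eta phi,
      forall (t : F) (n : {ffun 'I_r -> nat}), 0 <= t ->
        {ae eta, forall x,
           (distribution Pr (X x t)).-integrable setT (EFin \o phi n) /\
           K t (phi n) x = expR (- lamn n * t) * phi n x} &
      forall (t : F) (f : 'cV[F]_r -> F), 0 <= t -> f \in Lfun eta 2%:E ->
        [/\ {ae eta, forall x,
               (distribution Pr (X x t)).-integrable setT (EFin \o f)},
            K t f \in Lfun eta 2%:E &
            L2_sum eta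
              (fun n x => expR (- lamn n * t) * inner eta f (phi n) * phi n x)
              (K t f)]].
Proof.
move=> Ph C Lam eta_g lam0 _ _ ZZ LamZ phi lamn K.
pose T := Z^T *m invmx (psd_sqrt Ph).
have [Tu TPT TM TRT] := spectral_coordinates r_ge1 R_pd AR Pinf_pd Pinf_sol
  Qinf_pd Qinf_sol lam0 ZZ LamZ.
rewrite -/T -/Ph in Tu TPT TM TRT.
have TBT : T *m (B *m B^T) *m T^T = 2 *: diag_mx (\row_i lam i) by rewrite BB.
have eta_std := centered_gaussian_std TPT eta_g.
have phiE n : phi n = nhfun T n.
  apply/funext => x; rewrite /phi (hermite_familyE H_hermite) big_split /=.
  rewrite -natr_prod -/(mfact n) mulrA; congr (_ * _).
  have s0 : Num.sqrt (mfact n)%:R != 0 :> F.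
    by rewrite gt_eqF// sqrtr_gt0 ltr0n prodn_gt0// => i; exact: fact_gt0.
  by apply: (mulfI s0); rewrite mulVKf// -expr2 sqr_sqrtr// ler0n.
have {phiE}-> : phi = nhfun T by exact/funext.
have expE (t : F) n : expR (- lamn n * t) = \prod_i expR (- (lam i * t)) ^+ n i.
  rewrite /lamn mulNr -mulrN mulr_suml expR_sum; apply: eq_bigr => i _.
  by rewrite -mulrA -expRM_natl mulrN.
pose Y (t : F) : Om -> 'cV[F]_r := X 0 t.
have mY t : measurable_fun setT (Y t) by exact: measurable_funPT.
pose G (t : F) := mehler_map T (fun i => expR (- (lam i * t))) (Y t).
have Ymgf (t : F) : 0 <= t -> forall u : 'I_r -> F,
    (\int[Pr]_w (expR (\sum_i u i * (T *m Y t w) i 0))%:E =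
     (expR (\sum_i u i ^+ 2 * (1 - expR (- (lam i * t)) ^+ 2) / 2))%:E)%E.
  by move=> t0; exact: (ou_mgf lam0 TM TBT W_bm (X_sde 0) t0).
have mG t x : measurable_fun setT (fun w => G t (x, w)).
  exact: (measurable_fun_pair2 x (measurable_mehler_map _ _ (mY t))).
have XG (t : F) x : 0 <= t -> {ae Pr, forall w, X x t w = G t (x, w)}.
  move=> t0; have := ou_translation lam0 TM W_bm (X_sde x) (X_sde 0).
  apply: filterS => w h; rewrite -[LHS](mulKmx Tu) -[RHS](mulKmx Tu); congr (_ *m _).
  by apply/colP => i; rewrite h// mehler_mapE.
have KE (t : F) f x : 0 <= t -> measurable_fun setT f ->
    K t f x = averaging Pr (G t) f x.
  move=> t0 mf; congr fine.
  apply: (integral_pushforward_ae (mG t x) _ (XG t x t0)); exact/measurable_EFinP.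
split.
- split=> [n|m n|f /Lfun2P Hf].
  + by apply/Lfun2P; exact: sqint_nhfun.
  + exact: nhfun_orthonormal.
  + apply: L2_sumP => //; first by move=> n; exact/sqintZ/sqint_nhfun.
    exact: nhfun_complete.
- move=> t n t0; apply: aeW => x.
  have [mn _] := sqint_nhfun Tu eta_std n.
  have [hi _] := mehler_hfun Tu (mY t) (Ymgf t t0) n x.
  split; last by rewrite KE// mehler_nhfun// ?expE//; exact: Ymgf.
  apply: (integrable_distribution_ae (mG t x)) => //; [exact/measurable_EFinP|exact: XG|].
  exact: integrableZR.
- move=> t f t0 /Lfun2P Hf; have [mf _] := Hf.
  have mGt := measurable_mehler_map T (fun i => expR (- (lam i * t))) (mY t).
  have inv := mehler_invariant Tu eta_std (mY t) (Ymgf t t0).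
  have KfE : K t f = averaging Pr (G t) f by apply/funext => x; exact: KE.
  split.
  + have := ae_sqint_section mGt inv Hf; apply: filterS => x Hx.
    apply: (integrable_distribution_ae (mG t x)) => //; [exact/measurable_EFinP|exact: XG|].
    exact: sqint_integrable.
  + by rewrite KfE; apply/Lfun2P; case: (averaging_contraction mGt inv Hf).
  + rewrite KfE (_ : (fun n x => _) = fun (n : {ffun 'I_r -> nat}) (x : 'cV[F]_r) =>
      (\prod_i expR (- (lam i * t)) ^+ n i) * inner eta f (nhfun T n) * nhfun T n x).
      exact: (mehler_expansion Tu eta_std (mY t) (Ymgf t t0) Hf).
    by apply/funext => n; rewrite expE.
Qed.
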